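(* Let $\mathcal{X} \in \mathbb{R}^{I_1 \times \cdots \times I_N}$ be a (low-rank) real $N$-way tensor. Let $k \geq 2$ be a target rank and $p \geq 2$ an oversampling parameter (the same for each mode), and put $l = k+p$, where $l \le I_n$ for every $n=1,\dots,N$. Let $\mathbf{Q}_1,\dots,\mathbf{Q}_N$, with $\mathbf{Q}_n \in \mathbb{R}^{I_n\times l}$, be the random matrices with orthonormal columns produced from $\mathcal{X}$ by the randomized tensor compression algorithm (described in the context) with standard Gaussian test matrices and no power iterations. Then $$\mathbb{E}\,\bigl\| \mathcal{X} - \mathcal{X} \times_1 \mathbf{Q}_1\mathbf{Q}_1^\top \times_2 \cdots \times_N \mathbf{Q}_N\mathbf{Q}_N^\top \bigr\|_F \;\leq\; \sqrt{1 + \frac{k}{p-1}} \cdot \sqrt{\sum_{n=1}^{N}\sum_{j>k}\sigma_{nj}^2},$$ where $\sigma_{nj}$ denotes the $j$-th largest singular value of the mode-$n$ unfolding $\mathcal{X}_{(n)}$ of $\mathcal{X}$, and the expectation is over the random test matrices.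
   Context: Notation. For an $N$-way tensor $\mathcal{X}\in\mathbb{R}^{I_1\times\cdots\times I_N}$, $\mathcal{X}_{(n)}\in\mathbb{R}^{I_n\times\prod_{i\ne n} I_i}$ denotes its mode-$n$ unfolding, i.e. the matrix whose columns are the mode-$n$ fibers of $\mathcal{X}$ (the vectors obtained by fixing all indices except the $n$-th), in some fixed order. For a matrix $\mathbf{M}$ with $I_n$ columns, the $n$-mode product $\mathcal{X}\times_n\mathbf{M}$ is the tensor obtained by multiplying every mode-$n$ fiber of $\mathcal{X}$ by $\mathbf{M}$; equivalently $(\mathcal{X}\times_n\mathbf{M})_{(n)}=\mathbf{M}\,\mathcal{X}_{(n)}$. $\|\cdot\|_F$ is the Frobenius norm (square root of the sum of the squares of all entries). Singular values are listed in decreasing order with multiplicity; $\sum_{j>k}$ runs over all singular values of index larger than $k$ (an empty sum is $0$). ''Low-rank'' is used informally: the tensor rank of $\mathcal{X}$ (the smallest number of rank-one tensors summing to $\mathcal{X}$) is much smaller than the dimensions of $\mathcal{X}$. No quantitative condition is attached to it. Randomized tensor compression algorithm (input: $\mathcal{X}$, $k$, $p$; no power iterations). Set $l=k+p$ and $\mathcal{B}=\mathcal{X}$. For $n=1,\dots,N$ in turn: (i) let $J_n$ be the number of columns of the mode-$n$ unfolding $\mathcal{B}_{(n)}\in\mathbb{R}^{I_n\times J_n}$ of the current tensor $\mathcal{B}$, and draw a random test matrix $\mathbf{\Omega}_n\in\mathbb{R}^{J_n\times l}$ with independent standard Gaussian entries, independent of all earlier draws; (ii) form the sketch $\mathbf{Y}_n=\mathcal{B}_{(n)}\mathbf{\Omega}_n\in\mathbb{R}^{I_n\times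 l}$; (iii) compute the economic QR decomposition $\mathbf{Y}_n=\mathbf{Q}_n\mathbf{R}_n$, so that $\mathbf{Q}_n\in\mathbb{R}^{I_n\times l}$ has orthonormal columns and its column space contains that of $\mathbf{Y}_n$ (with equality when $\mathbf{Y}_n$ has full column rank); $\mathbf{Q}_n$ is taken to be a fixed measurable function of $\mathbf{Y}_n$; (iv) replace $\mathcal{B}$ by $\mathcal{B}\times_n\mathbf{Q}_n^\top$. The output is the compressed tensor $\mathcal{B}\in\mathbb{R}^{l\times\cdots\times l}$ and the matrices $\mathbf{Q}_1,\dots,\mathbf{Q}_N$. *)

(* Defs.v *)
From mathcomp Require Import all_boot all_order all_algebra.
From mathcomp Require Import polyrcf.
From mathcomp Require Import all_classical all_reals all_analysis.

Set Implicit Arguments.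
Unset Strict Implicit.
Unset Printing Implicit Defensive.

Import Order.TTheory GRing.Theory Num.Theory.
Import numFieldNormedType.Exports.

Local Open Scope ring_scope.

Definition midx N (d : 'I_N -> nat) := {dffun forall m : 'I_N, 'I_(d m)}.

Definition tensor (R : Type) N (d : 'I_N -> nat) := {ffun midx d -> R}.

Definition frobenius_norm (R : realType) N (d : 'I_N -> nat) (X : tensor R d) : R :=
  Num.sqrt (\sum_i X i ^+ 2).

(* A mode-n fiber is specified by all the indices except the n-th. *)
Definition fidx N (d : 'I_N -> nat) (n : 'I_N) :=
  {dffun forall m : {m : 'I_N | m != n}, 'I_(d (val m))}.

Definition insert_idx N (d : 'I_N -> nat) (n : 'I_N) (j : 'I_(d n))
    (c : fidx d n) : midx d :=
  [ffun m => match eqVneq m n with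
             | EqNotNeq h => cast_ord (congr1 d (esym h)) j
             | NeqNotEq h => c (exist _ m h)
             end].

(* When the shapes d and d' agree off n, the mode-n fibers of tensors of
   shapes d' and d are indexed in the same way. *)
Definition fiber_of N (d d' : 'I_N -> nat) (n : 'I_N)
    (E : forall m, m != n -> d' m = d m) (i : midx d') : fidx d n :=
  [ffun m => cast_ord (E (val m) (valP m)) (i (val m))].

(* Column c is the fiber of rank c in the enumeration of the fibers. *)
Definition unfolding (R : Type) N (d : 'I_N -> nat) (n : 'I_N) (X : tensor R d) :
    'M[R]_(d n, #|fidx d n|) :=
  \matrix_(j, c) X (insert_idx j (enum_val c)).

Definition mode_prod (R : realType) N (d d' : 'I_N -> nat) (n : 'I_N)
    (E : forall m, m != n -> d' m = d m) (M : 'M[R]_(d' n, d n))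
    (X : tensor R d) : tensor R d' :=
  [ffun i : midx d' => \sum_(j < d n) M (i n) j * X (insert_idx j (fiber_of E i))].

Definition multi_mode_prod (R : realType) N (d : 'I_N -> nat)
    (M : forall n : 'I_N, 'M[R]_(d n)) (X : tensor R d) : tensor R d :=
  foldl (fun Y n => mode_prod (fun _ _ => erefl) (M n) Y) X (enum 'I_N).

Lemma card_fidx N (d : 'I_N -> nat) (n : 'I_N) :
  #|fidx d n| = (\prod_(m < N | m != n) d m)%N.
Proof.
rewrite card_dep_ffun foldrE big_map big_enum /=.
rewrite (eq_bigr (fun m : {m : 'I_N | m != n} => d (val m))); last first.
  by move=> m _; rewrite card_ord.
rewrite (reindex_omap (val : {m : 'I_N | m != n} -> 'I_N) insub) /=; last first.
  by move=> m mn; rewrite insubT.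
by apply: eq_bigl => -[m mn] /=; rewrite insubT mn /= eqxx.
Qed.

Lemma unfolding_mode_prod (R : realType) N (d : 'I_N -> nat) (n : 'I_N)
    (M : 'M[R]_(d n)) (X : tensor R d) :
  unfolding n (mode_prod (fun _ _ => erefl) M X) = M *m unfolding n X.
Proof.
apply/matrixP => i c; rewrite !mxE ffunE; apply: eq_bigr => j _; rewrite mxE.
have -> : insert_idx i (enum_val c) n = i.
  rewrite ffunE; case: eqVneq => [h|h]; last by case/eqP: (h).
  by apply: val_inj.
congr (_ * X (insert_idx _ _)); apply/ffunP => m; rewrite !ffunE.
case: eqVneq => [h|h]; first by case/negP: (valP m); apply/eqP.
apply: val_inj => /=; case: m h => m h0 /= h.
by rewrite (bool_irrelevance h0 h).
Qed.

(* The square roots of the eigenvalues of A A^T, repeated according to their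
   multiplicities and in decreasing order.  [rootsR] is increasing.  If A has
   more rows than columns, [take] drops the superfluous zero eigenvalues. *)
Definition singular_values (R : realType) m n (A : 'M[R]_(m, n)) : seq R :=
  let p := char_poly (A *m A^T) in
  take (minn m n)
    [seq Num.sqrt x | x <- rev (flatten [seq nseq (mup x p) x | x <- rootsR p])].

Definition economic_qr (R : realType) m l
    (Y Q : 'M[R]_(m, l)) (U : 'M[R]_l) : Prop :=
  [/\ Q^T *m Q = 1%:M, is_trig_mx U^T & Y = Q *m U].

(* The shape of the tensor once its first n modes have been compressed. *)
Definition cshape N (I : 'I_N -> nat) (l n : nat) : 'I_N -> nat :=
  fun m => if (m < n)%N then l else I m.

Lemma cshape_self N (I : 'I_N -> nat) l (n : 'I_N) : cshape I l n n = I n.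
Proof. by rewrite /cshape ltnn. Qed.

Lemma cshape_next N (I : 'I_N -> nat) l (n : 'I_N) : cshape I l n.+1 n = l.
Proof. by rewrite /cshape ltnSn. Qed.

Lemma cshape_off N (I : 'I_N -> nat) l (n m : 'I_N) :
  m != n -> cshape I l n.+1 m = cshape I l n m.
Proof. by rewrite /cshape ltnS [in RHS]ltn_neqAle -val_eqE => ->. Qed.

Definition ncols N (I : 'I_N -> nat) l (n : 'I_N) : nat := #|fidx (cshape I l n) n|.

(* [qr n] is the map sending the sketch of mode n to its orthonormal factor. *)
Definition step_factor (R : realType) N (I : 'I_N -> nat) l
    (qr : forall n : 'I_N, 'M[R]_(I n, l) -> 'M[R]_(I n, l))
    (Om : forall n : 'I_N, 'M[R]_(ncols I l n, l))
    (n : 'I_N) (B : tensor R (cshape I l n)) : 'M[R]_(I n, l) :=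
  qr n (castmx (cshape_self I l n, erefl) (unfolding n B *m Om n)).

Definition step_tensor (R : realType) N (I : 'I_N -> nat) l (n : 'I_N)
    (Q : 'M[R]_(I n, l)) (B : tensor R (cshape I l n)) :
    tensor R (cshape I l n.+1) :=
  mode_prod (@cshape_off N I l n)
    (castmx (esym (cshape_next I l n), esym (cshape_self I l n)) Q^T) B.

Fixpoint rtc_tensor (R : realType) N (I : 'I_N -> nat) l
    (qr : forall n : 'I_N, 'M[R]_(I n, l) -> 'M[R]_(I n, l))
    (Om : forall n : 'I_N, 'M[R]_(ncols I l n, l))
    (X : tensor R I) (n : nat) : (n <= N)%N -> tensor R (cshape I l n) :=
  match n with
  | 0 => fun _ => X
  | n'.+1 => fun h : (n' < N)%N =>
      let B := rtc_tensor qr Om X (ltnW h) in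
      @step_tensor R N I l (Ordinal h) (@step_factor R N I l qr Om (Ordinal h) B) B
  end.

Definition rtc_factor (R : realType) N (I : 'I_N -> nat) l
    (qr : forall n : 'I_N, 'M[R]_(I n, l) -> 'M[R]_(I n, l))
    (Om : forall n : 'I_N, 'M[R]_(ncols I l n, l))
    (X : tensor R I) (n : 'I_N) : 'M[R]_(I n, l) :=
  step_factor qr Om (rtc_tensor qr Om X (ltnW (ltn_ord n))).

Local Open Scope classical_set_scope.

(* Generators of the Borel sigma-algebra on matrices. *)
Definition mx_cylinders (R : realType) m n : set (set 'M[R]_(m, n)) :=
  [set C | exists i j (A : set R),
     measurable A /\ C = (fun M : 'M[R]_(m, n) => M i j) @^-1` A].

Definition measurable_mx_fun (R : realType) m n m' n'
    (f : 'M[R]_(m, n) -> 'M[R]_(m', n')) : Prop :=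
  measurable_fun setT
    (f : g_sigma_algebraType (@mx_cylinders R m n) ->
         g_sigma_algebraType (@mx_cylinders R m' n')).

Definition mutually_independent d (T : measurableType d) (R : realType)
    (P : probability T R) (K : finType) (X : K -> {RV P >-> R}) : Prop :=
  forall (J : {set K}) (A : K -> set R), (forall k, measurable (A k)) ->
    P (\bigcap_(k in [set` J]) (X k @^-1` A k)) =
    \big[*%E/1%E]_(k in J) P (X k @^-1` A k).

Definition standard_gaussian d (T : measurableType d) (R : realType)
    (P : probability T R) (X : {RV P >-> R}) : Prop :=
  forall A : set R, measurable A -> distribution P X A = normal_prob 0 1 A.

Definition gaussian_test_matrices d (T : measurableType d) (R : realType)
    (P : probability T R) N (r : 'I_N -> nat) (l : nat)
    (Om : forall n : 'I_N, 'I_(r n) -> 'I_l -> {RV P >-> R}) : Prop :=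
  (forall n i j, standard_gaussian (Om n i j)) /\
  mutually_independent
    (fun k : {n : 'I_N & ('I_(r n) * 'I_l)%type} =>
       Om (tag k) (tagged k).1 (tagged k).2).

Definition sample_mx d (T : measurableType d) (R : realType)
    (P : probability T R) m l (Om : 'I_m -> 'I_l -> {RV P >-> R}) (w : T) :
    'M[R]_(m, l) :=
  \matrix_(i, j) Om i j w.

(* Main.v *)
(* The Q_n have orthonormal columns, so the squared error telescopes: it is the
   sum over n of |A_n - Q_n Q_n^T A_n|^2, where A_n is the mode-n unfolding of
   the tensor already compressed along the modes before n.  That tensor is the
   image of X under contractions acting on the other modes; hence, V being
   formed by the k leading left singular vectors of the unfolding X_(n),
   |A_n - V^T V A_n|^2 is at most the tail of the squared singular values of
   X_(n).  Since the earlier draws are independent of the n-th one, it remains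
   to show E |A - Q Q^T A|^2 <= (1 + k/(p-1)) |A - V^T V A|^2 for a fixed matrix
   A and to conclude with Jensen's inequality.

   For this range-finder bound, a product U of Givens rotations (which preserve
   Gaussian families) makes V A U^T vanish off its first k columns.  Write
   A U^T = [A1 A2], let G, H be the corresponding blocks of the rotated test
   matrix, and C = (G G^T + eps)^-1.  As Q Q^T A is the best approximation of A
   in the range of Q, comparison with the sketch times [G^T C  0] gives
   |A - Q Q^T A|^2 <= |A2|^2 + |eps A1 C - A2 H G^T C|^2.  Averaging over H
   bounds the second term by (eps |A1|^2 + |A2|^2) tr C.  The i-th diagonal
   entry of C is at most 1 / (D + eps), where D, the squared distance from row i
   of G to the span of the other rows, dominates a chi-square with p + 1 degrees
   of freedom; the inverse moment 1/(p-1) of the latter is the integral of its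
   Laplace transform.  Finally eps tends to 0.  Keeping eps > 0 makes G G^T + eps
   invertible everywhere, and not just almost surely. *)
Require Import Defs.
From mathcomp Require Import all_boot all_order all_algebra.
From mathcomp Require Import all_classical all_reals all_analysis.
From mathcomp Require Import measurable_realfun.
From mathcomp Require Import ring lra zify.
From mathcomp Require Import polyrcf.
From mathcomp Require complex.
Import Order.TTheory GRing.Theory Num.Theory.
Import numFieldNormedType.Exports.
Set Implicit Arguments.
Unset Strict Implicit.
Unset Printing Implicit Defensive.
Local Open Scope classical_set_scope.
Local Open Scope ring_scope.

(** * Integration against the normal law *)

(** The rotation invariance of Gaussian families is needed only for products of Givens rotations. A
    plane rotation splits into two substitutions, each affine in one variable, so that Lebesgue
    measure on the line and Fubini's theorem suffice. Elimination by such rotations then serves four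
    times: it deflates an eigenvector in the spectral theorem, turns a linear form in Gaussians into
    a multiple of a single one, straightens the rows of G other than row i, and confines V A U^T to
    its first columns. Conditioning takes the form of resampling: some coordinates are redrawn from
    an independent copy, which leaves the expectation unchanged, and the inner integral is bounded
    for each outcome of the others. All integrands stay nonnegative, so no integrability has to be
    checked. As for the constant, at most k - 1 rows of G differ from row i, so at least p + 1 of
    the k + p dimensions remain; integrating (1 + 2t)^(-(p+1)/2) over t >= 0 gives 1/(p-1). *)

Definition image_measure d d' (T : measurableType d) (T' : measurableType d')
    (R : realType) (mu : {measure set T -> \bar R}) (f : T -> T')
    (mf : measurable_fun setT f) : {measure set T' -> \bar R} :=
  measure_function_pushforward__canonical__measure_function_Measure mu mf.

Section density.
Local Open Scope ereal_scope.
Context d (T : measurableType d) (R : realType).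
Variables (mu nu : {measure set T -> \bar R}) (g : T -> R).
Hypothesis mg : measurable_fun setT g.
Hypothesis g0 : forall x, (0 <= g x)%R.
Hypothesis nuE : forall A, measurable A -> nu A = \int[mu]_(x in A) (g x)%:E.

Import HBNNSimple.

(** Both sides agree on indicators by [nuE], hence on simple functions, and monotone convergence
    along [nnsfun_approx] gives the rest. *)
Lemma ge0_integral_density (f : T -> \bar R) : measurable_fun setT f ->
  (forall x, 0 <= f x) -> \int[nu]_x f x = \int[mu]_x (f x * (g x)%:E).
Proof.
move=> mf f0.
have indicE A : measurable A -> \int[nu]_x (\1_A x)%:E = \int[mu]_x ((\1_A x)%:E * (g x)%:E).
  move=> mA; rewrite integral_indic// setIT nuE// integral_mkcond.
  apply: eq_integral => x _; rewrite patchE indicE.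
  by case: ifPn => xA; rewrite ?mul1e ?mul0e.
have nnsE (h : {nnsfun T >-> R}) :
    \int[nu]_x (h x)%:E = \int[mu]_x ((h x)%:E * (g x)%:E).
  under [LHS]eq_integral do rewrite fimfunE -fsumEFin//.
  rewrite [LHS]ge0_integral_fsum//; last 2 first.
    - by move=> r; exact/measurable_EFinP/measurableT_comp.
    - by move=> n x _; rewrite EFinM nnfun_muleindic_ge0.
  under [RHS]eq_integral.
    move=> x xD; rewrite fimfunE -fsumEFin// ge0_mule_fsuml; last first.
      by move=> r; rewrite EFinM nnfun_muleindic_ge0.
    over.
  rewrite [RHS]ge0_integral_fsum//; last 2 first.
    - move=> r; apply: emeasurable_funM; last exact/measurable_EFinP.
      by apply/measurable_EFinP; do 2 apply/measurableT_comp => //.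
    - by move=> n x _; apply: mule_ge0; rewrite ?lee_fin// -lee_fin EFinM nnfun_muleindic_ge0.
  apply: eq_fsbigr => r _.
  (* A negative [r] is not a value of the nonnegative [h], so its level set is empty. *)
  have [r0|r0] := leP 0%R r; last first.
    rewrite !integral0_eq// => x _; rewrite preimage_nnfun0// indic0 mulr0 ?mul0e//.
  under eq_integral do rewrite EFinM.
  under [RHS]eq_integral do rewrite EFinM -muleA.
  rewrite [LHS]ge0_integralZl//; last by apply/measurable_EFinP.
  rewrite [RHS]ge0_integralZl//; last 2 first.
  - by apply: emeasurable_funM; apply/measurable_EFinP.
  - by move=> x _; rewrite mule_ge0 ?lee_fin//.
  by rewrite indicE.
pose f_ := nnsfun_approx measurableT mf.
transitivity (limn (fun n => \int[nu]_x (f_ n x)%:E)).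
  rewrite -monotone_convergence//=.
  - apply: eq_integral => x _; apply/esym/cvg_lim => //=.
    exact: cvg_nnsfun_approx.
  - by move=> n; apply: measurableT_comp => //; exact: measurable_funTS.
  - by move=> n x _; rewrite lee_fin.
  - by move=> x _ a b ab; rewrite lee_fin//; exact/lefP/nd_nnsfun_approx.
under eq_fun do rewrite nnsE.
rewrite -monotone_convergence//=.
- apply: eq_integral => x _; apply/cvg_lim => //.
  apply: cvgeZr => //; exact: cvg_nnsfun_approx.
- by move=> n; apply: emeasurable_funM; last exact/measurable_EFinP; exact/measurable_EFinP/measurable_funTS.
- by move=> n x _; rewrite mule_ge0 ?lee_fin//.
- move=> x _ a b ab; rewrite lee_wpmul2r// lee_fin//; exact/lefP/nd_nnsfun_approx.
Qed.

End density.

Section gauss1.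
Context {R : realType}.
Local Notation mu := (@lebesgue_measure R).
Local Notation gam := (@normal_prob R 0 1).
Local Notation phi := (@normal_pdf R 0 1).

Lemma ge0_integral_normal (f : R -> \bar R) : measurable_fun setT f ->
  (forall x, 0 <= f x)%E -> (\int[gam]_x f x = \int[mu]_x (f x * (phi x)%:E))%E.
Proof.
move=> mf f0; apply: ge0_integral_density => //.
- exact: measurable_normal_pdf.
- by move=> x; rewrite normal_pdf_ge0.
Qed.

(** The rescaled image measure agrees with [mu] on half-open intervals, and these determine [mu]. *)
Lemma lebesgue_measure_affine (a b : R) (A : set R) : a != 0 -> measurable A ->
  (mu A = `|a|%:E * mu ((fun x => a * x + b)%R @^-1` A))%E.
Proof.
move=> a0 mA.
have mf : measurable_fun setT (fun x : R => a * x + b).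
  by apply: measurable_funD => //; exact: measurable_funM.
have k0 : 0 <= `|a| by [].
pose m := mscale (NngNum k0) (@image_measure _ _ (measurableTypeR R) (measurableTypeR R) _ mu _ mf).
rewrite [LHS](@lebesgue_measure_unique _ m)// => X [[x y] xy <-] /=.
rewrite /m /mscale /= /pushforward.
have [ap|an|/eqP] := ltgtP 0 a; last by rewrite eq_sym (negbTE a0).
- rewrite (_ : _ @^-1` _ = `]((x - b) / a), ((y - b) / a)]%classic); last first.
    apply/seteqP; split=> z /=; rewrite !in_itv /= ltr_pdivrMr// ler_pdivlMr//.
      by rewrite ltrBlDr lerBrDr mulrC.
    by rewrite ltrBlDr lerBrDr mulrC.
  rewrite !lebesgue_measure_itv /= !lte_fin ltr_pM2r ?invr_gt0// ltrD2r.
  case: ifPn => _; last by rewrite mule0.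
  rewrite -!EFinD -EFinM; congr EFin; rewrite gtr0_norm//; field; exact: a0.
(* A negative slope exchanges the end points, so the preimage is closed on the left. *)
- rewrite (_ : _ @^-1` _ = `[((y - b) / a), ((x - b) / a)[%classic); last first.
    apply/seteqP; split=> z /=; rewrite !in_itv /= ltr_ndivlMr// ler_ndivrMr//.
      by rewrite andbC ltrBlDr lerBrDr mulrC.
    by rewrite andbC ltrBlDr lerBrDr mulrC.
  rewrite !lebesgue_measure_itv /= !lte_fin ltr_nM2r ?invr_lt0// ltrD2r.
  case: ifPn => _; last by rewrite mule0.
  rewrite -!EFinD -EFinM; congr EFin; rewrite ltr0_norm//; field; exact: a0.
Qed.

Lemma ge0_integral_affine (a b : R) (f : R -> \bar R) : a != 0 ->
  measurable_fun setT f -> (forall x, 0 <= f x)%E ->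
  (\int[mu]_x f x = `|a|%:E * \int[mu]_x f (a * x + b)%R)%E.
Proof.
move=> a0 mf f0.
have mf1 : measurable_fun setT (fun x : R => a * x + b).
  by apply: measurable_funD => //; exact: measurable_funM.
have k0 : 0 <= `|a| by [].
pose m := mscale (NngNum k0) (@image_measure _ _ (measurableTypeR R) (measurableTypeR R) _ mu _ mf1).
transitivity (\int[m]_x f x)%E.
  apply: eq_measure_integral => // A mA _.
  by first [exact: (lebesgue_measure_affine b a0 mA) | exact: (esym (lebesgue_measure_affine b a0 mA))].
by rewrite /m ge0_integral_mscale//= ge0_integral_pushforward.
Qed.

End gauss1.

Section gauss2.
Context {R : realType}.
Local Notation mu := (@lebesgue_measure R).
Local Notation gam := (@normal_prob R 0 1).
Local Notation phi := (@normal_pdf R 0 1).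
Local Notation RR := (measurableTypeR R).

Definition rot (c s : R) (z : RR * RR) : RR * RR :=
  (c * z.1 - s * z.2, s * z.1 + c * z.2).

Lemma measurable_rot c s : measurable_fun setT (rot c s).
Proof.
have m1 : measurable_fun setT (fun z : RR * RR => z.1 : R) by exact: measurable_fst.
have m2 : measurable_fun setT (fun z : RR * RR => z.2 : R) by exact: measurable_snd.
have mr1 : measurable_fun setT (fun z : RR * RR => c * z.1 - s * z.2 : R).
  by apply: measurable_funB; apply: measurable_funM.
have mr2 : measurable_fun setT (fun z : RR * RR => s * z.1 + c * z.2 : R).
  by apply: measurable_funD; apply: measurable_funM.
by apply: measurable_fun_pair; [exact: mr1|exact: mr2].
Qed.

Lemma normal_pdf01E (x : R) : phi x = normal_peak 1 * expR (- (x ^+ 2 / 2)).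
Proof.
by rewrite normal_pdfE ?oner_neq0// /normal_fun subr0 expr1n mulNr.
Qed.

Lemma ge0_integral_normal2 (h : RR * RR -> \bar R) :
  measurable_fun setT h -> (forall z, 0 <= h z)%E ->
  (\int[gam \x gam]_z h z =
   \int[mu]_x \int[mu]_y (h (x, y) * (phi x * phi y)%:E))%E.
Proof.
move=> mh h0.
have mphi := @measurable_normal_pdf R 0 1.
rewrite fubini_tonelli1// ge0_integral_normal//; last 2 first.
- exact: measurable_fun_fubini_tonelli_F.
- by move=> x; apply: integral_ge0.
apply: eq_integral => x _; rewrite /fubini_F.
have mhx : measurable_fun setT (fun y : RR => h (x, y)) by exact: measurableT_comp.
rewrite ge0_integral_normal// -ge0_integralZr//=; last 3 first.
- by apply: emeasurable_funM => //; exact/measurable_EFinP.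
- by move=> y _; rewrite mule_ge0// lee_fin normal_pdf_ge0.
- by rewrite lee_fin normal_pdf_ge0.
by apply: eq_integral => y _; rewrite -muleA -EFinM [(phi y * _)%R]mulrC.
Qed.

(** Substitute u = c x - s y at fixed y, then v = (s/c) u + y/c at fixed u. Both substitutions are
    affine in one variable, and their Jacobians |c| and 1/|c| cancel; hence the assumption
    [c != 0]. *)
Lemma ge0_integral_rot (h : RR * RR -> \bar R) (c s : R) :
  c != 0 -> c ^+ 2 + s ^+ 2 = 1 ->
  measurable_fun setT h -> (forall z, 0 <= h z)%E ->
  (\int[mu]_x \int[mu]_y h (c * x - s * y, s * x + c * y)%R
   = \int[mu]_x \int[mu]_y h (x, y))%E.
Proof.
move=> c0 cs1 mh h0.
have mrot := measurable_rot c s.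
have mhr : measurable_fun setT (fun z : RR * RR => h (c * z.1 - s * z.2, s * z.1 + c * z.2)).
  exact: (measurableT_comp mh mrot).
rewrite (@fubini_tonelli _ _ _ _ _ mu mu _ mhr) //=.
pose h1 y u := h (u, s / c * u + y / c).
have mh1 : measurable_fun setT (fun z : RR * RR => h1 z.1 z.2).
  have m1 : measurable_fun setT (fun z : RR * RR => z.1 : R) by exact: measurable_fst.
  have m2 : measurable_fun setT (fun z : RR * RR => z.2 : R) by exact: measurable_snd.
  have m3 : measurable_fun setT (fun z : RR * RR => s / c * z.2 + z.1 / c : R).
    by apply: measurable_funD; apply: measurable_funM.
  by apply: (measurableT_comp mh); apply: measurable_fun_pair; [exact: m2|exact: m3].
have nc0 : 0 < `|c| by rewrite normr_gt0.
transitivity (\int[mu]_y (`|c|^-1%:E * \int[mu]_u h1 y u))%E.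
  apply: eq_integral => y _.
  rewrite [X in _ = (_ * X)%E](@ge0_integral_affine R c (- (s * y)))//; last 2 first.
  - exact: (measurable_fun_pair2 (y : RR) mh1).
  - by move=> u; exact: h0.
  rewrite muleA -EFinM mulVf ?gt_eqF// mul1e; apply: eq_integral => x _.
  rewrite /h1; congr (h (_, _)).
  have e : s ^+ 2 = 1 - c ^+ 2 by rewrite -cs1; ring.
  transitivity (s * x + (1 - s ^+ 2) * y / c); last by field; exact: c0.
  by rewrite e; field; exact: c0.
rewrite ge0_integralZl//=; last 2 first.
- exact: (@measurable_fun_fubini_tonelli_F _ _ _ _ _ mu _ mh1 (fun z => h0 _)).
- by move=> y _; apply: integral_ge0 => z _; exact: h0.
rewrite (@fubini_tonelli _ _ _ _ _ mu mu _ mh1 (fun z => h0 _)) /=.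
rewrite -ge0_integralZl//=; last 2 first.
- exact: (@measurable_fun_fubini_tonelli_G _ _ _ _ _ mu _ mh1 (fun z => h0 _)).
- by move=> y _; apply: integral_ge0 => z _; exact: h0.
apply: eq_integral => u _.
rewrite [in RHS](@ge0_integral_affine R c^-1 (s / c * u)) ?invr_eq0//; last first.
  exact: (measurable_fun_pair2 (u : RR) mh).
rewrite normfV; congr (_ * _)%E; apply: eq_integral => y _.
by rewrite /h1; congr (h (_, _)); rewrite addrC [y / c]mulrC.
Qed.

(** The joint density depends only on x^2 + y^2, which [rot] preserves, so the invariance of
    Lebesgue measure suffices. *)
Lemma normal_prod_rot (c s : R) (E : set (RR * RR)) :
  c != 0 -> c ^+ 2 + s ^+ 2 = 1 -> measurable E ->
  (gam \x gam)%E (rot c s @^-1` E) = (gam \x gam)%E E.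
Proof.
move=> c0 cs1 mE.
have mrot := measurable_rot c s.
have mphi := @measurable_normal_pdf R 0 1.
have mI : measurable_fun setT (fun z : RR * RR => (\1_E z)%:E : \bar R).
  by apply/measurable_EFinP; exact: measurable_indic.
have mfE : measurable (rot c s @^-1` E).
  by rewrite -[X in measurable X]setTI; exact: mrot.
transitivity (\int[gam \x gam]_z (\1_(rot c s @^-1` E) z)%:E)%E.
  by rewrite (integral_indic _ measurableT mfE) setIT.
transitivity (\int[gam \x gam]_z (\1_E z)%:E)%E; last first.
  by rewrite (integral_indic _ measurableT mE) setIT.
have mI' : measurable_fun setT (fun z : RR * RR => (\1_(rot c s @^-1` E) z)%:E : \bar R).
  by apply/measurable_EFinP; exact: measurable_indic.
rewrite (ge0_integral_normal2 mI'); last by move=> z; rewrite lee_fin.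
rewrite (ge0_integral_normal2 mI); last by move=> z; rewrite lee_fin.
have mh : measurable_fun setT (fun z : RR * RR =>
    ((\1_E z)%:E * (phi z.1 * phi z.2)%:E)%E : \bar R).
  apply: emeasurable_funM => //; apply/measurable_EFinP.
  have m1 : measurable_fun setT (fun z : RR * RR => z.1 : R) by exact: measurable_fst.
  have m2 : measurable_fun setT (fun z : RR * RR => z.2 : R) by exact: measurable_snd.
  apply: measurable_funM; first exact: (measurableT_comp mphi m1).
  exact: (measurableT_comp mphi m2).
rewrite -[RHS](ge0_integral_rot c0 cs1 mh); last first.
  by move=> z; rewrite mule_ge0 ?lee_fin// mulr_ge0// normal_pdf_ge0.
apply: eq_integral => x _; apply: eq_integral => y _ /=.
congr (_ * _%:E)%E.
rewrite !normal_pdf01E mulrACA [RHS]mulrACA; congr (_ * _).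
rewrite -!expRD; congr expR.
have e : c ^+ 2 = 1 - s ^+ 2 by rewrite -cs1; ring.
by rewrite !sqrrD !exprMn sqrrN !exprMn e; ring.
Qed.

End gauss2.

(** * Independent standard Gaussian families *)

(** Boxes constrain all coordinates at once, which makes them stable under intersection: a finite
    measure is then determined by its values on them. *)
Definition boxes (R : realType) (K : finType) : set (set (K -> R)) :=
  [set C | exists A : K -> set R,
     (forall k, measurable (A k)) /\ C = [set x | forall k, A k (x k)]].
Arguments boxes : clear implicits.

Definition famR (R : realType) (K : finType) := g_sigma_algebraType (boxes R K).

Section famR.
Context {R : realType} {K : finType}.

Lemma measurable_coord (k : K) : measurable_fun setT (fun x : famR R K => x k : R).
Proof.
move=> _ B mB; rewrite setTI; apply: sub_sigma_algebra.
exists (fun i => if i == k then B else setT); split => [i|]; first by case: ifP.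
apply/seteqP; split => [x Bx i /=|x /(_ k)]; last by rewrite eqxx.
by case: eqP => // ->.
Qed.

Lemma measurable_famP d (S : measurableType d) (Y : S -> K -> R) :
  (forall k, measurable_fun setT (fun s => Y s k)) ->
  measurable_fun setT (Y : S -> famR R K).
Proof.
move=> mY; apply: (@measurability _ _ S (famR R K) setT _ (boxes R K)) => //.
move=> _ [C [A [mA ->]] <-]; rewrite setTI.
rewrite (_ : _ @^-1` _ = \bigcap_(k in [set: K]) ((fun s => Y s k) @^-1` A k)).
  apply: fin_bigcap_measurable => [|k _]; first exact: finite_finset.
  by rewrite -[X in measurable X]setTI; exact: mY.
by apply/seteqP; split => [s /= h k _|s h k]; [exact: h|exact: (h k Logic.I)].
Qed.

End famR.

Section iid.
Context {R : realType}.
Local Notation gam := (@normal_prob R 0 1).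

(** A single product formula over all of [K] encodes both independence and the marginal laws; taking
    [A k = setT] recovers it for subfamilies. *)
Definition iid_gaussian d (T : measurableType d) (P : {measure set T -> \bar R})
    (K : finType) (X : K -> T -> R) : Prop :=
  (forall k, measurable_fun setT (X k)) /\
  forall A : K -> set R, (forall k, measurable (A k)) ->
    P [set w | forall k, A k (X k w)] = \big[*%E/1%E]_k gam (A k).

(** The joint law is determined on boxes, so an expectation may be computed on any space carrying
    such a family, in particular on a product space. *)
Lemma iid_gaussian_transfer d1 d2 (T1 : measurableType d1) (T2 : measurableType d2)
    (P1 : {measure set T1 -> \bar R}) (P2 : {measure set T2 -> \bar R})
    (K : finType) (X1 : K -> T1 -> R) (X2 : K -> T2 -> R) (f : famR R K -> \bar R) :
  iid_gaussian P1 X1 -> iid_gaussian P2 X2 ->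
  measurable_fun setT f -> (forall x, 0 <= f x)%E ->
  (\int[P1]_w f (fun k => X1 k w) = \int[P2]_w f (fun k => X2 k w))%E.
Proof.
move=> [mX1 PX1] [mX2 PX2] mf f0.
have mY1 := measurable_famP (Y := fun w k => X1 k w) mX1.
have mY2 := measurable_famP (Y := fun w k => X2 k w) mX2.
transitivity (\int[image_measure P1 mY1]_x f x)%E.
  by rewrite [RHS]ge0_integral_pushforward.
transitivity (\int[image_measure P2 mY2]_x f x)%E; last first.
  by rewrite [LHS]ge0_integral_pushforward.
apply: eq_measure_integral => // A mA _; move: A mA.
have boxT : boxes R K setT.
  by exists (fun=> setT); split => //; apply/seteqP; split.
apply: (@g_sigma_algebra_measure_unique _ R (famR R K) (boxes R K) _ (fun=> setT)) => //.
- by move=> C hC; exact: sub_sigma_algebra.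
- by apply/seteqP; split => // x _; exists 0%N.
- move=> _ _ [A [mA ->]] [B [mB ->]]; exists (fun k => A k `&` B k); split.
    by move=> k; exact: measurableI.
  by apply/seteqP; split => [x [hA hB] k|x h]; [split|split=> k; have [] := h k].
- move=> _ [A [mA ->]]; rewrite /image_measure /= /pushforward.
  by rewrite [LHS](PX1 A mA) [RHS](PX2 A mA).
- move=> _; rewrite /image_measure /= /pushforward.
  have -> : P1 ((fun w k => X1 k w) @^-1` [set: famR R K])
     = \big[*%E/1%E]_(k : K) gam setT.
    by rewrite -(PX1 (fun=> setT))//; congr (P1 _); apply/seteqP; split.
  by rewrite big1 ?ltry// => k _; exact: probability_setT.
Qed.

Lemma iid_gaussian_sub d (T : measurableType d) (P : {measure set T -> \bar R})
    (K L : finType) (h : L -> K) (X : K -> T -> R) : injective h ->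
  iid_gaussian P X -> iid_gaussian P (fun l => X (h l)).
Proof.
move=> injh [mX PX]; split=> [l|A mA]; first exact: mX.
(* This is [A l] at [h l], and the whole line off the image of [h]. *)
pose B k := [set x | forall l, h l = k -> A l x].
have BhE l : B (h l) = A l.
  by apply/seteqP; split => [x /(_ l erefl)//|x Ax l' /injh ->].
have BE k : k \notin (h @: [set: L]%SET) -> B k = setT.
  move=> kh; apply/seteqP; split => // x _ l hl.
  by case/negP: kh; apply/imsetP; exists l; rewrite ?hl.
have mB k : measurable (B k).
  have [/imsetP[l _ ->]|/BE ->//] := boolP (k \in (h @: [set: L]%SET)).
  by rewrite BhE.
rewrite (_ : [set w | _] = [set w | forall k, B k (X k w)]).
  rewrite PX// (bigID (mem (h @: [set: L]%SET))) /=.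
  rewrite [X in (_ * X)%E]big1 ?mule1; last first.
    by move=> k kh; rewrite BE//; exact: probability_setT.
  rewrite big_imset /=; last by move=> ? ? _ _; exact: injh.
  by apply: eq_big => [l|l _]; rewrite ?inE// BhE.
apply/seteqP; split => w H.
  by move=> k l lk; rewrite -lk.
by move=> l; exact: (H (h l) l erefl).
Qed.

(** The coordinates selected by [a] and the remaining ones may live on two factors of a product
    space. Together with [iid_gaussian_transfer], this turns conditioning into Fubini's theorem. *)
Lemma iid_gaussian_decouple d1 d2 (T1 : measurableType d1) (T2 : measurableType d2)
    (P1 : probability T1 R) (P2 : probability T2 R)
    (K : finType) (a : pred K) (X1 : K -> T1 -> R) (X2 : K -> T2 -> R) :
  iid_gaussian P1 X1 -> iid_gaussian P2 X2 ->
  iid_gaussian (P1 \x P2)%E (fun k z => if a k then X1 k z.1 else X2 k z.2).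
Proof.
move=> [mX1 PX1] [mX2 PX2]; split => [k|A mA].
  by case: (a k); apply: measurableT_comp => //; exact: mX1.
pose A1 k := if a k then A k else setT.
pose A2 k := if a k then setT else A k.
have mA1 k : measurable (A1 k) by rewrite /A1; case: ifP.
have mA2 k : measurable (A2 k) by rewrite /A2; case: ifP.
have mb d (T : measurableType d) (X : K -> T -> R) (B : K -> set R) :
    (forall k, measurable (B k)) -> (forall k, measurable_fun setT (X k)) ->
    measurable [set w | forall k, B k (X k w)].
  move=> mB mX; rewrite (_ : [set w | _] =
    (fun w k => X k w) @^-1` ([set x | forall k, B k (x k)] : set (famR R K))) //.
  rewrite -[X in measurable X]setTI; apply: (measurable_famP (Y := fun w k => X k w) mX) => //.
  by apply: sub_sigma_algebra; exists B.
rewrite (_ : [set w | _] = [set w | forall k, A1 k (X1 k w)] `*` [set w | forall k, A2 k (X2 k w)]).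
  transitivity (P1 [set w | forall k, A1 k (X1 k w)] *
                P2 [set w | forall k, A2 k (X2 k w)])%E.
    by apply: product_measure1E; exact: mb.
  rewrite [X in (X * _)%E](PX1 A1 mA1) [X in (_ * X)%E](PX2 A2 mA2) -big_split /=.
  apply: eq_bigr => k _; rewrite /A1 /A2; case: ifP => _.
    by rewrite [X in (_ * X)%E](@probability_setT _ _ _ gam) mule1.
  by rewrite [X in (X * _)%E](@probability_setT _ _ _ gam) mul1e.
apply/seteqP; split => -[w1 w2] /=.
  by move=> h; split => k; have := h k; rewrite /A1 /A2; case: (a k).
by move=> [h1 h2] k; have := h1 k; have := h2 k; rewrite /A1 /A2; case: (a k).
Qed.

End iid.

(** * Givens rotations *)

Section givens.
Context {R : realType}.
Local Notation gam := (@normal_prob R 0 1).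
Local Notation RR := (measurableTypeR R).

Lemma iid_gaussian_givens d (T : measurableType d) (P : probability T R)
    (K : finType) (X : K -> T -> R) (i j : K) (c s : R) :
  i != j -> c != 0 -> c ^+ 2 + s ^+ 2 = 1 -> iid_gaussian P X ->
  iid_gaussian P (fun k w =>
    if k == i then c * X i w - s * X j w else
    if k == j then s * X i w + c * X j w else X k w).
Proof.
move=> ij c0 cs1 [mX PX]; split => [k|A mA].
  case: (k == i); first by apply: measurable_funB; exact: measurable_funM.
  by case: (k == j) => //; apply: measurable_funD; exact: measurable_funM.
pose B U V k := if k == i then U else if k == j then V else A k.
have mB (U V : set R) : measurable U -> measurable V -> forall k, measurable (B U V k).
  by move=> mU mV k; rewrite /B; case: ifP => // _; case: ifP.
pose D := [set w | forall k, B setT setT k (X k w)].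
have mD : measurable D.
  rewrite (_ : D =
    (fun w k => X k w) @^-1` ([set x | forall k, B setT setT k (x k)] : set (famR R K))) //.
  rewrite -[X in measurable X]setTI; apply: (measurable_famP (Y := fun w k => X k w) mX) => //.
  by apply: sub_sigma_algebra; exists (B setT setT); split => //; exact: mB.
pose q := (\big[*%E/1%E]_(k | (k != i) && (k != j)) gam (A k))%E.
have q0 : (0 <= q)%E by apply: prode_ge0.
have qfin : q \is a fin_num.
  apply: (big_ind (fun x : \bar R => x \is a fin_num)) => [//|x y|k _].
    exact: fin_numM.
  by apply: fin_num_measure; exact: mA.
have fq0 : 0 <= fine q by apply: fine_ge0.
have mY : measurable_fun setT (fun w => (X i w, X j w) : RR * RR).
  by apply: measurable_fun_pair; exact: mX.
have prodB U V : \big[*%E/1%E]_k gam (B U V k) = (gam U * gam V * q)%E.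
  rewrite (bigD1 i)//= (bigD1 j)/= 1?eq_sym// /B eqxx [j == i]eq_sym (negbTE ij) eqxx.
  rewrite -muleA; congr (_ * (_ * _))%E; apply: eq_bigr => k /andP[ki kj].
  by rewrite (negbTE ki) (negbTE kj).
(* The law of the pair (X i, X j) on the event [D] that fixes the constraints on the other
   coordinates. It has to be [q] times a product of two normal laws. *)
pose nu := image_measure (mrestr P mD) mY.
have nuE (U V : set R) : measurable U -> measurable V ->
    nu (U `*` V) = (gam U * gam V * q)%E.
  move=> mU mV; rewrite -prodB -(PX _ (mB _ _ mU mV)).
  rewrite /nu /image_measure /= /pushforward /mrestr; congr (P _).
  apply/seteqP; split => [w [[/= wU wV] Dw] k|w /= h].
    by have := Dw k; rewrite /B; case: eqP => [->//|_]; case: eqP => [->|].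
  split.
    split => /=; first by have := h i; rewrite /B eqxx.
    by have := h j; rewrite /B [j == i]eq_sym (negbTE ij) eqxx.
  by move=> k; have := h k; rewrite /B; case: eqP => // _; case: eqP.
(* The factor [q] is absorbed into the first marginal, which makes [nu] a product measure,
   determined by its values on rectangles. *)
pose m1 := mscale (NngNum fq0) gam.
have m1E (U V : set R) : measurable U -> measurable V ->
    (m1 U * gam V = gam U * gam V * q)%E.
  by move=> mU mV; rewrite /m1 /mscale /= fineK// -muleA muleC.
have nuP (E : set (RR * RR)) : measurable E -> (m1 \x gam)%E E = nu E.
  apply: product_measure_unique => U V mU mV.
  by rewrite nuE// m1E.
have qP (E : set (RR * RR)) : measurable E -> (m1 \x gam)%E E = (q * (gam \x gam) E)%E.
  have -> : (q * (gam \x gam) E)%E = mscale (NngNum fq0) (gam \x gam)%E E.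
    by rewrite /mscale /= fineK.
  apply: product_measure_unique => U V mU mV.
  transitivity ((fine q)%:E * (gam \x gam) (U `*` V))%E; first by [].
  transitivity ((fine q)%:E * (gam U * gam V))%E.
    by congr (_ * _)%E; exact: product_measure1E.
  by rewrite fineK// muleC -m1E.
have mAij : measurable (A i `*` A j : set (RR * RR)) by apply: measurableX; exact: mA.
have mrAij : measurable (rot c s @^-1` (A i `*` A j : set (RR * RR))).
  by rewrite -[X in measurable X]setTI; exact: measurable_rot.
transitivity (nu (rot c s @^-1` (A i `*` A j))).
  rewrite /nu /image_measure /= /pushforward /mrestr; congr (P _).
  apply/seteqP; split => [w /= h|w [[/= wi wj] Dw] k].
    split.
      split => /=; first by have := h i; rewrite eqxx.
      by have := h j; rewrite [j == i]eq_sym (negbTE ij) eqxx.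
    by move=> k; have := h k; rewrite /B; case: eqP => // _; case: eqP.
  by have := Dw k; rewrite /B; case: eqP => [->//|_]; case: eqP => [->|].
rewrite -nuP// qP// normal_prod_rot//.
rewrite (_ : (gam \x gam)%E (A i `*` A j) = (gam (A i) * gam (A j))%E); last first.
  by apply: product_measure1E; exact: mA.
rewrite muleC -prodB; apply: eq_bigr => k _; rewrite /B.
by case: eqP => [->//|_]; case: eqP => [->|].
Qed.

(** [U] multiplies a Gaussian matrix with columns indexed by [L]. Quantifying over all spaces and
    families makes the property stable under products of matrices. *)
Definition gaussian_invariant m (U : 'M[R]_m) : Prop :=
  forall d (T : measurableType d) (P : probability T R) (L : finType)
    (X : 'I_m * L -> T -> R), iid_gaussian P X ->
  iid_gaussian P (fun k w => \sum_j U k.1 j * X (j, k.2) w).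

Lemma gaussian_invariant1 m : @gaussian_invariant m 1%:M.
Proof.
move=> d T P L X iX; rewrite (_ : (fun _ => _) = X)//.
apply/funext => -[i l]; apply/funext => w /=; rewrite (bigD1 i)//= mxE eqxx mul1r.
by rewrite big1 ?addr0// => j ji; rewrite mxE eq_sym (negbTE ji) mul0r.
Qed.

Lemma gaussian_invariantM m (U V : 'M[R]_m) :
  gaussian_invariant U -> gaussian_invariant V -> gaussian_invariant (U *m V).
Proof.
move=> iU iV d T P L X iX.
rewrite (_ : (fun _ => _) = (fun (k : 'I_m * L) w =>
   \sum_a U k.1 a * (fun k w => \sum_j V k.1 j * X (j, k.2) w) (a, k.2) w)).
  by apply: (iU _ _ _ _ (fun k w => \sum_j V k.1 j * X (j, k.2) w)); exact: iV.
apply/funext => -[i l]; apply/funext => w /=.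
under eq_bigr do rewrite mxE mulr_suml.
rewrite exchange_big /=; apply: eq_bigr => a _; rewrite mulr_sumr.
by apply: eq_bigr => b _; rewrite mulrA.
Qed.

Definition givens m (i j : 'I_m) (c s : R) : 'M[R]_m :=
  \matrix_(a, b) if a == i then c *+ (b == i) - s *+ (b == j) else
                 if a == j then s *+ (b == i) + c *+ (b == j) else (a == b)%:R.

Lemma givens_sum m (i j : 'I_m) (c s : R) (f : 'I_m -> R) (a : 'I_m) : i != j ->
  \sum_b givens i j c s a b * f b =
  if a == i then c * f i - s * f j else
  if a == j then s * f i + c * f j else f a.
Proof.
move=> ij; have sumd k x : \sum_b (x *+ (b == k)) * f b = x * f k.
  rewrite (bigD1 k)//= eqxx mulr1n big1 ?addr0// => b bk.
  by rewrite (negbTE bk) mulr0n mul0r.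
under eq_bigr do rewrite mxE.
case: ifP => _.
  by under eq_bigr do rewrite mulrBl; rewrite sumrB !sumd.
case: ifP => _.
  by under eq_bigr do rewrite mulrDl; rewrite big_split /= !sumd.
rewrite (bigD1 a)//= eqxx mul1r big1 ?addr0// => b ba.
by rewrite eq_sym (negbTE ba) mul0r.
Qed.

Lemma givens_mulmx m (i j : 'I_m) (c s : R) n (M : 'M[R]_(m, n)) a b : i != j ->
  (givens i j c s *m M) a b =
  if a == i then c * M i b - s * M j b else
  if a == j then s * M i b + c * M j b else M a b.
Proof. by move=> ij; rewrite mxE givens_sum. Qed.

Lemma givens_tr m (i j : 'I_m) (c s : R) : i != j ->
  (givens i j c s)^T = givens i j c (- s).
Proof.
move=> ij; apply/matrixP => a b; rewrite !mxE [b == a]eq_sym.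
have nij : (i == j) = false by exact: negbTE.
have nji : (j == i) = false by rewrite eq_sym.
case: (altP (a =P i)) => [->|ai]; last case: (altP (a =P j)) => [->|aj];
  case: (altP (b =P i)) => [->|bi]; try case: (altP (b =P j)) => [->|bj];
  rewrite ?eqxx ?nij ?nji ?mulr1n ?mulr0n ?(negbTE ai) ?(negbTE aj) //; try ring.
- by rewrite [i == b]eq_sym (negbTE bi); case: (b == j); rewrite ?mulr1n ?mulr0n; ring.
- by rewrite [j == b]eq_sym; case: (b == j); rewrite ?mulr1n ?mulr0n; ring.
- by rewrite subr0.
- by rewrite addr0.
Qed.

Lemma givens_orthogonal m (i j : 'I_m) (c s : R) : i != j -> c ^+ 2 + s ^+ 2 = 1 ->
  givens i j c s *m (givens i j c s)^T = 1%:M.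
Proof.
move=> ij cs1; rewrite givens_tr//; apply/matrixP => a b.
have ji : (j == i) = false by rewrite eq_sym (negbTE ij).
rewrite givens_mulmx// !mxE !eqxx ji.
have nij : (i == j) = false by exact: negbTE.
case: (altP (a =P i)) => [->|ai]; last case: (altP (a =P j)) => [->|aj//].
- rewrite [i == b]eq_sym; case: (altP (b =P i)) => [->|bi].
    by rewrite nij ?mulr1n ?mulr0n -cs1; ring.
  by case: (b == j); rewrite ?mulr1n ?mulr0n; ring.
- rewrite [j == b]eq_sym; case: (altP (b =P i)) => [->|bi].
    by rewrite nij ?mulr1n ?mulr0n; ring.
  by case: (b == j); rewrite ?mulr1n ?mulr0n -?cs1; ring.
Qed.

Lemma gaussian_invariant_givens m (i j : 'I_m) (c s : R) : i != j ->
  c ^+ 2 + s ^+ 2 = 1 -> gaussian_invariant (givens i j c s).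
Proof.
move=> ij.
have main c' s' : c' != 0 -> c' ^+ 2 + s' ^+ 2 = 1 -> gaussian_invariant (givens i j c' s').
  move=> c0 cs1 d T P L X iX.
  (* Only the columns in [r] are rotated so far; adding one more is an instance of
     [iid_gaussian_givens]. *)
  have ind (r : seq L) : uniq r -> iid_gaussian P (fun k w =>
      if k.2 \in r then
        if k.1 == i then c' * X (i, k.2) w - s' * X (j, k.2) w else
        if k.1 == j then s' * X (i, k.2) w + c' * X (j, k.2) w else X k w
      else X k w).
    elim: r => [|l r IH] /=; first by move=> _; rewrite (_ : (fun _ => _) = X).
    move=> /andP[lr ur].
    have ijl : (i, l) != (j, l) by rewrite xpair_eqE (negbTE ij).
    have := iid_gaussian_givens ijl c0 cs1 (IH ur).
    rewrite /= (negbTE lr); congr iid_gaussian.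
    apply/funext => -[a b]; apply/funext => w /=; rewrite !xpair_eqE in_cons.
    case: (eqVneq b l) => [->|bl]; rewrite ?andbT ?andbF//=.
    by rewrite (negbTE lr).
  have := ind (enum L) (enum_uniq _); congr iid_gaussian.
  apply/funext => -[a b]; apply/funext => w /=.
  by rewrite mem_enum inE (givens_sum c' s' (fun a => X (a, b) w)).
have [->|c0] := eqVneq c 0; last exact: main.
rewrite expr0n add0r => s1.
(* A rotation by a right angle is the square of a rotation with c <> 0. *)
pose h : R := (Num.sqrt 2)^-1.
have h2 : h ^+ 2 = 1 / 2 by rewrite exprVn sqr_sqrtr// div1r.
have hn0 : h != 0 by rewrite invr_eq0 sqrtr_eq0 -ltNge.
have -> : givens i j 0 s = givens i j h (s * h) *m givens i j h (s * h).
  have ji : (j == i) = false by rewrite eq_sym (negbTE ij).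
  have e1 : h * h = 1 / 2 by rewrite -h2.
  have e2 : s * h * (s * h) = 1 / 2 by rewrite -h2 -[h ^+ 2]mul1r -s1; ring.
  apply/matrixP => a b; rewrite givens_mulmx// !mxE !eqxx ji.
  have e3 x : s * (h * h) * x + s * (h * h) * x = s * x by rewrite e1; field.
  have e4 x : h * h * x - s * h * (s * h) * x = 0 by rewrite e1 e2; ring.
  case: eqP => // _; last case: eqP => // _.
  - case: (b == i); case: (b == j); rewrite ?mulr1n ?mulr0n;
    [have := e3 1; have := e4 1|have := e4 1|have := e3 1|]; lra.
  - case: (b == i); case: (b == j); rewrite ?mulr1n ?mulr0n;
    [have := e3 1; have := e4 1|have := e3 1|have := e4 1|]; lra.
by apply: gaussian_invariantM; apply: main => //; rewrite exprMn s1 h2; field.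
Qed.

End givens.

(** * Elimination by Givens rotations *)

Section lq.
Context {R : realType}.

Definition gaussian_rotation m (U : 'M[R]_m) : Prop :=
  U *m U^T = 1%:M /\ gaussian_invariant U.

Lemma gaussian_rotation1 m : @gaussian_rotation m 1%:M.
Proof. by split; [rewrite trmx1 mulmx1|exact: gaussian_invariant1]. Qed.

Lemma gaussian_rotationM m (U V : 'M[R]_m) :
  gaussian_rotation U -> gaussian_rotation V -> gaussian_rotation (U *m V).
Proof.
move=> [oU iU] [oV iV]; split; last exact: gaussian_invariantM.
by rewrite trmx_mul mulmxA -(mulmxA U) oV mulmx1.
Qed.

(** The rotation mixes columns [q] and [b] only. The last two clauses record which zeros survive:
    those of other columns, and those of rows vanishing in both columns. *)
Lemma givens_elim m n (M : 'M[R]_(m, n)) (t : 'I_m) (q b : 'I_n) : q != b ->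
  exists U : 'M[R]_n, [/\ gaussian_rotation U, (M *m U^T) t b = 0,
    forall a b', b' != q -> b' != b -> (M *m U^T) a b' = M a b' &
    forall a, M a q = 0 -> M a b = 0 -> (M *m U^T) a q = 0 /\ (M *m U^T) a b = 0].
Proof.
move=> qb; have bq : (b == q) = false by rewrite eq_sym (negbTE qb).
(* In the remaining case the entry to remove is nonzero, which gives [rho != 0] below. *)
have [y0|y0] := eqVneq (M t b) 0.
  exists 1%:M; split; rewrite ?trmx1 ?mulmx1//.
  exact: gaussian_rotation1.
pose x := M t q; pose y := M t b; pose rho := Num.sqrt (x ^+ 2 + y ^+ 2).
have rho2 : rho ^+ 2 = x ^+ 2 + y ^+ 2.
  by rewrite sqr_sqrtr// addr_ge0// sqr_ge0.
have rho0 : rho != 0.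
  by rewrite -(sqrf_eq0 rho) rho2 paddr_eq0 ?sqr_ge0// !sqrf_eq0 negb_and y0 orbT.
have cs1 : (x / rho) ^+ 2 + (- (y / rho)) ^+ 2 = 1.
  by rewrite sqrrN !expr_div_n -mulrDl -rho2 divff// expf_neq0.
have ME a b' : (M *m (givens q b (x / rho) (- (y / rho)))^T) a b' =
   if b' == q then x / rho * M a q + y / rho * M a b else
   if b' == b then - (y / rho) * M a q + x / rho * M a b else M a b'.
  rewrite -[in LHS](trmxK M) -trmx_mul mxE givens_mulmx// !mxE.
  by rewrite mulNr opprK.
exists (givens q b (x / rho) (- (y / rho))); split.
- split; first exact: givens_orthogonal.
  exact: gaussian_invariant_givens.
- by rewrite ME bq eqxx -/x -/y; ring.
- by move=> a b' b'q b'b; rewrite ME (negbTE b'q) (negbTE b'b).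
- by move=> a aq ab; rewrite !ME bq !eqxx aq ab !mulr0 addr0.
Qed.

Lemma givens_elim_seq m n (M : 'M[R]_(m, n)) (t : 'I_m) (q : 'I_n) (bs : seq 'I_n) :
  uniq (q :: bs) ->
  exists U : 'M[R]_n, [/\ gaussian_rotation U,
    forall b, b \in bs -> (M *m U^T) t b = 0,
    forall a b, b \notin q :: bs -> (M *m U^T) a b = M a b &
    forall a, (forall b, b \in q :: bs -> M a b = 0) ->
      forall b, b \in q :: bs -> (M *m U^T) a b = 0].
Proof.
elim: bs => [|b0 bs IH] /=.
  move=> _; exists 1%:M; split => //; first exact: gaussian_rotation1.
    by move=> a b _; rewrite trmx1 mulmx1.
  by move=> a Ma b bq; rewrite trmx1 mulmx1 Ma.
rewrite inE negb_or => /andP[/andP[qb0 qbs] /andP[b0bs ubs]].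
have [|U [gU Ut Uout Uz]] := IH; first by rewrite /= qbs ubs.
have b0qbs : b0 \notin q :: bs by rewrite inE negb_or eq_sym qb0.
have [V [gV Vt Vout Vz]] := givens_elim (M *m U^T) t qb0.
have E : M *m (V *m U)^T = M *m U^T *m V^T by rewrite trmx_mul mulmxA.
exists (V *m U); split; rewrite ?E; first exact: gaussian_rotationM.
- move=> b; rewrite inE => /predU1P[->//|bbs].
  rewrite Vout ?Ut//; first by apply: contraNneq qbs => <-.
  by apply: contraNneq b0bs => <-.
- move=> a b; rewrite !inE !negb_or => /and3P[bq bb0 bbs].
  by rewrite Vout// Uout// inE negb_or bq.
- move=> a Ma b.
  have Uz' : forall b', b' \in q :: bs -> (M *m U^T) a b' = 0.
    by apply: Uz => b' b'q; apply: Ma; move: b'q; rewrite !inE => /orP[->//|->]; rewrite !orbT.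
  have Ub0 : (M *m U^T) a b0 = 0 by rewrite Uout// Ma// !inE eqxx orbT.
  have [Vq Vb0] := Vz a (Uz' q (mem_head _ _)) Ub0.
  have [->//|bq] := eqVneq b q; have [->//|bb0] := eqVneq b b0.
  by rewrite !inE (negbTE bq) (negbTE bb0) /= => bbs; rewrite Vout// Uz'// inE bbs orbT.
Qed.

(** Row [t] is cleared to the right of its pivot, column [t]. The rows above already vanish on all
    the columns being mixed, so they keep their zeros. *)
Lemma gaussian_lq_trig m n (M : 'M[R]_(m, n)) (t : nat) : (t <= n)%N ->
  exists2 U : 'M[R]_n, gaussian_rotation U &
    forall (a : 'I_m) (b : 'I_n), (a < t)%N -> (t <= b)%N -> (M *m U^T) a b = 0.
Proof.
elim: t => [|t IH] tn.
  by exists 1%:M => //; exact: gaussian_rotation1.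
have [U gU Uz] := IH (ltnW tn).
have [mt|tm] := leqP m t.
  exists U => // a b _ tb; apply: Uz; first exact: leq_trans (ltn_ord a) mt.
  exact: ltnW.
pose q := Ordinal tn; pose bs := [seq b : 'I_n <- enum 'I_n | (t < b)%N].
have uq : uniq (q :: bs).
  by rewrite /= filter_uniq ?enum_uniq// andbT mem_filter ltnn.
have [V [gV Vt Vout Vz]] := givens_elim_seq (M *m U^T) (Ordinal tm) uq.
exists (V *m U); first exact: gaussian_rotationM.
move=> a b; rewrite ltnS leq_eqVlt trmx_mul mulmxA => /predU1P[at_|at_] tb.
  rewrite (_ : a = Ordinal tm); last exact: val_inj.
  by apply: Vt; rewrite mem_filter tb mem_enum.
apply: Vz; last by rewrite inE mem_filter tb mem_enum orbT.
move=> b'; rewrite inE mem_filter => /predU1P[->|/andP[tb' _]]; apply: Uz => //.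
exact: ltnW.
Qed.

Lemma gaussian_lq m r s (M : 'M[R]_(m, r + s)) : (m <= r)%N ->
  exists2 U : 'M[R]_(r + s), gaussian_rotation U & rsubmx (M *m U^T) = 0.
Proof.
move=> mr; have [U gU Uz] := gaussian_lq_trig M (leq_addr s r).
exists U => //; apply/matrixP => a b; rewrite [LHS]mxE [RHS]mxE.
by apply: Uz => /=; [exact: leq_trans (ltn_ord a) mr|rewrite leq_addr].
Qed.

End lq.

(** * Spectral theorem and low-rank approximation *)

Section spectral.
Import complex.
Context {R : realType}.

Lemma symmetric_eigenvalue n (S : 'M[R]_n.+1) : S^T = S ->
  exists a, eigenvalue S a.
Proof.
move=> symS; pose f : {rmorphism R -> R[i]} := real_complex R.
pose Sc : 'M[R[i]]_n.+1 := map_mx f S.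
have /closed_rootP[z] : size (char_poly Sc) != 1%N by rewrite size_char_poly.
rewrite -eigenvalue_root_char => /eigenvalueP[v vz v0].
pose cv : 'rV[R[i]]_n.+1 := map_mx Num.conj v.
have cSc : map_mx Num.conj Sc = Sc.
  apply/matrixP => i j; rewrite !mxE; apply/CrealP.
  by rewrite /f /= complex_real.
have a0 : (v *m cv^T) 0 0 != 0.
  rewrite mxE; apply: contra v0 => /eqP a0; apply/eqP/rowP => j; rewrite mxE.
  have /psumr_eq0P H : \sum_j v 0 j * (cv^T) j 0 = 0 by [].
  have /eqP : v 0 j * (cv^T) j 0 = 0.
    by apply: H => // i _; rewrite !mxE mul_conjC_ge0.
  by rewrite !mxE mul_conjC_eq0 => /eqP.
have ra : ((v *m cv^T) 0 0)^* = (v *m cv^T) 0 0.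
  apply/CrealP; rewrite mxE; apply: rpred_sum => i _; rewrite !mxE.
  by apply: ger0_real; rewrite mul_conjC_ge0.
have b1 : (v *m Sc *m cv^T) 0 0 = z * (v *m cv^T) 0 0.
  by rewrite vz -scalemxAl mxE.
have b2 : ((v *m Sc *m cv^T) 0 0)^* = (v *m Sc *m cv^T) 0 0.
  have -> : ((v *m Sc *m cv^T) 0 0)^* = (map_mx Num.conj (v *m Sc *m cv^T)) 0 0.
    by rewrite [RHS]mxE.
  have -> : map_mx Num.conj (v *m Sc *m cv^T) = (v *m Sc *m cv^T)^T.
    rewrite !map_mxM /= cSc !trmx_mul trmxK mulmxA -/cv.
    congr (_ *m _ *m _); first by rewrite /Sc map_trmx symS.
    by apply/matrixP => i j; rewrite !mxE conjCK.
  by rewrite mxE.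
have zreal : z \is Num.real.
  apply/CrealP; move: b2; rewrite b1 rmorphM /= ra => /(mulIf a0).
  by [].
exists (complex.Re z); rewrite eigenvalue_root_char -(fmorph_root f).
rewrite map_char_poly /= RRe_real// -eigenvalue_root_char.
by apply/eigenvalueP; exists v.
Qed.

Lemma symmetric_diagonalize n (S : 'M[R]_n) : S^T = S ->
  exists U : 'M[R]_n, exists2 d : 'rV[R]_n,
    U *m U^T = 1%:M & U *m S *m U^T = diag_mx d.
Proof.
elim: n S => [|n IH] S symS.
  by exists 1%:M, 0; apply/matrixP => -[].
rewrite -add1n in S symS *.
have [a /eigenvalueP[v vS v0]] := symmetric_eigenvalue symS.
(* Eliminating in the one-row matrix [v] moves the eigenvector onto the first axis; by symmetry the
   first row and column of [S'] then vanish off the diagonal, and the induction continues on the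
   lower block. *)
have [U [oU _] vU] := gaussian_lq (v : 'M[R]_(1, 1 + n)) (leqnn 1).
have UtU : U^T *m U = 1%:M by apply: mulmx1C.
pose S' := U *m S *m U^T.
pose al := lsubmx (v *m U^T).
have vUE : v *m U^T = row_mx al 0 by rewrite -vU hsubmxK.
have al0 : al != 0.
  apply: contra v0 => /eqP al0; rewrite -[v]mulmx1 -UtU mulmxA vUE al0 row_mx0.
  by rewrite mul0mx.
have e : row_mx al 0 *m S' = a *: row_mx al 0.
  rewrite -vUE /S' !mulmxA -(mulmxA v) UtU mulmx1 vS -scalemxAl //.
have S'E : S' = @block_mx R 1 n 1 n (ulsubmx S') (ursubmx S') (dlsubmx S') (drsubmx S').
  by rewrite submxK.
have symS' : S'^T = S' by rewrite /S' !trmx_mul trmxK symS mulmxA.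
have al00 : al 0 0 != 0.
  by apply: contra al0 => /eqP al00; apply/eqP/matrixP => i j; rewrite !ord1 al00 mxE.
move: e; rewrite S'E mul_row_block !mul0mx !addr0 scale_row_mx scaler0.
move=> /eq_row_mx[e1 e2].
have alI (B : 'M[R]_(1, n)) : al *m B = 0 -> B = 0.
  move=> /matrixP alB; apply/matrixP => i j; have := alB 0 j.
  by rewrite !mxE big_ord1 !ord1 => /eqP; rewrite mulf_eq0 (negbTE al00) => /eqP.
have ur0 : ursubmx S' = 0 by exact: alI.
have dl0 : dlsubmx S' = 0.
  by rewrite -[dlsubmx S']trmxK trmx_dlsub symS' ur0 trmx0.
have symS2 : (drsubmx S')^T = drsubmx S' by rewrite trmx_drsub symS'.
have [U2 [d2 oU2 U2S]] := IH _ symS2.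
exists (@block_mx R 1 n 1 n 1%:M 0 0 U2 *m U), (row_mx (ulsubmx S') d2).
  rewrite trmx_mul mulmxA -(mulmxA _ U) oU mulmx1 tr_block_mx mulmx_block.
  rewrite !trmx0 trmx1 !mul0mx !mulmx0 !addr0 !add0r mulmx1 oU2.
  by rewrite -scalar_mx_block.
have -> : @block_mx R 1 n 1 n 1%:M 0 0 U2 *m U *m S *m
   (@block_mx R 1 n 1 n 1%:M 0 0 U2 *m U)^T =
   @block_mx R 1 n 1 n 1%:M 0 0 U2 *m S' *m (@block_mx R 1 n 1 n 1%:M 0 0 U2)^T.
  by rewrite trmx_mul /S' !mulmxA.
rewrite S'E ur0 dl0 tr_block_mx !mulmx_block !trmx0 trmx1.
rewrite !mul0mx !mulmx0 !addr0 !add0r !mul1mx mulmx1 !mul0mx U2S diag_mx_row.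
congr (block_mx _ _ _ _).
by rewrite block_mxKul; apply/matrixP => i j; rewrite [RHS]mxE !ord1 eqxx mulr1n.
Qed.

End spectral.

(** * Frobenius norm and ordered eigenvalues *)

Section frobenius.
Context {R : realType}.

Definition fsq m n (A : 'M[R]_(m, n)) : R := \sum_i \sum_j A i j ^+ 2.

Lemma fsq_tr m n (A : 'M[R]_(m, n)) : fsq A = \tr (A *m A^T).
Proof.
by apply: eq_bigr => i _; rewrite mxE; apply: eq_bigr => j _; rewrite mxE expr2.
Qed.

Lemma fsq_ge0 m n (A : 'M[R]_(m, n)) : 0 <= fsq A.
Proof. by apply: sumr_ge0 => i _; apply: sumr_ge0 => j _; exact: sqr_ge0. Qed.

Lemma fsq_trmx m n (A : 'M[R]_(m, n)) : fsq A^T = fsq A.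
Proof. by rewrite !fsq_tr trmxK mxtrace_mulC. Qed.

Lemma fsq_mulmx_orth m n p (A : 'M[R]_(m, n)) (Q : 'M[R]_(n, p)) :
  Q *m Q^T = 1%:M -> fsq (A *m Q) = fsq A.
Proof. by move=> oQ; rewrite !fsq_tr trmx_mul mulmxA -(mulmxA A) oQ mulmx1. Qed.

Lemma fsq_pythagoras m n k (Q : 'M[R]_(m, k)) (A : 'M[R]_(m, n)) :
  Q^T *m Q = 1%:M -> fsq (A - Q *m Q^T *m A) = fsq A - fsq (Q^T *m A).
Proof.
move=> oQ; have e : (A - Q *m Q^T *m A)^T = A^T - A^T *m Q *m Q^T.
  by rewrite linearB /= !trmx_mul trmxK mulmxA.
rewrite !fsq_tr e mulmxBl !mulmxBr !raddfB /= !trmx_mul !trmxK.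
have t1 : \tr (A *m (A^T *m Q *m Q^T)) = \tr (Q^T *m A *m (A^T *m Q)).
  by rewrite !mulmxA mxtrace_mulC !mulmxA.
have t2 : \tr (Q *m Q^T *m A *m A^T) = \tr (Q^T *m A *m (A^T *m Q)).
  by rewrite -!mulmxA mxtrace_mulC !mulmxA.
have t3 : \tr (Q *m Q^T *m A *m (A^T *m Q *m Q^T)) = \tr (Q^T *m A *m (A^T *m Q)).
  by rewrite mxtrace_mulC -!mulmxA (mulmxA Q^T Q) oQ mul1mx mxtrace_mulC !mulmxA -!mulmxA mxtrace_mulC !mulmxA.
by rewrite t1 t2 t3; ring.
Qed.

Lemma sorted_flatten_nseq (T : eqType) (le lt : rel T) (f : T -> nat) (s : seq T) :
  reflexive le -> {homo id : x y / lt x y >-> le x y} ->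
  pairwise lt s -> pairwise le (flatten [seq nseq (f x) x | x <- s]).
Proof.
move=> lexx ltW; elim: s => //= x s IH /andP[xs ps].
rewrite pairwise_cat IH// andbT; apply/andP; split.
  apply/allrelP => y z; rewrite mem_nseq => /andP[_ /eqP ->] /flattenP[_ /mapP[u us ->]].
  by rewrite mem_nseq => /andP[_ /eqP ->]; apply: ltW; move/allP: xs => /(_ u us).
elim: (f x) => //= k ->; rewrite andbT; apply/allP => y.
by rewrite mem_nseq => /andP[_ /eqP ->].
Qed.

(** Links the list of roots with multiplicities that defines [singular_values] to an orthogonal
    diagonalization: both are decreasing lists with the same elements, hence equal. *)
Lemma sorted_eigenvalues n (S U : 'M[R]_n) (d : 'rV[R]_n) :
  U *m U^T = 1%:M -> U *m S *m U^T = diag_mx d ->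
  exists2 t : n.-tuple 'I_n, perm_eq t (enum 'I_n) &
    rev (flatten [seq nseq (mup x (char_poly S)) x | x <- rootsR (char_poly S)])
    = [seq d 0 i | i <- t] /\ sorted >=%R [seq d 0 i | i <- t].
Proof.
move=> oU Sd.
have UtU : U^T *m U = 1%:M by apply: mulmx1C.
pose ds := [seq d 0 i | i : 'I_n].
have cpE : char_poly S = \prod_(y <- ds) ('X - y%:P).
  have -> : char_poly S = char_poly (diag_mx d).
    rewrite -Sd; apply/esym.
    have e : char_poly_mx (U *m S *m U^T) = map_mx polyC U *m char_poly_mx S *m map_mx polyC U^T.
      rewrite /char_poly_mx mulmxBr mulmxBl !map_mxM /=; congr (_ - _).
      by rewrite scalar_mxC -mulmxA -map_mxM /= oU map_mx1 mulmx1.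
    rewrite /char_poly e !det_mulmx mulrAC -det_mulmx -map_mxM /= oU.
    by rewrite map_mx1 det1 mul1r.
  rewrite char_poly_trig; last by apply: diag_mx_is_trig.
  by rewrite big_map big_enum /=; apply: eq_bigr => i _; rewrite mxE eqxx mulr1n.
have cp0 : char_poly S != 0 by rewrite monic_neq0 ?char_poly_monic.
have permL : perm_eq (flatten [seq nseq (mup x (char_poly S)) x | x <- rootsR (char_poly S)]) ds.
  have mE x : mup x (char_poly S) = count_mem x ds by rewrite cpE mu_prod_XsubC.
  under eq_map do rewrite mE.
  apply: perm_trans (perm_count_undup ds); apply: perm_flatten; apply: perm_map.
  apply: uniq_perm; [|exact: undup_uniq|].
    by rewrite /rootsR uniq_roots.
  move=> x; rewrite mem_undup -(roots_on_rootsR cp0) in_itv /= cpE.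
  by rewrite root_prod_XsubC.
pose t := sort (fun i j => d 0 j <= d 0 i) (enum 'I_n).
have st : size t == n by rewrite size_sort size_enum_ord.
exists (Tuple st) => /=; first by rewrite perm_sort.
have sortt : sorted >=%R [seq d 0 i | i <- t].
  rewrite sorted_map; apply: sort_sorted => i j; exact: le_total.
split => //; apply: (@sorted_eq _ >=%R) => //.
- by move=> y x z /= yx zy; exact: le_trans zy yx.
- by move=> x y /= /andP[? ?]; apply/eqP; rewrite eq_le; apply/andP.
- rewrite rev_sorted sorted_pairwise; last exact: le_trans.
  apply: (@sorted_flatten_nseq _ _ <%R); [exact: lexx|by move=> x y /ltW|].
  by rewrite -sorted_pairwise ?sorted_roots//; exact: lt_trans.
- rewrite perm_rev; apply: (perm_trans permL); rewrite perm_sym; apply: perm_map.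
  by rewrite perm_sort.
Qed.
End frobenius.

(** * Truncation to the leading singular vectors *)

Section lowrank.
Context {R : realType}.

(** Used with two selections of rows: the [k] leading ones, which form the approximating [V], and
    [n.+1] of them in a rank argument. *)
Lemma eigenrows_mulmx n k (S U : 'M[R]_n) (d : 'rV[R]_n) (h : 'I_k -> 'I_n) :
  injective h -> U *m U^T = 1%:M -> U *m S *m U^T = diag_mx d ->
  let V := rowsub h U in
  V *m V^T = 1%:M /\ V *m S *m V^T = diag_mx (\row_a d 0 (h a)).
Proof.
move=> injh oU Sd V; have sub A : V *m A *m V^T = mxsub h h (U *m A *m U^T).
  apply/matrixP => a b; rewrite !mxE; apply: eq_bigr => j _; rewrite !mxE.
  by congr (_ * _); apply: eq_bigr => i _; rewrite !mxE.
split.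
  have := sub 1%:M; rewrite !mulmx1 oU => ->; apply/matrixP => a b.
  by rewrite !mxE (inj_eq injh).
by rewrite sub Sd; apply/matrixP => a b; rewrite !mxE (inj_eq injh).
Qed.

Lemma gram_eigenvalues_ge0 m n (A : 'M[R]_(m, n)) (U : 'M[R]_m) (d : 'rV[R]_m) :
  U *m (A *m A^T) *m U^T = diag_mx d -> forall i, 0 <= d 0 i.
Proof.
move=> Sd i; have -> : d 0 i = (diag_mx d) i i by rewrite mxE eqxx mulr1n.
rewrite -Sd !mulmxA -mulmxA -trmx_mul mxE; apply: sumr_ge0 => j _.
by rewrite [_^T _ _]mxE -expr2 sqr_ge0.
Qed.

(** By Pythagoras the residual is the trace of A A^T minus its [k] largest eigenvalues. It remains
    to see that the eigenvalues discarded by [take] are zero. *)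
Lemma best_rank_approx m n (A : 'M[R]_(m, n)) k : (k <= m)%N ->
  exists2 V : 'M[R]_(k, m), V *m V^T = 1%:M &
    fsq (A - V^T *m V *m A) <= \sum_(x <- drop k (singular_values A)) x ^+ 2.
Proof.
move=> km; have symS : (A *m A^T)^T = A *m A^T by rewrite trmx_mul trmxK.
have [U [d oU Sd]] := symmetric_diagonalize symS.
have [t permt [Lt st]] := sorted_eigenvalues oU Sd.
have ut : uniq t by rewrite (perm_uniq permt) enum_uniq.
have d0 := gram_eigenvalues_ge0 Sd.
have inj_t l (lm : (l <= m)%N) : injective (fun a : 'I_l => tnth t (widen_ord lm a)).
  by move=> a b /(tuple_uniqP _ ut)/(congr1 val)/= /val_inj.
have [oV VS] := eigenrows_mulmx (inj_t k km) oU Sd.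
set V := rowsub _ U in oV VS; exists V => //.
pose L := [seq d 0 i | i <- t].
have L0 x : x \in L -> 0 <= x by move=> /mapP[i _ ->].
have szL : size L = m by rewrite size_map size_tuple.
have -> : singular_values A = [seq Num.sqrt x | x <- take (minn m n) L].
  by rewrite /singular_values Lt map_take.
have -> : fsq (A - V^T *m V *m A) = \sum_(x <- drop k L) x.
  have := @fsq_pythagoras _ _ _ _ V^T A; rewrite trmxK => -> //.
  rewrite !fsq_tr trmx_mul !mulmxA -(mulmxA V) VS.
  have -> : \tr (A *m A^T) = \sum_(x <- L) x.
    rewrite -[A *m A^T]mul1mx -(mulmx1C oU) -mulmxA mxtrace_mulC Sd.
    by rewrite mxtrace_diag big_map (perm_big _ permt) big_enum.
  rewrite mxtrace_diag -{1}(cat_take_drop k L) big_cat /=.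
  suff -> : \sum_(x <- take k L) x = \sum_i (\row_a d 0 (tnth t (widen_ord km a))) 0 i.
    by rewrite addrC addrK.
  rewrite (big_nth 0) size_take szL.
  have -> : (if (k < m)%N then k else m) = k by have := km; case: ltngtP.
  rewrite big_mkord; apply: eq_bigr => a _.
  rewrite mxE nth_take// (nth_map (tnth t (widen_ord km a))) ?size_tuple; last first.
    exact: leq_trans (ltn_ord a) km.
  by rewrite [in RHS](tnth_nth (tnth t (widen_ord km a))).
(* If an eigenvalue of index at least [n] were nonzero, [n.+1] eigenrows [W] would have positive
   eigenvalues and (W A)(W A)^T would be invertible of size [n.+1], although W A has only [n]
   columns. *)
have dropz x : x \in drop (minn m n) L -> x = 0.
  case: (leqP m n) => [mn|nm].
    by rewrite drop_oversize// szL.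
  move=> /(nthP 0)[i]; rewrite size_drop szL => im.
  rewrite nth_drop => <-; apply/eqP; apply/negPn/negP => Lne0.
  pose W := rowsub (fun a : 'I_n.+1 => tnth t (widen_ord nm a)) U.
  have [_] := eigenrows_mulmx (inj_t n.+1 nm) oU Sd; rewrite -/W => WS.
  have Lgt0 : 0 < L`_(n + i).
    by rewrite lt_def Lne0 L0// mem_nth// szL -ltn_subRL.
  have : W *m A *m (W *m A)^T \in unitmx.
    rewrite trmx_mul !mulmxA -(mulmxA W) WS unitmxE det_diag unitfE.
    apply/prodf_neq0 => a _; rewrite mxE gt_eqF//.
    rewrite (lt_le_trans Lgt0)// (tnth_nth (tnth t (widen_ord nm a))).
    rewrite -(nth_map _ 0 (fun i => d 0 i)) ?size_tuple; last first.
      exact: leq_trans (ltn_ord a) nm.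
    have sL : pairwise >=%R L.
      by rewrite -sorted_pairwise// => y z w /= yz wy; exact: le_trans wy yz.
    have := ltn_ord a; rewrite ltnS => an.
    have [<-|ani] := eqVneq (nat_of_ord a) (n + i)%N; first exact: lexx.
    move/(pairwiseP 0): sL; apply; rewrite ?inE ?szL.
    - exact: leq_trans (ltn_ord a) nm.
    - by rewrite -ltn_subRL.
    - by rewrite ltn_neqAle ani (leq_trans an)// leq_addr.
  rewrite -row_free_unit /row_free => /eqP rk.
  have := leq_trans (mxrankM_maxl (W *m A) (W *m A)^T) (rank_leq_col (W *m A)).
  by rewrite rk ltnn.
have sqE : \sum_(x <- drop k [seq Num.sqrt x | x <- take (minn m n) L]) x ^+ 2 =
             \sum_(x <- drop k (take (minn m n) L)) x.
  rewrite -map_drop big_map; apply: eq_big_seq => x xL; rewrite sqr_sqrtr// L0//.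
  exact: (mem_take (mem_drop xL)).
rewrite [leRHS]sqE {sqE}.
rewrite -{1}(cat_take_drop (minn m n) L) drop_cat.
have zsum s : {subset s <= drop (minn m n) L} -> \sum_(x <- s) x = 0.
  by move=> sL; rewrite big_seq big1// => x /sL /dropz.
case: ltnP => [_|szk].
  by rewrite big_cat /= [X in _ + X]zsum ?addr0.
rewrite zsum; last by move=> x /mem_drop.
by rewrite drop_oversize// big_nil.
Qed.

End lowrank.

(** * Gaussian moments *)

Section moments.
Context {R : realType}.
Local Notation mu := (@lebesgue_measure R).
Local Notation gam := (@normal_prob R 0 1).
Local Notation phi := (@normal_pdf R 0 1).
Local Notation RR := (measurableTypeR R).

(* The Laplace transform of the square of a standard Gaussian. *)
Definition isqrt (t : R) : R := (Num.sqrt (1 + 2 * t))^-1.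

Lemma isqrt_gt0 t : 0 <= t -> 0 < isqrt t.
Proof. by move=> t0; rewrite invr_gt0 sqrtr_gt0; lra. Qed.

Lemma isqrt_sqr t : 0 <= t -> isqrt t ^+ 2 = (1 + 2 * t)^-1.
Proof. by move=> t0; rewrite exprVn sqr_sqrtr//; lra. Qed.

(** Up to the factor [isqrt t], the integrand times the normal density is the centered normal
    density with standard deviation [isqrt t]. *)
Lemma integral_normal_expsq (t : R) : 0 <= t ->
  (\int[gam]_x (expR (- (t * x ^+ 2)))%:E = (isqrt t)%:E)%E.
Proof.
move=> t0; have s0 := isqrt_gt0 t0.
have me : measurable_fun setT (fun x : R => (expR (- (t * x ^+ 2)))%:E).
  apply/measurable_EFinP; apply: measurableT_comp => //; apply: measurableT_comp => //.
  by apply: measurable_funM => //; exact: measurable_funX.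
rewrite ge0_integral_normal//.
transitivity (\int[mu]_x ((isqrt t)%:E * (normal_pdf 0 (isqrt t) x)%:E))%E.
  apply: eq_integral => x _; rewrite -!EFinM; congr EFin.
  rewrite !normal_pdfE ?oner_neq0 ?gt_eqF// /normal_fun !subr0 expr1n.
  rewrite mulrCA -expRD /normal_peak.
  have -> : isqrt t ^+ 2 * pi *+ 2 = isqrt t ^+ 2 * (1 ^+ 2 * pi *+ 2).
    by rewrite expr1n mul1r mulrnAr.
  rewrite [in RHS]sqrtrM ?sqr_ge0// sqrtr_sqr gtr0_norm// invfM.
  rewrite [RHS]mulrA (mulrA _ (isqrt t)^-1) divff ?gt_eqF// mul1r.
  congr (_ * expR _); rewrite isqrt_sqr//; field.
  by rewrite gt_eqF//; lra.
rewrite ge0_integralZl//; last 3 first.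
- by apply/measurable_EFinP; exact: measurable_normal_pdf.
- by move=> x _; rewrite lee_fin normal_pdf_ge0.
- by rewrite lee_fin ltW.
by rewrite integral_normal_pdf mule1.
Qed.

Lemma is_derive_isqrt (t : R) : 0 <= t -> is_derive t 1 isqrt (- isqrt t ^+ 3).
Proof.
move=> t0; have p0 : 0 < 1 + 2 * t by lra.
have s0 : Num.sqrt (1 + 2 * t) != 0 by rewrite gt_eqF// sqrtr_gt0.
have d1 : is_derive t 1 (fun t : R => 1 + 2 * t) 2.
  by apply: is_derive_eq; rewrite /GRing.scale /=; ring.
have d2 := @is_derive1_comp _ Num.sqrt (fun t : R => 1 + 2 * t) _ _ _ (is_derive1_sqrt p0) d1.
have d3 := @is_deriveV _ (Num.sqrt \o (fun t : R => 1 + 2 * t)) t _ 1 s0 d2.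
rewrite (_ : - isqrt t ^+ 3 = - (Num.sqrt \o (fun t : R => 1 + 2 * t)) t ^- 2 *:
   ((2 * Num.sqrt (1 + 2 * t))^-1 * 2)); first exact: d3.
by rewrite /isqrt /GRing.scale /=; field.
Qed.

Lemma cvg_isqrt_pinfty : isqrt t @[t --> +oo] --> 0.
Proof.
apply/cvgrPdist_le => /= e e0; near=> t.
have t0 : 0 <= t by near: t; exact: nbhs_pinfty_ge.
rewrite sub0r normrN gtr0_norm ?isqrt_gt0//.
rewrite -(@ler_pXn2r _ 2) ?nnegrE ?(ltW e0) ?(ltW (isqrt_gt0 t0))//.
rewrite isqrt_sqr// -[leRHS]invrK lef_pV2 ?posrE ?invr_gt0 ?exprn_gt0//; last by lra.
have : (e ^+ 2)^-1 <= t by near: t; apply: nbhs_pinfty_ge; rewrite num_real.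
lra.
Unshelve. all: end_near. Qed.

(** Since the derivative of [isqrt] is -isqrt^3, the function -isqrt^(m+1)/(m+1) is an
    antiderivative. The drop of the exponent by two is what turns p + 1 degrees of freedom into
    1/(p-1). *)
Lemma integral_isqrt_exp (m : nat) :
  (\int[mu]_(t in `[0%R, +oo[) (isqrt t ^+ m.+3)%:E = (m.+1%:R^-1)%:E)%E.
Proof.
pose F (t : R) := - m.+1%:R^-1 * isqrt t ^+ m.+1.
have dF (t : R) : 0 <= t -> is_derive t 1 F (isqrt t ^+ m.+3).
  move=> t0; have dq := is_derive_isqrt t0.
  have dX := is_deriveZ (- m.+1%:R^-1) (@is_deriveX _ _ isqrt m.+1 t 1 _ dq).
  rewrite (_ : F = - m.+1%:R^-1 \*: (isqrt ^+ m.+1)); last first.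
    by apply/funext => x; rewrite /F /GRing.scale /= exprfctE.
  rewrite (_ : isqrt t ^+ m.+3 = - m.+1%:R^-1 *: ((m.+1%:R * isqrt t ^+ m) *: - isqrt t ^+ 3)) //.
  rewrite /GRing.scale /= mulNr mulrN mulrN opprK.
  by rewrite -mulrA -exprD addn3 mulKf// pnatr_eq0.
have dq0 (t : R) : 0 <= t -> derivable isqrt t 1.
  by move=> /is_derive_isqrt d; exact: ex_derive.
have cq (t : R) : 0 <= t -> {for t, continuous isqrt}.
  by move=> /dq0 /derivable1_diffP /differentiable_continuous.
have cF : F t @[t --> 0^'+] --> F 0.
  apply: cvg_at_right_filter; apply: cvgMl_tmp.
  apply: (cvg_comp isqrt (fun x => x ^+ m.+1)); first exact: cq.
  exact: exprn_continuous.
have dXq (t : R) : 0 <= t -> derivable (isqrt ^+ m.+3) t 1.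
  by move=> t0; apply: derivableX; exact: dq0.
have cX : {within `[0, +oo[, continuous (isqrt ^+ m.+3)}.
  by apply: derivable_within_continuous => x; rewrite in_itv /= andbT => /dXq.
have XE : isqrt ^+ m.+3 = (fun t => isqrt t ^+ m.+3) by rewrite exprfctE.
rewrite XE in cX.
have Foo : F t @[t --> +oo] --> 0.
  rewrite [X in _ --> X](_ : _ = - m.+1%:R^-1 * 0); last by rewrite mulr0.
  apply: cvgMl_tmp.
  rewrite [X in _ --> X](_ : _ = 0 ^+ m.+1); last by rewrite expr0n.
  apply: (cvg_comp isqrt (fun x => x ^+ m.+1)); first exact: cvg_isqrt_pinfty.
  exact: exprn_continuous.
have X0 (x : R) : 0 <= x -> 0 <= isqrt x ^+ m.+3.
  by move=> x0; rewrite exprn_ge0// ltW// isqrt_gt0.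
have dF1 (x : R) : 0 < x -> derivable F x 1.
  by move=> /ltW /dF d; exact: ex_derive.
have dFE : {in `]0, +oo[, derive1 F =1 (fun t => isqrt t ^+ m.+3)}.
  move=> x; rewrite in_itv /= andbT => /ltW /dF d.
  by rewrite derive1E derive_val.
have := ge0_continuous_FTC2y X0 cX Foo dF1 cF dFE.
by rewrite /F /isqrt mulr0 addr0 sqrtr1 invr1 expr1n mulr1 -EFinB sub0r opprK.
Qed.

End moments.

Section iid_moments.
Context {R : realType}.
Local Notation mu := (@lebesgue_measure R).
Local Notation gam := (@normal_prob R 0 1).
Local Notation phi := (@normal_pdf R 0 1).
Local Notation RR := (measurableTypeR R).

(** The coordinates outside [a] are redrawn independently of those in [a]. *)
Lemma iid_gaussian_split d (T : measurableType d) (P : probability T R)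
    (K : finType) (a : pred K) (X : K -> T -> R) (f : famR R K -> \bar R) :
  iid_gaussian P X -> measurable_fun setT f -> (forall x, 0 <= f x)%E ->
  (\int[P]_w f (fun k => X k w) =
   \int[P]_w \int[P]_w' f (fun k => if a k then X k w else X k w'))%E.
Proof.
move=> iX mf f0.
have iXX := iid_gaussian_decouple a iX iX.
rewrite (iid_gaussian_transfer iX iXX)// fubini_tonelli1//.
exact: (measurableT_comp mf (measurable_famP (proj1 iXX))).
Qed.

Lemma iid_gaussian_law d (T : measurableType d) (P : probability T R)
    (K : finType) (X : K -> T -> R) (k : K) (f : R -> \bar R) :
  iid_gaussian P X -> measurable_fun setT f -> (forall x, 0 <= f x)%E ->
  (\int[P]_w f (X k w) = \int[gam]_x f x)%E.
Proof.
move=> iX mf f0.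
have injh : injective (fun _ : 'I_1 => k) by move=> i j _; rewrite !ord1.
have [mX PX] := iid_gaussian_sub injh iX.
have mXk : @measurable_fun _ _ T RR setT (X k) by exact: (proj1 iX).
transitivity (\int[@image_measure _ _ T RR _ P _ mXk]_x f x)%E.
  by rewrite [RHS]ge0_integral_pushforward.
apply: eq_measure_integral => // A mA _.
rewrite /image_measure /= /pushforward.
transitivity (P [set w | forall i : 'I_1, A (X k w)]).
  by congr (P _); apply/seteqP; split => [w wA i //|w /(_ ord0)].
by rewrite (PX (fun=> A))// big_ord1.
Qed.

Lemma measurable_funV_gt0 d (T : measurableType d) (f : T -> R) :
  measurable_fun setT f -> (forall x, 0 < f x) ->
  measurable_fun setT (fun x => (f x)^-1).
Proof.
move=> mf f0; rewrite (_ : (fun _ => _) = fun x => expR (- ln (f x))).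
  apply: measurableT_comp => //; apply: measurableT_comp => //.
  by apply: measurableT_comp => //; exact: measurable_ln.
by apply/funext => x; rewrite expRN lnK// posrE.
Qed.

Lemma ge0_integral_normalN (f : R -> \bar R) : measurable_fun setT f ->
  (forall x, 0 <= f x)%E -> (\int[gam]_x f (- x)%R = \int[gam]_x f x)%E.
Proof.
move=> mf f0.
have mfN : measurable_fun setT (fun x : R => f (- x)).
  by apply: (measurableT_comp mf); exact: measurable_funN.
rewrite !ge0_integral_normal//.
have m1 : measurable_fun setT (fun x : R => (f x * (phi x)%:E)%E).
  by apply: emeasurable_funM => //; apply/measurable_EFinP; exact: measurable_normal_pdf.
have m0 (x : R) : (0 <= f x * (phi x)%:E)%E by rewrite mule_ge0// lee_fin normal_pdf_ge0.
have n10 : (-1 : R) != 0 by rewrite oppr_eq0 oner_neq0.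
rewrite [RHS](ge0_integral_affine 0 n10 m1 m0) normrN normr1 mul1e.
by apply: eq_integral => x _; rewrite mulN1r addr0 !normal_pdf01E sqrrN.
Qed.

(** [1 - t] is the tangent at 0 of a convex function; after squaring and multiplying by [1 + 2 * t],
    the gap is [t ^+ 2 * (3 - 2 * t)]. *)
Lemma isqrt_ge (t : R) : 0 <= t -> 1 - t <= isqrt t.
Proof.
move=> t0; have q0 := isqrt_gt0 t0.
have [t1|t1] := leP t 1; last by apply: (le_trans _ (ltW q0)); lra.
rewrite -(@ler_pXn2r _ 2) ?nnegrE ?(ltW q0) ?subr_ge0// isqrt_sqr//.
rewrite -[leRHS]mul1r ler_pdivlMr; last by lra.
by have : 0 <= t ^+ 2 * (3 - 2 * t); [apply: mulr_ge0; [exact: sqr_ge0|lra]|nra].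
Qed.

Lemma integral_normal_sqr : (\int[gam]_x (x ^+ 2)%:E <= 1)%E.
Proof.
(* g n increases to x^2, and g n x <= (1 - exp (- t x^2)) / t for t = 1/(n+1),
   whose integral is known. *)
pose g (n : nat) (x : R) : \bar R := (x ^+ 2 * (1 + x ^+ 2 * n.+1%:R^-1)^-1)%:E.
have frac (u v : R) : 0 < 1 + u * v -> u * (1 + u * v)^-1 * v = 1 - (1 + u * v)^-1.
  by move=> uv; field; rewrite gt_eqF.
have den n (x : R) : 0 < 1 + x ^+ 2 * n.+1%:R^-1.
  by rewrite ltr_wpDr// mulr_ge0// sqr_ge0.
have mden n : measurable_fun setT (fun x : R => 1 + x ^+ 2 * n.+1%:R^-1).
  apply: measurable_funD => //; apply: measurable_funM => //; exact: measurable_funX.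
have mg n : measurable_fun setT (g n).
  apply/measurable_EFinP; apply: measurable_funM; first exact: measurable_funX.
  exact: measurable_funV_gt0.
have g0 n x : setT x -> (0 <= g n x)%E.
  by move=> _; rewrite lee_fin mulr_ge0 ?sqr_ge0// invr_ge0 ltW.
have lim_g x : g^~ x n @[n --> \oo] --> (x ^+ 2)%:E.
  apply: cvg_EFin; first by apply: nearW.
  rewrite [X in _ --> X](_ : _ = x ^+ 2 * (1 + x ^+ 2 * 0)^-1); last first.
    by rewrite mulr0 addr0 invr1 mulr1.
  apply: cvgMl_tmp; apply: cvgV; first by rewrite mulr0 addr0 oner_neq0.
  apply: cvgD; first exact: cvg_cst.
  by apply: cvgMl_tmp; exact: cvg_harmonic.
have int_g n : (\int[gam]_x g n x <= 1)%E.
  pose t : R := n.+1%:R^-1; have t0 : 0 < t by rewrite invr_gt0.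
  have mexp : measurable_fun setT (fun x : R => expR (- (t * x ^+ 2))).
    apply: measurableT_comp => //; apply: measurableT_comp => //.
    by apply: measurable_funM => //; exact: measurable_funX.
  have exp1 (x : R) : expR (- (t * x ^+ 2)) <= 1.
    by rewrite -[leRHS]expR0 ler_expR oppr_le0 mulr_ge0 ?sqr_ge0// ltW.
  have m1e : measurable_fun setT (fun x : R => (1 - expR (- (t * x ^+ 2)))%:E).
    by apply/measurable_EFinP; exact: measurable_funB.
  have int1 : (\int[gam]_x (1 - expR (- (t * x ^+ 2)))%:E <= t%:E)%E.
    have : (\int[gam]_x (1 - expR (- (t * x ^+ 2)))%:E +
            \int[gam]_x (expR (- (t * x ^+ 2)))%:E = 1)%E.
      have q1 x : setT x -> (0 <= (1 - expR (- (t * x ^+ 2)))%:E)%E.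
        by move=> _; rewrite lee_fin subr_ge0.
      have q2 x : setT x -> (0 <= (expR (- (t * x ^+ 2)))%:E)%E.
        by move=> _; rewrite lee_fin expR_ge0.
      have m2e : measurable_fun setT (fun x : R => (expR (- (t * x ^+ 2)))%:E).
        exact/measurable_EFinP.
      rewrite -(ge0_integralD gam measurableT q1 m1e q2 m2e).
      under eq_integral do rewrite -EFinD subrK.
      by rewrite integral_cst// [X in (_ * X)%E]probability_setT mule1.
    rewrite integral_normal_expsq ?(ltW t0)//.
    have := isqrt_ge (ltW t0); set J := (\int[gam]_x _)%E.
    by case: J => [r| |] //= qt; rewrite -EFinD lee_fin => -[]; lra.
  apply: (@le_trans _ _ (\int[gam]_x (t^-1%:E * (1 - expR (- (t * x ^+ 2)))%:E))%E).
    apply: ge0_le_integral => //; first by move=> x _; exact: g0.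
      exact: mg.
      by apply: emeasurable_funM.
    move=> x _; rewrite -EFinM lee_fin ler_pdivlMl//.
    have dy : 0 < 1 + x ^+ 2 * t := den n x.
    have := expR_ge1Dx (x ^+ 2 * t); rewrite expRN (mulrC t (x ^+ 2)) => H.
    have H' : (expR (x ^+ 2 * t))^-1 <= (1 + x ^+ 2 * t)^-1.
      by rewrite lef_pV2 ?posrE ?expR_gt0.
    by rewrite [leLHS]mulrC frac// lerD2l lerN2.
  have q1 x : setT x -> (0 <= (1 - expR (- (t * x ^+ 2)))%:E)%E.
    by move=> _; rewrite lee_fin subr_ge0.
  have q2 : (0 <= t^-1%:E)%E by rewrite lee_fin invr_ge0 ltW.
  rewrite (ge0_integralZl gam measurableT m1e q1 q2).
  rewrite (@le_trans _ _ (t^-1%:E * t%:E)%E)//.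
    by apply: lee_wpmul2l => //; rewrite lee_fin invr_ge0 ltW.
  by rewrite -EFinM mulVf// gt_eqF.
have ndg x : setT x -> nondecreasing_seq (g^~ x).
  move=> _ i j ij; rewrite lee_fin ler_wpM2l ?sqr_ge0// lef_pV2 ?posrE//.
  rewrite lerD2l ler_wpM2l ?sqr_ge0// lef_pV2 ?posrE//.
  by rewrite ler_nat.
have H := @cvg_monotone_convergence _ _ _ gam _ measurableT _ mg g0 ndg.
have -> : (\int[gam]_x (x ^+ 2)%:E = \int[gam]_x limn (g^~ x))%E.
  by apply: eq_integral => x _; rewrite (cvg_lim _ (lim_g x)).
rewrite -(cvg_lim _ H)//; apply: lime_le; first by apply/cvg_ex; eexists; exact: H.
by apply: nearW.
Qed.

(** By symmetry of the law, [a] and [- a] give the same integral. Adding the two integrands cancels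
    the cross term pointwise, so that no signed function is integrated. *)
Lemma integral_normal_affine_sqr (a b : R) :
  (\int[gam]_x ((b + a * x) ^+ 2)%:E <= (b ^+ 2 + a ^+ 2)%:E)%E.
Proof.
have mq (c : R) : measurable_fun setT (fun x : R => ((b + c * x) ^+ 2)%:E).
  apply/measurable_EFinP; apply: measurable_funX; apply: measurable_funD => //.
have q0 c x : (0 <= ((b + c * x) ^+ 2)%:E)%E by rewrite lee_fin sqr_ge0.
have symE : (\int[gam]_x ((b + a * x) ^+ 2)%:E = \int[gam]_x ((b + - a * x) ^+ 2)%:E)%E.
  rewrite -[LHS](ge0_integral_normalN (mq a) (q0 a)).
  by apply: eq_integral => x _; rewrite mulrN mulNr.
have msq : measurable_fun setT (fun x : R => (x ^+ 2)%:E).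
  by apply/measurable_EFinP; exact: measurable_funX.
have sumE : (\int[gam]_x ((b + a * x) ^+ 2)%:E + \int[gam]_x ((b + a * x) ^+ 2)%:E
    <= (2 * (b ^+ 2 + a ^+ 2))%:E)%E.
  rewrite {2}symE -(ge0_integralD gam measurableT
    (fun x _ => q0 a x) (mq a) (fun x _ => q0 (- a) x) (mq (- a))).
  have -> : (\int[gam]_x (((b + a * x) ^+ 2)%:E + ((b + - a * x) ^+ 2)%:E) =
             \int[gam]_x ((2 * b ^+ 2)%:E + (2 * a ^+ 2)%:E * (x ^+ 2)%:E))%E.
    by apply: eq_integral => x _; rewrite -!EFinM -!EFinD; congr EFin; ring.
  have a0 : (0 <= (2 * a ^+ 2)%:E)%E by rewrite lee_fin; have := sqr_ge0 a; lra.
  have b0 : (0 <= (2 * b ^+ 2)%:E)%E by rewrite lee_fin; have := sqr_ge0 b; lra.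
  have x0 (x : R) : setT x -> (0 <= (x ^+ 2)%:E)%E by move=> _; rewrite lee_fin sqr_ge0.
  have ax0 (x : R) : setT x -> (0 <= (2 * a ^+ 2)%:E * (x ^+ 2)%:E)%E.
    by move=> xT; apply: mule_ge0 => //; exact: x0.
  have max : measurable_fun setT (fun x : R => ((2 * a ^+ 2)%:E * (x ^+ 2)%:E)%E).
    by apply: emeasurable_funM.
  have mb : measurable_fun setT (fun x : RR => (2 * b ^+ 2)%:E : \bar R) by [].
  rewrite (ge0_integralD gam measurableT (fun x _ => b0) mb ax0 max).
  rewrite integral_cst// [X in (_ * X)%E]probability_setT mule1.
  rewrite (ge0_integralZl gam measurableT msq x0 a0).
  rewrite mulrDr EFinD leeD2l// -[leRHS]mule1 lee_wpmul2l//.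
  exact: integral_normal_sqr.
move: sumE; set J := (\int[gam]_x _)%E.
have J0 : (0 <= J)%E by apply: integral_ge0.
case: J J0 => [r _|_|//]; last by rewrite /= leye_eq.
by rewrite -EFinD !lee_fin; lra.
Qed.

(** A rotation carries the coefficient vector onto the first axis: the linear form becomes [al]
    times one standard Gaussian, with al^2 the sum of the squared coefficients. *)
Lemma iid_gaussian_linear_sqr d (T : measurableType d) (P : probability T R)
    (K : finType) (X : K -> T -> R) (c : K -> R) (b : R) : iid_gaussian P X ->
  (\int[P]_w ((b + \sum_k c k * X k w) ^+ 2)%:E <= (b ^+ 2 + \sum_k c k ^+ 2)%:E)%E.
Proof.
move=> iX; pose n := #|K|.
have [n0|n0] := posnP n.
  have E0 (F : K -> R) : \sum_k F k = 0.
    by apply: big1 => k _; move: n0; rewrite /n (cardD1 k).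
  under eq_integral do rewrite E0.
  by rewrite integral_cst// [X in (_ * X)%E]probability_setT mule1 E0 !addr0.
(* The trivial second index presents the family as a one-column matrix, the form on which
   [gaussian_invariant] acts. *)
pose h (p : 'I_n * 'I_1) : K := enum_val p.1.
have injh : injective h by move=> [i i'] [j j'] /enum_val_inj /= ->; rewrite !ord1.
have iY := iid_gaussian_sub injh iX.
pose v : 'rV[R]_n := \row_i c (enum_val i).
have [U [oU gU] Uz] := gaussian_lq_trig v n0.
have iZ := gU _ _ _ _ _ iY; pose z := Ordinal n0.
pose al := (v *m U^T) 0 z.
have UtU : U^T *m U = 1%:M by apply: mulmx1C.
have alE : al ^+ 2 = \sum_k c k ^+ 2.
  transitivity ((v *m U^T *m (v *m U^T)^T) 0 0).
    rewrite mxE (bigD1 z)//= big1 ?addr0; first by rewrite [_^T _ _]mxE expr2.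
    by move=> j jz; rewrite Uz ?mul0r// lt0n; apply: contra jz => /eqP j0; apply/eqP/val_inj.
  rewrite trmx_mul trmxK -mulmxA (mulmxA U^T) UtU mul1mx mxE.
  rewrite (reindex (@enum_val K predT)) /=; last first.
    exists enum_rank => x _; [exact: enum_valK|exact: enum_rankK].
  by apply: eq_bigr => i _; rewrite !mxE expr2.
have XE w : \sum_k c k * X k w = al * \sum_j U z j * X (enum_val j) w.
  pose x : 'cV[R]_n := \col_j X (enum_val j) w.
  transitivity ((v *m x) 0 0).
    rewrite mxE (reindex (@enum_val K predT)) /=; last first.
      exists enum_rank => y _; [exact: enum_valK|exact: enum_rankK].
    by apply: eq_bigr => i _; rewrite !mxE.
  rewrite -[v]mulmx1 -UtU mulmxA -mulmxA mxE (bigD1 z)//= big1 ?addr0.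
    by congr (_ * _); rewrite mxE; apply: eq_bigr => j _; rewrite [x _ _]mxE.
  by move=> j jz; rewrite Uz ?mul0r// lt0n; apply: contra jz => /eqP j0; apply/eqP/val_inj.
under eq_integral do rewrite XE.
have mq : measurable_fun setT (fun x : R => ((b + al * x) ^+ 2)%:E).
  by apply/measurable_EFinP; apply: measurable_funX; apply: measurable_funD.
rewrite [leLHS](iid_gaussian_law (z, ord0) iZ mq); last by move=> x; rewrite lee_fin sqr_ge0.
by rewrite -alE; exact: integral_normal_affine_sqr.
Qed.

End iid_moments.

(** * Inverse moment of a chi-square variable *)

Section inverse_chi2.
Context {R : realType}.
Local Notation mu := (@lebesgue_measure R).
Local Notation RR := (measurableTypeR R).

Lemma measurable_sqsum (K : finType) (r : seq K) :
  measurable_fun setT (fun x : famR R K => \sum_(k <- r) x k ^+ 2).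
Proof.
by apply: measurable_sum => k; apply: measurable_funX; exact: measurable_coord.
Qed.

(** Splitting off one coordinate at a time factors the exponential, and each coordinate contributes
    one factor [isqrt t]. *)
Lemma iid_gaussian_laplace d (T : measurableType d) (P : probability T R)
    (K : finType) (X : K -> T -> R) (t : R) (r : seq K) : 0 <= t -> uniq r ->
  iid_gaussian P X ->
  (\int[P]_w (expR (- (t * \sum_(k <- r) X k w ^+ 2)))%:E = (isqrt t ^+ size r)%:E)%E.
Proof.
move=> t0 ur iX.
have mexp (s : seq K) : measurable_fun setT (fun x : famR R K =>
    (expR (- (t * \sum_(k <- s) x k ^+ 2)))%:E).
  apply/measurable_EFinP; apply: measurableT_comp => //; apply: measurableT_comp => //.
  by apply: measurable_funM => //; exact: measurable_sqsum.
elim: r ur => [_|k r IH /= /andP[kr ur]].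
  under eq_integral do rewrite big_nil mulr0 oppr0 expR0.
  by rewrite integral_cst// [X in (_ * X)%E]probability_setT mule1.
rewrite (iid_gaussian_split (pred1 k) iX (mexp (k :: r)))//.
have mexp1 : measurable_fun setT (fun x : R => (expR (- (t * x ^+ 2)))%:E).
  apply/measurable_EFinP; apply: measurableT_comp => //; apply: measurableT_comp => //.
  by apply: measurable_funM => //; exact: measurable_funX.
transitivity (\int[P]_w ((isqrt t ^+ size r)%:E * (expR (- (t * X k w ^+ 2)))%:E))%E.
  apply: eq_integral => w _; rewrite -IH// muleC -ge0_integralZl//; last first.
    by apply: (measurableT_comp (mexp r)); exact: (measurable_famP (proj1 iX)).
  apply: eq_integral => w' _; rewrite big_cons /= eqxx -EFinM -expRD.
  congr (expR _)%:E; rewrite mulrDr opprD; congr (_ - _ * _).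
  by apply: eq_big_seq => k' k'r; case: eqP => // k'k; move: kr; rewrite -k'k k'r.
rewrite ge0_integralZl//; last 2 first.
- by apply: (measurableT_comp mexp1); exact: (proj1 iX).
- by rewrite lee_fin exprn_ge0// ltW// isqrt_gt0.
rewrite (iid_gaussian_law k iX mexp1)// integral_normal_expsq//.
by rewrite -EFinM exprSr.
Qed.

Lemma integral_exp_inv (s : R) : 0 < s ->
  (\int[mu]_(t in `[0%R, +oo[) (expR (- (t * s)))%:E = (s^-1)%:E)%E.
Proof.
move=> s0; have mpdf := @measurable_exponential_pdf R s.
transitivity (\int[mu]_t ((s^-1)%:E * (exponential_pdf s t)%:E))%E.
  rewrite integral_mkcond; apply: eq_integral => t _.
  rewrite /exponential_pdf !patchE; case: ifP => _; last by rewrite mule0.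
  by rewrite -EFinM mulKf ?gt_eqF// mulNr mulrC.
rewrite ge0_integralZl//.
- by rewrite integral_exponential_pdf// mule1.
- exact/measurable_EFinP.
- by move=> t _; rewrite lee_fin exponential_pdf_ge0// ltW.
- by rewrite lee_fin invr_ge0 ltW.
Qed.

(** 1/s is the integral of exp(-ts) over t >= 0. By Tonelli the expectation is at most the integral
    of the Laplace transform, since dropping [eps] only increases it; at least three degrees of
    freedom make this integral finite. *)
Lemma iid_gaussian_inv_sqsum d (T : measurableType d) (P : probability T R)
    (K : finType) (X : K -> T -> R) (eps : R) (m : nat) :
  0 < eps -> #|K| = m.+3 -> iid_gaussian P X ->
  (\int[P]_w ((\sum_k X k w ^+ 2 + eps)^-1)%:E <= (m.+1%:R^-1)%:E)%E.
Proof.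
move=> e0 cK iX.
pose S w := \sum_k X k w ^+ 2.
have S0 w : 0 <= S w by apply: sumr_ge0 => k _; exact: sqr_ge0.
have mS : measurable_fun setT S.
  by apply: measurable_sum => k; apply: measurable_funX; exact: (proj1 iX).
pose f (z : T * RR) : \bar R :=
  (expR (- (z.2 * (S z.1 + eps))) * \1_(`[0%R, +oo[%classic : set R) z.2)%:E.
have mf : measurable_fun setT f.
  apply/measurable_EFinP; apply: measurable_funM; last first.
    have mi : @measurable_fun _ _ RR _ setT (\1_(`[0%R, +oo[%classic : set R) : R -> R).
      exact: measurable_indic.
    exact: (measurableT_comp mi (@measurable_snd _ _ T RR)).
  apply: measurableT_comp => //; apply: measurableT_comp => //.
  apply: measurable_funM => //; apply: measurable_funD => //.
  exact: (measurableT_comp mS).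
have f0 z : (0 <= f z)%E by rewrite lee_fin mulr_ge0// expR_ge0.
have E1 : (\int[P]_w ((S w + eps)^-1)%:E = \int[P]_w \int[mu]_t f (w, t))%E.
  apply: eq_integral => w _; rewrite -integral_exp_inv; last by rewrite ltr_wpDl.
  rewrite integral_mkcond; apply: eq_integral => t _; rewrite patchE /f indicE /=.
  by case: ifP => _; rewrite ?mulr1 ?mulr0.
rewrite E1 (@fubini_tonelli _ _ _ _ _ P mu _ mf f0).
rewrite -integral_isqrt_exp [leRHS]integral_mkcond; apply: ge0_le_integral => //.
- by move=> t _; apply: integral_ge0.
- exact: measurable_fun_fubini_tonelli_G.
- apply/(measurable_restrictT _ _).1 => //.
  (* The absolute value keeps the argument of the root positive on the whole line and changes
     nothing on the half-line of integration. *)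
  apply: (eq_measurable_fun (fun t : R => ((Num.sqrt (1 + 2 * `|t|))^-1 ^+ m.+3)%:E)).
    by move=> t; rewrite inE /= in_itv /= andbT => t0; rewrite ger0_norm.
  apply/measurable_funTS/measurable_EFinP; apply: measurable_funX.
  apply: measurable_funV_gt0; last by move=> t; rewrite sqrtr_gt0; have := normr_ge0 t; lra.
  apply: measurableT_comp; first exact: (continuous_measurable_fun (@sqrt_continuous R)).
  by apply: measurable_funD => //; apply: measurable_funM => //; exact: measurableT_comp.
- move=> t _; rewrite patchE; case: ifPn => [|].
    rewrite inE /= in_itv /= andbT => t0.
    rewrite -cK cardE -(iid_gaussian_laplace t0 (enum_uniq _) iX).
    apply: ge0_le_integral => //.
    + exact: (measurable_fun_pair1 (t : RR) mf).
    + apply/measurable_EFinP; apply: measurableT_comp => //; apply: measurableT_comp => //.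
      apply: measurable_funM => //; apply: measurable_sum => k; apply: measurable_funX; exact: (proj1 iX).
    move=> w _; rewrite lee_fin /f /= indicE mem_set ?mulr1/= ?in_itv/= ?t0//.
    by rewrite ler_expR lerN2 ler_wpM2l// big_enum /= lerDl ltW.
  move=> tn; rewrite integral0_eq// => w _; rewrite /f /= indicE (negbTE tn).
  by rewrite mulr0.
Qed.

End inverse_chi2.

(** * The Gaussian resolvent *)

Section measurable_mx.
Context {R : realType} d (S : measurableType d).

Definition measurable_mx m n (F : S -> 'M[R]_(m, n)) : Prop :=
  forall i j, measurable_fun setT (fun s => F s i j).

Lemma measurable_mx_cst m n (A : 'M[R]_(m, n)) : measurable_mx (fun=> A).
Proof. by move=> i j; exact: measurable_cst. Qed.

Lemma measurable_mxD m n (F G : S -> 'M[R]_(m, n)) :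
  measurable_mx F -> measurable_mx G -> measurable_mx (fun s => F s + G s).
Proof.
move=> mF mG i j; under eq_fun do rewrite mxE.
by apply: measurable_funD; [exact: mF|exact: mG].
Qed.

Lemma measurable_mxN m n (F : S -> 'M[R]_(m, n)) :
  measurable_mx F -> measurable_mx (fun s => - F s).
Proof.
move=> mF i j; under eq_fun do rewrite mxE.
by apply: measurableT_comp => //; exact: mF.
Qed.

Lemma measurable_mxM m n p (F : S -> 'M[R]_(m, n)) (G : S -> 'M[R]_(n, p)) :
  measurable_mx F -> measurable_mx G -> measurable_mx (fun s => F s *m G s).
Proof.
move=> mF mG i j; under eq_fun do rewrite mxE.
by apply: measurable_sum => k; apply: measurable_funM; [exact: mF|exact: mG].
Qed.

Lemma measurable_mx_tr m n (F : S -> 'M[R]_(m, n)) :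
  measurable_mx F -> measurable_mx (fun s => (F s)^T).
Proof. by move=> mF i j; under eq_fun do rewrite mxE; exact: mF. Qed.

Lemma measurable_det n (F : S -> 'M[R]_n) : measurable_mx F ->
  measurable_fun setT (fun s => \det (F s)).
Proof.
move=> mF; apply: measurable_sum => s; apply: measurable_funM => //.
by apply: measurable_prod => i _; exact: mF.
Qed.

Lemma measurable_funV d' (T : measurableType d') (f : T -> R) :
  measurable_fun setT f -> (forall x, f x != 0) ->
  measurable_fun setT (fun x => (f x)^-1).
Proof.
move=> mf f0; rewrite (_ : (fun _ => _) = fun x => f x * (f x ^+ 2)^-1).
  apply: measurable_funM => //; apply: measurable_funV_gt0; first exact: measurable_funX.
  by move=> x; rewrite exprn_even_gt0/=.
by apply/funext => x; rewrite expr2 invfM mulVKf.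
Qed.

(** By Cramer's formula the entries are cofactors divided by a determinant that never vanishes. *)
Lemma measurable_mx_inv n (F : S -> 'M[R]_n) : measurable_mx F ->
  (forall s, F s \in unitmx) -> measurable_mx (fun s => invmx (F s)).
Proof.
move=> mF uF i j; under eq_fun do rewrite /invmx uF mxE [\adj _ _ _]mxE.
apply: measurable_funM.
  apply: measurable_funV; first exact: measurable_det.
  by move=> s; have := uF s; rewrite unitmxE unitfE.
apply: measurable_funM => //; apply: measurable_det => a b.
by under eq_fun do rewrite !mxE; exact: mF.
Qed.

Lemma measurable_fsq m n (F : S -> 'M[R]_(m, n)) : measurable_mx F ->
  measurable_fun setT (fun s => fsq (F s)).
Proof.
move=> mF; apply: measurable_sum => i; apply: measurable_sum => j.
by apply: measurable_funX; exact: mF.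
Qed.

Lemma measurable_mxtrace n (F : S -> 'M[R]_n) : measurable_mx F ->
  measurable_fun setT (fun s => \tr (F s)).
Proof. by move=> mF; apply: measurable_sum => i; exact: mF. Qed.

End measurable_mx.

(** * Regularized Gram matrices *)

Section resolvent.
Context {R : realType}.

Lemma fsq_contract m n q (A : 'M[R]_(m, n)) (W : 'M[R]_(q, n)) :
  W *m W^T = 1%:M -> fsq (A *m W^T) <= fsq A.
Proof.
move=> oW; rewrite -subr_ge0 -(fsq_trmx A) -(fsq_trmx (A *m W^T)) trmx_mul trmxK.
by have := @fsq_pythagoras _ _ _ _ W^T A^T; rewrite trmxK => <-//; exact: fsq_ge0.
Qed.

Lemma fsq_row m n (A : 'M[R]_(m, n)) : fsq A = \sum_i fsq (row i A).
Proof.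
apply: eq_bigr => i _; rewrite /fsq big_ord1.
by apply: eq_bigr => j _; rewrite mxE.
Qed.

Lemma fsqZ m n (a : R) (A : 'M[R]_(m, n)) : fsq (a *: A) = a ^+ 2 * fsq A.
Proof.
rewrite mulr_sumr; apply: eq_bigr => i _; rewrite mulr_sumr.
by apply: eq_bigr => j _; rewrite mxE exprMn.
Qed.

Lemma fsq_eq0 m n (A : 'M[R]_(m, n)) : fsq A = 0 -> A = 0.
Proof.
move=> A0; apply/matrixP => i j; rewrite mxE; apply/eqP; rewrite -sqrf_eq0.
have H : \sum_j A i j ^+ 2 = 0.
  by apply: (psumr_eq0P (P := xpredT) _ A0) => // a _; apply: sumr_ge0 => b _; exact: sqr_ge0.
by apply/eqP; apply: (psumr_eq0P (P := xpredT) _ H) => // b _; exact: sqr_ge0.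
Qed.

Definition rgram r l (eps : R) (G : 'M[R]_(r, l)) : 'M[R]_r := G *m G^T + eps%:M.

Lemma rgram_form r l (eps : R) (G : 'M[R]_(r, l)) (v : 'rV[R]_r) :
  (v *m rgram eps G *m v^T) 0 0 = fsq (v *m G) + eps * fsq v.
Proof.
rewrite mulmxDr mulmxDl mxE; congr (_ + _).
  by rewrite fsq_tr trmx_mul !mulmxA /mxtrace big_ord1.
by rewrite mul_mx_scalar -scalemxAl mxE fsq_tr /mxtrace big_ord1.
Qed.

Lemma rgram_unit r l (eps : R) (G : 'M[R]_(r, l)) : 0 < eps ->
  rgram eps G \in unitmx.
Proof.
move=> e0; rewrite -row_free_unit; apply/row_freeP.
suff : kermx (rgram eps G) = 0 by move/eqP; rewrite kermx_eq0 => /row_freeP.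
apply/row_matrixP => i; rewrite row0; apply: fsq_eq0.
have /sub_kermxP H : (row i (kermx (rgram eps G)) <= kermx (rgram eps G))%MS by exact: row_sub.
have := rgram_form eps G (row i (kermx (rgram eps G))).
rewrite H mul0mx mxE => /esym /eqP.
rewrite paddr_eq0 ?fsq_ge0 ?mulr_ge0 ?fsq_ge0 ?ltW// => /andP[_].
by rewrite mulf_eq0 gt_eqF//= => /eqP.
Qed.

Lemma rgram_sym r l (eps : R) (G : 'M[R]_(r, l)) : (rgram eps G)^T = rgram eps G.
Proof. by rewrite linearD /= trmx_mul trmxK tr_scalar_mx. Qed.

(** If c is row i of [C], then c S is the i-th unit row for S = [rgram eps G], so the quadratic form
    c S c^T equals [C i i]. *)
Lemma resolvent_diagE r l (eps : R) (G : 'M[R]_(r, l)) i : 0 < eps ->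
  let C := invmx (rgram eps G) in
  C i i = fsq (row i C *m G) + eps * fsq (row i C).
Proof.
move=> e0 C; have uS := rgram_unit G e0; rewrite -rgram_form.
by rewrite -row_mul mulVmx// row1 -rowE !mxE.
Qed.

Lemma resolvent_diag_ge0 r l (eps : R) (G : 'M[R]_(r, l)) i : 0 < eps ->
  0 <= invmx (rgram eps G) i i.
Proof.
by move=> e0; rewrite resolvent_diagE// addr_ge0 ?mulr_ge0 ?fsq_ge0// ltW.
Qed.

(** Let c be row i of the inverse [C]. As W^T annihilates the other rows of [G], the product c G W^T
    is [C i i] times row i of G W^T. Contraction by W^T and [C i i ^+ 2 <= fsq c] turn
    [resolvent_diagE] into C_ii >= C_ii^2 (N + eps), and one divides by C_ii > 0. *)
Lemma resolvent_diag_le r l q (eps : R) (G : 'M[R]_(r, l)) (W : 'M[R]_(q, l)) i :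
  0 < eps -> W *m W^T = 1%:M -> (forall k, k != i -> row k G *m W^T = 0) ->
  invmx (rgram eps G) i i <= (fsq (row i G *m W^T) + eps)^-1.
Proof.
move=> e0 oW WG; set C := invmx _; pose c := row i C.
have uS := rgram_unit G e0.
have cS : c *m rgram eps G = delta_mx 0 i by rewrite -row_mul mulVmx// row1.
have form : C i i = fsq (c *m G) + eps * fsq c := resolvent_diagE G i e0.
have cG : fsq (C i i *: (row i G *m W^T)) <= fsq (c *m G).
  have -> : C i i *: (row i G *m W^T) = c *m G *m W^T; last exact: fsq_contract.
  rewrite -mulmxA; apply/rowP => j; rewrite [RHS]mxE (bigD1 i)//= big1 ?addr0.
    by rewrite [RHS]mulrC !mxE mulrC; congr (_ * _); apply: eq_bigr => b _; rewrite !mxE.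
  move=> k ki; have /rowP/(_ j) := WG k ki; rewrite !mxE => H.
  rewrite (_ : \sum_j0 _ = 0) ?mulr0// -[RHS]H.
  by apply: eq_bigr => b _; rewrite !mxE.
have cc : C i i ^+ 2 <= fsq c.
  rewrite /fsq big_ord1 (bigD1 i)//= mxE lerDl.
  by apply: sumr_ge0 => b _; exact: sqr_ge0.
have c0 : c != 0.
  apply/eqP => c0; have := congr1 (fun v : 'rV_r => v 0 i) cS.
  by rewrite c0 mul0mx !mxE !eqxx => /esym/eqP; rewrite oner_eq0.
have ci0 : 0 < C i i.
  rewrite form ltr_wpDl ?fsq_ge0// mulr_gt0// lt_def fsq_ge0 andbT.
  by apply: contra c0 => /eqP/fsq_eq0 ->.
rewrite fsqZ in cG; set N := fsq (row i G *m W^T) in cG *.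
have N0 : 0 <= N by exact: fsq_ge0.
rewrite -div1r ler_pdivlMr; last by rewrite ltr_wpDl.
rewrite -(ler_pM2l ci0) mulr1 [leRHS]form mulrDr mulrDr lerD//; first by rewrite mulrA -expr2.
by rewrite mulrA -expr2 mulrC ler_wpM2l// ltW.
Qed.

End resolvent.

Section resolvent_expectation.
Context {R : realType}.

Lemma iid_gaussian_split_le d (T : measurableType d) (P : probability T R)
    (K : finType) (a : pred K) (X : K -> T -> R) (f : famR R K -> \bar R)
    (c : T -> \bar R) :
  iid_gaussian P X -> measurable_fun setT f -> (forall x, 0 <= f x)%E ->
  measurable_fun setT c ->
  (forall w, \int[P]_w' f (fun k => if a k then X k w else X k w') <= c w)%E ->
  (\int[P]_w f (fun k => X k w) <= \int[P]_w c w)%E.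
Proof.
move=> iX mf f0 mc fc; rewrite (iid_gaussian_split a iX mf f0).
have iXX := iid_gaussian_decouple a iX iX.
have mff := measurableT_comp mf (measurable_famP (proj1 iXX)).
apply: ge0_le_integral => //.
- by move=> w _; apply: integral_ge0.
- exact: (@measurable_fun_fubini_tonelli_F _ _ _ _ _ P _ mff (fun z => f0 _)).
Qed.

Lemma integral_probability_cst d (T : measurableType d) (P : probability T R) (c : \bar R) :
  (\int[P]_w c = c)%E.
Proof.
by rewrite integral_cst// [X in (_ * X)%E]probability_setT mule1.
Qed.

Definition fam_mx m n (x : famR R ('I_m * 'I_n)%type) : 'M[R]_(m, n) :=
  \matrix_(i, j) x (i, j).

Lemma measurable_fam_mx m n : measurable_mx (@fam_mx m n).
Proof.
move=> i j; have := @measurable_coord R _ (i, j); congr (measurable_fun _ _).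
by apply/funext => x; rewrite mxE.
Qed.

Lemma iid_gaussian_row d (T : measurableType d) (P : probability T R)
    r l q (X : 'I_r * 'I_(l + q) -> T -> R) (U : 'M[R]_(l + q)) (i : 'I_r) :
  gaussian_invariant U -> iid_gaussian P X ->
  iid_gaussian P (fun (b : 'I_q) w => \sum_j U (rshift l b) j * X (i, j) w).
Proof.
move=> gU iX.
have inj1 : injective (fun p : 'I_(l + q) * 'I_1 => (i, p.1)).
  by move=> [a a'] [b b'] [->]; rewrite !ord1.
have iY := gU _ _ _ _ _ (iid_gaussian_sub inj1 iX).
have inj2 : injective (fun b : 'I_q => (rshift l b, ord0 : 'I_1)).
  by move=> a b [] /(@addnI l) ab; exact: val_inj.
exact: iid_gaussian_sub inj2 iY.
Qed.

(** Each diagonal entry is treated with its own row redrawn while the [r] other rows are fixed.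
    These leave [m.+3] orthogonal directions, in which the fresh row has independent standard
    Gaussian coordinates. *)
Lemma integral_resolvent_trace d (T : measurableType d) (P : probability T R)
    r m (X : 'I_r.+1 * 'I_(r + m.+3) -> T -> R) (eps : R) :
  0 < eps -> iid_gaussian P X ->
  (\int[P]_w (\tr (invmx (rgram eps (fam_mx (X^~ w)))))%:E <=
   (r.+1%:R / m.+1%:R)%:E)%E.
Proof.
move=> e0 iX; set n := (r + m.+3)%N in X iX *.
pose C (x : famR R ('I_r.+1 * 'I_n)%type) := invmx (rgram eps (fam_mx x)).
have mC : measurable_mx C.
  apply: measurable_mx_inv => [|x]; last exact: rgram_unit.
  apply: measurable_mxD; last exact: measurable_mx_cst.
  apply: measurable_mxM; first exact: measurable_fam_mx.
  by apply: measurable_mx_tr; exact: measurable_fam_mx.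
have C0 x i : 0 <= C x i i.
  exact: resolvent_diag_ge0.
have mCX i : measurable_fun setT (fun w => (C (X^~ w) i i)%:E).
  apply/measurable_EFinP.
  exact: (measurableT_comp (mC i i) (measurable_famP (proj1 iX))).
under eq_integral do rewrite /mxtrace -sumEFin.
rewrite ge0_integral_sum//; last by move=> i w _; rewrite lee_fin C0.
rewrite (_ : (_ / _)%:E = (\sum_(i < r.+1) (m.+1%:R^-1)%:E)%E); last first.
  by rewrite sumEFin; congr EFin; rewrite sumr_const card_ord -[RHS]mulr_natl.
apply: lee_sum => i _.
have mCi : measurable_fun setT (fun x => (C x i i)%:E).
  by apply/measurable_EFinP; exact: mC.
rewrite -[leRHS](integral_probability_cst P).
apply: (iid_gaussian_split_le (a := fun p => p.1 != i) iX mCi) => //.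
  by move=> x; rewrite lee_fin C0.
move=> w; have [U [oU gU] Uz] := gaussian_lq (row' i (fam_mx (X^~ w))) (leqnn r).
(* The rows of [W] are orthonormal and orthogonal to all rows of the matrix but row [i]; they depend
   on the fixed rows alone. *)
pose W := dsubmx U.
have oW : W *m W^T = 1%:M.
  apply/matrixP => a b; have /matrixP/(_ (rshift r a) (rshift r b)) := oU.
  rewrite !mxE (inj_eq (@rshift_inj _ _)) => <-.
  by apply: eq_bigr => j _; rewrite !mxE.
pose Y b w' := \sum_j U (rshift r b) j * X (i, j) w'.
have iY : iid_gaussian P Y by exact: iid_gaussian_row.
apply: le_trans (iid_gaussian_inv_sqsum e0 (card_ord m.+3) iY).
apply: ge0_le_integral => //.
- by move=> w' _; rewrite lee_fin C0.
- apply: (measurableT_comp mCi); apply: measurable_famP => k.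
  by case: (k.1 != i) => //; exact: (proj1 iX).
- apply/measurable_EFinP; apply: measurable_funV_gt0.
    apply: measurable_funD => //; apply: measurable_sum => b; apply: measurable_funX.
    exact: (proj1 iY).
  by move=> w'; rewrite ltr_wpDl// sumr_ge0// => b _; exact: sqr_ge0.
move=> w' _; rewrite lee_fin.
pose G := fam_mx (fun k => if k.1 != i then X k w else X k w').
have WG k : k != i -> row k G *m W^T = 0.
  case: (unliftP i k) => [k' -> _|->]; last by rewrite eqxx.
  apply/rowP => b.
  transitivity ((row' i (fam_mx (X^~ w)) *m U^T) k' (rshift r b)); last first.
    by move/matrixP: Uz => /(_ k' b); rewrite [LHS]mxE => ->; rewrite !mxE.
  by rewrite !mxE; apply: eq_bigr => j _; rewrite !mxE /= eq_sym neq_lift.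
apply: le_trans (resolvent_diag_le e0 oW WG) _.
rewrite lef_pV2 ?posrE ?ltr_wpDl ?fsq_ge0//; last first.
  by apply: sumr_ge0 => b _; exact: sqr_ge0.
rewrite lerD2r /fsq big_ord1 le_eqVlt; apply/orP; left; apply/eqP.
apply: eq_bigr => b _; congr (_ ^+ 2); rewrite mxE; apply: eq_bigr => j _.
by rewrite !mxE eqxx mulrC.
Qed.

Lemma integral_resolvent_trace_le d (T : measurableType d) (P : probability T R)
    r k p (X : 'I_r * 'I_(k + p) -> T -> R) (eps : R) :
  (r <= k)%N -> (2 <= p)%N -> 0 < eps -> iid_gaussian P X ->
  (\int[P]_w (\tr (invmx (rgram eps (fam_mx (X^~ w)))))%:E <=
   (k%:R / (p%:R - 1))%:E)%E.
Proof.
move=> rk p2 e0 iX; have p1 : 0 < p%:R - 1 :> R.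
  by rewrite subr_gt0 ltr1n.
case: r rk X iX => [|r] rk X iX.
  rewrite (eq_integral (fun=> 0%E)); last by move=> w _; rewrite /mxtrace big_ord0.
  by rewrite integral0 lee_fin divr_ge0// ltW.
(* [r] now counts the other rows, and [m.+3] the dimensions they leave. From [r < k] there are at
   least [p.+1] of these, so that [m.+1] is at least p - 1. *)
have [m lE] : exists m, (k + p = r + m.+3)%N.
  by exists (k + p - r - 3)%N; lia.
have mp : (p <= m.+2)%N by lia.
move: X iX; rewrite lE => X iX.
apply: le_trans (integral_resolvent_trace e0 iX) _; rewrite lee_fin.
apply: ler_pM => //.
  by rewrite ler_nat.
by rewrite lef_pV2 ?posrE// lerBlDr -[leRHS](natrD _ _ 1) ler_nat addn1.
Qed.

End resolvent_expectation.

(** * The randomized range finder *)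

Section range_finder.
Context {R : realType}.

(** Cauchy-Schwarz from Lagrange's identity: the difference of the two sides is half the sum of the
    squares of all [a i * b j - a j * b i]. *)
Lemma sqr_sum_le (K : finType) (a b : K -> R) :
  (\sum_k a k * b k) ^+ 2 <= (\sum_k a k ^+ 2) * (\sum_k b k ^+ 2).
Proof.
have : 0 <= \sum_i \sum_j (a i * b j - a j * b i) ^+ 2.
  by apply: sumr_ge0 => i _; apply: sumr_ge0 => j _; exact: sqr_ge0.
have -> : \sum_i \sum_j (a i * b j - a j * b i) ^+ 2 =
    \sum_i \sum_j a i ^+ 2 * b j ^+ 2 + \sum_i \sum_j a j ^+ 2 * b i ^+ 2
    - (\sum_i \sum_j (a i * b i) * (a j * b j)) *+ 2.
  rewrite -big_split /= -sumrMnl -sumrB; apply: eq_bigr => i _.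
  rewrite -big_split /= -sumrMnl -sumrB; apply: eq_bigr => j _.
  ring.
have -> : \sum_i \sum_j a i ^+ 2 * b j ^+ 2 = (\sum_k a k ^+ 2) * (\sum_k b k ^+ 2).
  by rewrite mulr_suml; apply: eq_bigr => i _; rewrite mulr_sumr.
have -> : \sum_i \sum_j a j ^+ 2 * b i ^+ 2 = (\sum_k a k ^+ 2) * (\sum_k b k ^+ 2).
  rewrite mulrC mulr_suml; apply: eq_bigr => i _; rewrite mulr_sumr.
  by apply: eq_bigr => j _; rewrite mulrC.
have -> : \sum_i \sum_j (a i * b i) * (a j * b j) = (\sum_k a k * b k) ^+ 2.
  by rewrite expr2 mulr_suml; apply: eq_bigr => i _; rewrite mulr_sumr.
lra.
Qed.

Lemma fsqM_le m n p (A : 'M[R]_(m, n)) (B : 'M[R]_(n, p)) :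
  fsq (A *m B) <= fsq A * fsq B.
Proof.
rewrite -(fsq_trmx B) /fsq mulr_suml; apply: ler_sum => i _.
rewrite mulr_sumr; apply: ler_sum => j _; rewrite mxE.
rewrite [leRHS](_ : _ = (\sum_k A i k ^+ 2) * (\sum_k B k j ^+ 2)); first exact: sqr_sum_le.
by congr (_ * _); apply: eq_bigr => k _; rewrite mxE.
Qed.

Lemma fsq_row_mx m n p (A : 'M[R]_(m, n)) (B : 'M[R]_(m, p)) :
  fsq (row_mx A B) = fsq A + fsq B.
Proof.
rewrite /fsq -big_split /=; apply: eq_bigr => i _; rewrite big_split_ord /=.
by congr (_ + _); apply: eq_bigr => j _; rewrite ?row_mxEl ?row_mxEr.
Qed.

(** Projecting off the range of [Q] annihilates Q D, so the left-hand residual is a projection of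
    [A - Q *m D]. *)
Lemma fsq_proj_le m n l (A : 'M[R]_(m, n)) (Q : 'M[R]_(m, l)) (D : 'M[R]_(l, n)) :
  Q^T *m Q = 1%:M -> fsq (A - Q *m Q^T *m A) <= fsq (A - Q *m D).
Proof.
move=> oQ; have -> : A - Q *m Q^T *m A = (A - Q *m D) - Q *m Q^T *m (A - Q *m D).
  rewrite mulmxBr [Q *m Q^T *m (Q *m D)]mulmxA -(mulmxA Q Q^T Q) oQ mulmx1.
  by rewrite opprB addrA subrK.
by rewrite fsq_pythagoras// gerBl fsq_ge0.
Qed.

(** Both terms on the right are nonnegative, so the trace dominates each of them; the two bounds
    control the [H] part and the [eps] part of the error respectively. *)
Lemma resolvent_trace_fsq r l (eps : R) (G : 'M[R]_(r, l)) : 0 < eps ->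
  let C := invmx (rgram eps G) in
  \tr C = fsq (G^T *m C) + eps * fsq C.
Proof.
move=> e0 C; have symC : C^T = C by rewrite /C trmx_inv rgram_sym.
have -> : G^T *m C = (C *m G)^T by rewrite trmx_mul symC.
rewrite fsq_trmx !fsq_row mulr_sumr -big_split /=; apply: eq_bigr => i _.
by rewrite row_mul; exact: resolvent_diagE.
Qed.

Lemma range_error_le m r s l (A1 : 'M[R]_(m, r)) (A2 : 'M[R]_(m, s))
    (G : 'M[R]_(r, l)) (H : 'M[R]_(s, l)) (Q : 'M[R]_(m, l)) (D : 'M[R]_l) (eps : R) :
  0 < eps -> Q^T *m Q = 1%:M -> row_mx A1 A2 *m col_mx G H = Q *m D ->
  forall C, C = invmx (rgram eps G) ->
  fsq (row_mx A1 A2 - Q *m Q^T *m row_mx A1 A2) <=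
  fsq A2 + fsq (eps *: (A1 *m C) + A2 *m H *m (- (G^T *m C))).
Proof.
move=> e0 oQ AQ C CE; have uS := rgram_unit G e0.
apply: le_trans (fsq_proj_le (row_mx A1 A2) (D *m row_mx (G^T *m C) 0) oQ) _.
rewrite mulmxA -AQ mul_mx_row mulmx0 opp_row_mx add_row_mx oppr0 addr0 fsq_row_mx addrC.
rewrite mul_row_col mulmxDl.
(* G G^T C = 1 - eps C by definition of [C]: regularization leaves the error eps A1 C in the first
   block. *)
have -> : A1 *m G *m (G^T *m C) = A1 - eps *: (A1 *m C).
  have := mulmxV uS; rewrite -CE {1}/rgram mulmxDl mul_scalar_mx => e.
  rewrite -mulmxA (mulmxA G) (_ : G *m G^T *m C = 1%:M - eps *: C); last by rewrite -e addrK.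
  by rewrite mulmxBr mulmx1 -scalemxAr.
by rewrite mulmxN opprD opprB addrA addrCA subrr addr0.
Qed.

(** Each entry is an affine form in the Gaussians, and the squared coefficients [A a i * K j b] sum
    to the product of the two norms. *)
Lemma integral_gaussian_fsq d (T : measurableType d) (P : probability T R)
    m s l q (X : 'I_s * 'I_l -> T -> R) (B : 'M[R]_(m, q)) (A : 'M[R]_(m, s))
    (K : 'M[R]_(l, q)) : iid_gaussian P X ->
  (\int[P]_w (fsq (B + A *m fam_mx (X^~ w) *m K))%:E <= (fsq B + fsq A * fsq K)%:E)%E.
Proof.
move=> iX.
have mX : measurable_mx (fun w => fam_mx (X^~ w)).
  by move=> i j; under eq_fun do rewrite mxE; exact: (proj1 iX).
have mF : measurable_mx (fun w => B + A *m fam_mx (X^~ w) *m K).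
  apply: measurable_mxD; first exact: measurable_mx_cst.
  apply: measurable_mxM; last exact: measurable_mx_cst.
  by apply: measurable_mxM => //; exact: measurable_mx_cst.
under eq_integral do rewrite /fsq -sumEFin.
rewrite ge0_integral_sum//; last 2 first.
- move=> a; apply/measurable_EFinP; apply: measurable_sum => b; apply: measurable_funX.
  exact: mF.
- by move=> a w _; rewrite lee_fin; apply: sumr_ge0 => b _; exact: sqr_ge0.
rewrite (_ : fsq B + fsq A * fsq K =
   \sum_a \sum_b (B a b ^+ 2 + \sum_(p : 'I_s * 'I_l) (A a p.1 * K p.2 b) ^+ 2)); last first.
  under [RHS]eq_bigr do rewrite big_split /=.
  rewrite big_split /=; congr (_ + _); rewrite {1}/fsq mulr_suml; apply: eq_bigr => a _.
  rewrite -(fsq_trmx K) /fsq mulr_sumr; apply: eq_bigr => b _.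
  rewrite mulr_suml -(pair_big_dep xpredT (fun _ => xpredT) (fun i j => (A a i * K j b) ^+ 2)) /=.
  apply: eq_bigr => i _; rewrite mulr_sumr; apply: eq_bigr => j _.
  by rewrite mxE exprMn.
rewrite -sumEFin; apply: lee_sum => a _.
under eq_integral do rewrite -sumEFin.
rewrite ge0_integral_sum//; last 2 first.
- by move=> b; apply/measurable_EFinP; apply: measurable_funX; exact: mF.
- by move=> b w _; rewrite lee_fin sqr_ge0.
rewrite -sumEFin; apply: lee_sum => b _.
apply: le_trans (iid_gaussian_linear_sqr (fun p : 'I_s * 'I_l => A a p.1 * K p.2 b) (B a b) iX).
rewrite le_eqVlt; apply/orP; left; apply/eqP; apply: eq_integral => w _.
congr ((_ ^+ 2)%:E); rewrite mxE; congr (_ + _); rewrite mxE.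
transitivity (\sum_i \sum_j A a i * K j b * X (i, j) w).
  rewrite exchange_big /=; apply: eq_bigr => j _; rewrite mxE mulr_suml.
  by apply: eq_bigr => i _; rewrite mxE mulrAC.
by rewrite pair_bigA /=; apply: eq_bigr => -[i j] _.
Qed.

End range_finder.

Section range_finder_expectation.
Context {R : realType}.

Lemma fam_mx_mul m n q (U : 'M[R]_(q, m)) (x : famR R ('I_m * 'I_n)%type) :
  fam_mx (fun p : 'I_q * 'I_n => \sum_j U p.1 j * x (j, p.2)) = U *m fam_mx x.
Proof.
by apply/matrixP => i j; rewrite !mxE; apply: eq_bigr => a _; rewrite mxE.
Qed.

Definition range_error (eps : R) m t s l (A1 : 'M[R]_(m, t)) (A2 : 'M[R]_(m, s))
    (y : famR R ('I_(t + s) * 'I_l)%type) : R :=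
  let G := usubmx (fam_mx y) in
  let C := invmx (rgram eps G) in
  fsq A2 + fsq (eps *: (A1 *m C) + A2 *m dsubmx (fam_mx y) *m (- (G^T *m C))).

Lemma measurable_range_resolvent (eps : R) t s l : 0 < eps ->
  measurable_mx (fun y : famR R ('I_(t + s) * 'I_l)%type =>
    invmx (rgram eps (usubmx (fam_mx y)))).
Proof.
move=> e0; apply: measurable_mx_inv => [|x]; last exact: rgram_unit.
have mG : measurable_mx (fun y : famR R ('I_(t + s) * 'I_l)%type => usubmx (fam_mx y)).
  move=> i j; have := @measurable_coord R _ (lshift s i, j); congr (measurable_fun _ _).
  by apply/funext => x; rewrite !mxE.
apply: measurable_mxD; last exact: measurable_mx_cst.
by apply: measurable_mxM => //; exact: measurable_mx_tr.
Qed.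

Lemma measurable_range_error (eps : R) m t s l (A1 : 'M[R]_(m, t)) (A2 : 'M[R]_(m, s)) :
  0 < eps -> measurable_fun setT (@range_error eps m t s l A1 A2).
Proof.
move=> e0; have mC := @measurable_range_resolvent eps t s l e0.
apply: measurable_funD => //; apply: measurable_fsq; apply: measurable_mxD.
  rewrite (_ : (fun _ => _) = fun y : famR R ('I_(t + s) * 'I_l)%type =>
      (eps *: A1) *m invmx (rgram eps (usubmx (fam_mx y)))); last first.
    by apply/funext => y; rewrite scalemxAl.
  by apply: measurable_mxM => //; exact: measurable_mx_cst.
apply: measurable_mxM.
  apply: measurable_mxM; first exact: measurable_mx_cst.
  move=> i j; have := @measurable_coord R _ (rshift t i, j); congr (measurable_fun _ _).
  by apply/funext => x; rewrite !mxE.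
apply: measurable_mxN; apply: measurable_mxM => //; apply: measurable_mx_tr.
move=> i j; have := @measurable_coord R _ (lshift s i, j); congr (measurable_fun _ _).
by apply/funext => x; rewrite !mxE.
Qed.

Lemma range_finder_eps d (T : measurableType d) (P : probability T R)
    m t s k p (A1 : 'M[R]_(m, t)) (A2 : 'M[R]_(m, s))
    (Y : 'I_(t + s) * 'I_(k + p) -> T -> R) (eps : R) :
  0 < eps -> (t <= k)%N -> (2 <= p)%N -> iid_gaussian P Y ->
  (\int[P]_w (range_error eps A1 A2 (Y^~ w))%:E <=
   (fsq A2 + (eps * fsq A1 + fsq A2) * (k%:R / (p%:R - 1)))%:E)%E.
Proof.
move=> e0 tk p2 iY.
pose G (y : famR R ('I_(t + s) * 'I_(k + p))%type) := usubmx (fam_mx y).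
pose H (y : famR R ('I_(t + s) * 'I_(k + p))%type) := dsubmx (fam_mx y).
pose C y := invmx (rgram eps (G y)).
pose F (y : famR R ('I_(t + s) * 'I_(k + p))%type) : \bar R := (range_error eps A1 A2 y)%:E.
have mF : measurable_fun setT F.
  by apply/measurable_EFinP; exact: measurable_range_error.
have mC : measurable_mx C by exact: measurable_range_resolvent.
have F0 y : (0 <= F y)%E by rewrite lee_fin addr_ge0// fsq_ge0.
have tC0 y : 0 <= \tr (C y).
  by apply: sumr_ge0 => i _; exact: resolvent_diag_ge0.
pose b := eps * fsq A1 + fsq A2.
have b0 : 0 <= b by rewrite addr_ge0 ?mulr_ge0 ?fsq_ge0// ltW.
have mtC : measurable_fun setT (fun w => (\tr (C (Y^~ w)))%:E).
  apply/measurable_EFinP.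
  exact: (measurableT_comp (measurable_mxtrace mC) (measurable_famP (proj1 iY))).
have iY1 : iid_gaussian P (fun q : 'I_t * 'I_(k + p) => Y (lshift s q.1, q.2)).
  by apply: iid_gaussian_sub iY => -[i j] [i' j'] /= /pair_equal_spec[/lshift_inj -> ->].
have iY2 : iid_gaussian P (fun q : 'I_s * 'I_(k + p) => Y (rshift t q.1, q.2)).
  by apply: iid_gaussian_sub iY => -[i j] [i' j'] /= /pair_equal_spec[/rshift_inj -> ->].
have GE w : G (Y^~ w) = fam_mx (fun q : 'I_t * 'I_(k + p) => Y (lshift s q.1, q.2) w).
  by apply/matrixP => i j; rewrite !mxE.
apply: (@le_trans _ _ (\int[P]_w ((fsq A2)%:E + b%:E * (\tr (C (Y^~ w)))%:E))%E).
  (* The first [t] rows, which form [G], are kept; the rows of [H] are redrawn, so that [C] is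
     constant in the inner integral. *)
  apply: (iid_gaussian_split_le (a := fun q : 'I_(t + s) * 'I_(k + p) => (q.1 < t)%N) iY mF F0).
    by apply: emeasurable_funD => //; exact: emeasurable_funM.
  move=> w; pose mix w' := fun q : 'I_(t + s) * 'I_(k + p) => if (q.1 < t)%N then Y q w else Y q w'.
  have Gmix w' : G (mix w') = G (Y^~ w).
    by apply/matrixP => i j; rewrite !mxE /mix /= ltn_ord.
  have Hmix w' : H (mix w') = fam_mx (fun q : 'I_s * 'I_(k + p) => Y (rshift t q.1, q.2) w').
    by apply/matrixP => i j; rewrite !mxE /mix /= ltnNge leq_addr.
  pose B0 := eps *: (A1 *m C (Y^~ w)); pose K := - ((G (Y^~ w))^T *m C (Y^~ w)).
  pose Z w' := fam_mx (fun q : 'I_s * 'I_(k + p) => Y (rshift t q.1, q.2) w').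
  have FE w' : F (mix w') = ((fsq A2)%:E + (fsq (B0 + A2 *m Z w' *m K))%:E)%E.
    by rewrite /F /range_error -/(G _) -/(H _) Hmix !Gmix EFinD.
  rewrite (eq_integral
      (fun w' => ((fsq A2)%:E + (fsq (B0 + A2 *m Z w' *m K))%:E)%E)); last first.
    by move=> w' _; exact: FE.
  rewrite ge0_integralD//; last 3 first.
  - by move=> w' _; rewrite lee_fin fsq_ge0.
  - by move=> w' _; rewrite lee_fin fsq_ge0.
  - apply/measurable_EFinP; apply: measurable_fsq.
    apply: measurable_mxD; first exact: measurable_mx_cst.
    apply: measurable_mxM; last exact: measurable_mx_cst.
    apply: measurable_mxM; first exact: measurable_mx_cst.
    by move=> i j; under eq_fun do rewrite mxE; exact: (proj1 iY).
  rewrite integral_probability_cst leeD2l//.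
  apply: le_trans (integral_gaussian_fsq B0 A2 K iY2) _.
  (* The two summands are eps^2 |A1 C|^2 and |A2|^2 |G^T C|^2. One factor [eps] of the first is
     spent on [eps * fsq C], which the trace dominates. *)
  rewrite lee_fin /B0 fsqZ /b mulrDl; apply: lerD.
    rewrite expr2 -!mulrA ler_wpM2l ?(ltW e0)//.
    apply: (@le_trans _ _ (eps * (fsq A1 * fsq (C (Y^~ w))))).
      by rewrite ler_wpM2l ?(ltW e0)// fsqM_le.
    rewrite mulrCA ler_wpM2l ?fsq_ge0//.
    by rewrite (resolvent_trace_fsq _ e0) lerDr fsq_ge0.
  rewrite ler_wpM2l ?fsq_ge0// /K -scaleN1r fsqZ sqrrN expr1n mul1r.
  by rewrite (resolvent_trace_fsq _ e0) lerDl mulr_ge0 ?fsq_ge0// ltW.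
rewrite ge0_integralD//; last 3 first.
- by move=> w _; rewrite lee_fin fsq_ge0.
- by move=> w _; rewrite mule_ge0 ?lee_fin.
- exact: emeasurable_funM.
rewrite integral_probability_cst [leRHS]EFinD leeD2l// [leRHS]EFinM.
rewrite ge0_integralZl//; last by move=> w _; rewrite lee_fin tC0.
apply: lee_wpmul2l; first by rewrite lee_fin.
under eq_integral do rewrite /C GE.
exact: integral_resolvent_trace_le.
Qed.

Lemma range_finder_expectation d (T : measurableType d) (P : probability T R)
    m J k p (A : 'M[R]_(m, J)) (V : 'M[R]_(k, m)) (X : 'I_J * 'I_(k + p) -> T -> R)
    (Q : famR R ('I_J * 'I_(k + p))%type -> 'M[R]_(m, k + p)) :
  (2 <= p)%N -> iid_gaussian P X ->
  measurable_fun setT (fun x => fsq (A - Q x *m (Q x)^T *m A)) ->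
  (forall x, (Q x)^T *m Q x = 1%:M) ->
  (forall x, exists D, A *m fam_mx x = Q x *m D) ->
  (\int[P]_w (fsq (A - Q (X^~ w) *m (Q (X^~ w))^T *m A))%:E <=
   ((1 + k%:R / (p%:R - 1)) * fsq (A - V^T *m V *m A))%:E)%E.
Proof.
move=> p2 iX mQ oQ AQ; set tau := fsq (A - V^T *m V *m A).
have p1 : 0 < p%:R - 1 :> R by rewrite subr_gt0 ltr1n.
(* Here t = min(k, J). If [A] has fewer than [k] columns, the second block is empty. *)
have [t [s [JE tk ks]]] : exists t s, [/\ J = (t + s)%N, (t <= k)%N & (t < k)%N -> s = 0%N].
  by exists (minn k J), (J - k)%N; split; lia.
move: A X Q iX mQ oQ AQ @tau; rewrite JE => A X Q iX mQ oQ AQ tau.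
have [U [oU gU] Uz] := gaussian_lq_trig (V *m A) (leq_addr s t).
have UtU : U^T *m U = 1%:M by apply: mulmx1C.
have VAU : rsubmx (V *m A *m U^T) = 0.
  apply/matrixP => i j; rewrite [LHS]mxE [RHS]mxE; apply: Uz; last by rewrite /= leq_addr.
  have [kt|/ks s0] := leqP k t; first exact: leq_trans (ltn_ord i) kt.
  by move: (ltn_ord j); rewrite {2}s0.
pose A1 := lsubmx (A *m U^T); pose A2 := rsubmx (A *m U^T).
have AU : A *m U^T = row_mx A1 A2 by rewrite hsubmxK.
(* After rotation V^T V A vanishes on the last [s] columns, so these columns of A - V^T V A are
   exactly [A2]. *)
have A2le : fsq A2 <= tau.
  rewrite /tau -(@fsq_mulmx_orth _ _ _ _ _ U^T) ?trmxK//.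
  rewrite mulmxBl -!mulmxA (mulmxA V) -(hsubmxK (V *m A *m U^T)) VAU mul_mx_row mulmx0.
  by rewrite AU opp_row_mx add_row_mx oppr0 addr0 fsq_row_mx lerDr fsq_ge0.
pose Y q w := \sum_j U q.1 j * X (j, q.2) w.
have iY : iid_gaussian P Y := gU _ _ _ _ _ iX.
have YE w : fam_mx (Y^~ w) = U *m fam_mx (X^~ w) by exact: (fam_mx_mul U (X^~ w)).
set I := (\int[P]_w _)%E.
have bound eps : 0 < eps ->
    (I <= (fsq A2 + (eps * fsq A1 + fsq A2) * (k%:R / (p%:R - 1)))%:E)%E.
  move=> e0; apply: le_trans (range_finder_eps A1 A2 e0 tk p2 iY).
  apply: ge0_le_integral => //.
  - by move=> w _; rewrite lee_fin fsq_ge0.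
  - apply/measurable_EFinP.
    exact: (measurableT_comp mQ (measurable_famP (proj1 iX))).
  - apply/measurable_EFinP.
    exact: (measurableT_comp (measurable_range_error A1 A2 e0) (measurable_famP (proj1 iY))).
  move=> w _; rewrite lee_fin; have [D AQD] := AQ (X^~ w).
  rewrite -(@fsq_mulmx_orth _ _ _ _ _ U^T) ?trmxK// mulmxBl -[_ *m A *m U^T]mulmxA AU.
  apply: (range_error_le (D := D) e0 (oQ _) _ (erefl _)).
  by rewrite -AU vsubmxK YE -mulmxA (mulmxA U^T) UtU mul1mx.
have I0 : (0 <= I)%E by apply: integral_ge0 => w _; rewrite lee_fin fsq_ge0.
have k0 : 0 <= k%:R / (p%:R - 1) :> R by rewrite divr_ge0// ltW.
apply: (@le_trans _ _ ((1 + k%:R / (p%:R - 1)) * fsq A2)%:E); last first.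
  by rewrite lee_fin ler_wpM2l// addr_ge0.
apply/lee_addgt0Pr => e e0; set kap := k%:R / (p%:R - 1) in k0 bound *.
have c0 : 0 < fsq A1 * kap + 1 by rewrite ltr_wpDl// mulr_ge0// fsq_ge0.
(* This [eps] makes the term in [fsq A1] at most [e]; the added 1 keeps the denominator positive. *)
apply: le_trans (bound (e / (fsq A1 * kap + 1)) _) _; first by rewrite divr_gt0.
rewrite -EFinD lee_fin.
have : e / (fsq A1 * kap + 1) * fsq A1 * kap <= e.
  by rewrite -mulrA mulrAC ler_pdivrMr// ler_wpM2l ?(ltW e0)// lerDl.
lra.
Qed.

End range_finder_expectation.

(** * Multilinear maps on tensors *)

Section kron.
Context {R : realType} {N : nat}.
Implicit Types d : 'I_N -> nat.

(** Distributivity with index types depending on [i]: passing to [fprod] and tagged sums reduces it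
    to the expansion over a single index type. *)
Lemma prod_sum_dffun (T : 'I_N -> finType) (f : forall i, T i -> R) :
  \prod_i \sum_(j : T i) f i j = \sum_(x : {dffun forall i, T i}) \prod_i f i (x i).
Proof.
rewrite [RHS](reindex (@dffun_of_fprod _ _)) /=; last exact/onW_bij/dffun_of_fprod_bij.
pose F i : {ffun T i -> R} := [ffun j => f i j].
transitivity (\sum_(t : fprod T) \prod_(i in 'I_N) F i (t i)); last first.
  by apply: eq_bigr => t _; apply: eq_bigr => i _; rewrite !ffunE.
rewrite big_fprod -(bigA_distr_big_dep _ (fun i u => untag 0 (F i) u)).
apply: eq_bigr => i _; rewrite -(big_tag (fun i j => F i j)).
by apply: eq_bigr => j _; rewrite ffunE.
Qed.

(** The Kronecker product of the [F m], acting on all modes at once. Sequences of mode products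
    become modewise matrix products, with no order left to track. *)
Definition kron d d' (F : forall m, 'M[R]_(d' m, d m)) (X : tensor R d) : tensor R d' :=
  [ffun i : midx d' => \sum_(x : midx d) (\prod_m F m (i m) (x m)) * X x].

Definition tdot d (X Y : tensor R d) : R := \sum_i X i * Y i.

Lemma tdotC d (X Y : tensor R d) : tdot X Y = tdot Y X.
Proof. by apply: eq_bigr => i _; rewrite mulrC. Qed.

Lemma tdotBl d (X Y Z : tensor R d) : tdot (X - Y) Z = tdot X Z - tdot Y Z.
Proof. by rewrite -sumrB; apply: eq_bigr => i _; rewrite !ffunE mulrBl. Qed.

Lemma tdot_ge0 d (X : tensor R d) : 0 <= tdot X X.
Proof. by apply: sumr_ge0 => i _; rewrite -expr2 sqr_ge0. Qed.

Lemma frobenius_normE d (X : tensor R d) : frobenius_norm X = Num.sqrt (tdot X X).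
Proof. by congr Num.sqrt; apply: eq_bigr => i _; rewrite expr2. Qed.

Lemma eq_kron d d' (F G : forall m, 'M[R]_(d' m, d m)) (X : tensor R d) :
  (forall m, F m = G m) -> kron F X = kron G X.
Proof.
move=> FG; apply/ffunP => i; rewrite !ffunE; apply: eq_bigr => x _.
by congr (_ * _); apply: eq_bigr => m _; rewrite FG.
Qed.

Lemma kron1 d (X : tensor R d) : kron (fun m => 1%:M) X = X.
Proof.
apply/ffunP => i; rewrite ffunE (bigD1 i)//= big1 ?mul1r => [|m _]; last by rewrite mxE eqxx.
rewrite big1 ?addr0// => x xi.
have [m mi] : exists m, i m != x m.
  apply/existsP; rewrite -[X in is_true X]negbK negb_exists.
  apply: contra xi => /forallP xi; apply/eqP/ffunP => m.
  by have := xi m; rewrite negbK => /eqP.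
by rewrite (bigD1 m)//= mxE (negbTE mi) !mul0r.
Qed.

Lemma kron_comp d1 d2 d3 (F : forall m, 'M[R]_(d3 m, d2 m))
    (G : forall m, 'M[R]_(d2 m, d1 m)) (X : tensor R d1) :
  kron F (kron G X) = kron (fun m => F m *m G m) X.
Proof.
apply/ffunP => i; rewrite !ffunE.
under eq_bigr do rewrite ffunE mulr_sumr.
rewrite exchange_big /=; apply: eq_bigr => x _.
under eq_bigr do rewrite mulrA -big_split /=.
rewrite -mulr_suml; congr (_ * _).
rewrite -(prod_sum_dffun (fun m j => F m (i m) j * G m j (x m))).
by apply: eq_bigr => m _; rewrite mxE.
Qed.

Lemma kronB d d' (F : forall m, 'M[R]_(d' m, d m)) (X Y : tensor R d) :
  kron F (X - Y) = kron F X - kron F Y.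
Proof.
apply/ffunP => i; rewrite !ffunE -sumrB; apply: eq_bigr => x _.
by rewrite !ffunE mulrBr.
Qed.

Lemma tdot_kron d d' (F : forall m, 'M[R]_(d' m, d m)) (X : tensor R d) (Y : tensor R d') :
  tdot (kron F X) Y = tdot X (kron (fun m => (F m)^T) Y).
Proof.
rewrite /tdot; under eq_bigr do rewrite ffunE mulr_suml.
rewrite exchange_big /=; apply: eq_bigr => x _; rewrite ffunE mulr_sumr.
apply: eq_bigr => i _; rewrite [RHS]mulrCA mulrA; congr (_ * _ * _).
by apply: eq_bigr => m _; rewrite mxE.
Qed.

(** In each mode F^T F is symmetric and idempotent, so [Z] is an orthogonal projection of [X] and
    Pythagoras applies. *)
Lemma tdot_kron_proj d d' (F : forall m, 'M[R]_(d' m, d m)) (X : tensor R d) :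
  (forall m, F m *m (F m)^T = 1%:M) ->
  let Z := kron (fun m => (F m)^T *m F m) X in
  tdot (X - Z) (X - Z) = tdot X X - tdot (kron F X) (kron F X).
Proof.
move=> oF Z.
have XZ : tdot X Z = tdot (kron F X) (kron F X) by rewrite tdot_kron kron_comp.
have ZZ : tdot Z Z = tdot (kron F X) (kron F X).
  rewrite /Z tdot_kron kron_comp -XZ; congr (tdot X _); apply: eq_kron => m.
  by rewrite trmx_mul trmxK -mulmxA (mulmxA (F m)) oF mul1mx.
by rewrite tdotBl 2![tdot _ (X - Z)]tdotC !tdotBl XZ [tdot Z X]tdotC XZ ZZ; ring.
Qed.

Lemma tdot_kron_le d d' (F : forall m, 'M[R]_(d' m, d m)) (X : tensor R d) :
  (forall m, F m *m (F m)^T = 1%:M) -> tdot (kron F X) (kron F X) <= tdot X X.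
Proof. by move=> oF; rewrite -subr_ge0 -(tdot_kron_proj _ oF) tdot_ge0. Qed.

(* The identity between index types of equal size, with no cast along the
   equality of the sizes. *)
Definition cid p q : 'M[R]_(p, q) := \matrix_(a, b) (val a == val b)%:R.

Lemma cid1 p : cid p p = 1%:M.
Proof. by apply/matrixP => a b; rewrite !mxE. Qed.

(** [M] in mode [n] and the identity elsewhere. With [cid] the definition makes sense for any two
    shapes; their agreement off [n] is left to the lemmas. *)
Definition mode_mx d d' (n : 'I_N) (M : 'M[R]_(d' n, d n)) (m : 'I_N) : 'M[R]_(d' m, d m) :=
  match eqVneq m n with
  | EqNotNeq h => castmx (congr1 d' (esym h), congr1 d (esym h)) M
  | NeqNotEq _ => cid _ _
  end.

Lemma mode_mx_self d d' (n : 'I_N) (M : 'M[R]_(d' n, d n)) : mode_mx M n = M.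
Proof.
rewrite /mode_mx; case: eqVneq => [h|/eqP//].
by rewrite (eq_irrelevance h erefl) castmx_id.
Qed.

Lemma mode_mx_neq d d' (n m : 'I_N) (M : 'M[R]_(d' n, d n)) : m != n ->
  mode_mx M m = cid _ _.
Proof. by rewrite /mode_mx => mn; case: eqVneq => // h; rewrite h eqxx in mn. Qed.

Lemma insert_idx_self d (n : 'I_N) (j : 'I_(d n)) (c : fidx d n) : insert_idx j c n = j.
Proof. by rewrite ffunE; case: eqVneq => [h|/eqP//]; apply: val_inj. Qed.

Lemma insert_idx_neq d (n : 'I_N) (j : 'I_(d n)) (c : fidx d n) (m : 'I_N) (mn : m != n) :
  insert_idx j c m = c (exist _ m mn).
Proof.
rewrite ffunE; case: eqVneq => [h|h]; first by case/eqP: (mn).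
by rewrite (bool_irrelevance h mn).
Qed.

Lemma mode_prod_kron d d' (n : 'I_N) (E : forall m, m != n -> d' m = d m)
    (M : 'M[R]_(d' n, d n)) (X : tensor R d) :
  mode_prod E M X = kron (mode_mx M) X.
Proof.
apply/ffunP => i; rewrite !ffunE; pose c := fiber_of E i.
(* A multi-index differing from [i] in some mode other than [n] meets a zero entry of [cid]; the
   others are determined by their [n]-th component. *)
rewrite (bigID (fun x : midx d => insert_idx (x n) c == x)) /=.
rewrite [X in _ = _ + X]big1 ?addr0; last first.
  move=> x xc; have [m mn mx] : exists2 m, m != n & val (i m) != val (x m).
    apply/exists_inP; rewrite -[X in is_true X]negbK negb_exists_in.
    apply: contra xc => /forall_inP H; apply/eqP/ffunP => m.
    have [->|mn] := eqVneq m n; first by rewrite insert_idx_self.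
    by rewrite insert_idx_neq ffunE; apply: val_inj => /=; have := H m mn; rewrite negbK => /eqP.
  by rewrite (bigD1 m)//= mode_mx_neq// mxE (negbTE mx) !mul0r.
rewrite [RHS](reindex_onto (fun j => insert_idx j c) (fun x : midx d => x n)) /=; last first.
  by move=> x /eqP.
rewrite [RHS](eq_bigl xpredT); last by move=> j; rewrite !insert_idx_self !eqxx.
apply: eq_bigr => j _; congr (_ * _).
rewrite (bigD1 n)//= mode_mx_self insert_idx_self big1 ?mulr1// => m mn.
by rewrite mode_mx_neq// mxE insert_idx_neq ffunE /= eqxx.
Qed.

Lemma tdot_unfolding d (n : 'I_N) (X : tensor R d) : tdot X X = fsq (unfolding n X).
Proof.
rewrite /fsq; under [RHS]eq_bigr do under eq_bigr do rewrite mxE.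
rewrite pair_bigA /=.
pose h (p : 'I_(d n) * 'I_(#|fidx d n|)) : midx d := insert_idx p.1 (enum_val p.2).
pose g (x : midx d) : 'I_(d n) * 'I_(#|fidx d n|) :=
  (x n, enum_rank ([ffun m : {m : 'I_N | m != n} => x (val m)] : fidx d n)).
rewrite /tdot (reindex h) /=; first by apply: eq_bigr => p _; rewrite expr2.
exists g => [[j c] _|x _].
  rewrite /g /h /= insert_idx_self; congr (_, _).
  rewrite -[RHS]enum_valK; congr enum_rank; apply/ffunP => -[m mn].
  by rewrite ffunE insert_idx_neq.
rewrite /h /g /= enum_rankK; apply/ffunP => m.
have [->|mn] := eqVneq m n; first by rewrite insert_idx_self.
by rewrite insert_idx_neq ffunE.
Qed.

Lemma unfoldingB d (n : 'I_N) (X Y : tensor R d) :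
  unfolding n (X - Y) = unfolding n X - unfolding n Y.
Proof. by apply/matrixP => j c; rewrite !mxE !ffunE. Qed.

Lemma multi_mode_prod_kron d (M : forall n : 'I_N, 'M[R]_(d n)) (X : tensor R d) :
  multi_mode_prod M X = kron M X.
Proof.
rewrite /multi_mode_prod; have : uniq (enum 'I_N) by exact: enum_uniq.
(* The statement is generalized to any list of distinct modes, with the identity in the modes not
   listed. *)
have -> : kron M X = kron (fun m => if m \in enum 'I_N then M m else 1%:M) X.
  by apply: eq_kron => m; rewrite mem_enum.
elim/last_ind: (enum 'I_N) => [_|r n IH]; first by rewrite -[LHS]kron1; exact: eq_kron.
rewrite rcons_uniq => /andP[nr ur]; rewrite foldl_rcons IH// mode_prod_kron kron_comp.
apply: eq_kron => m; rewrite mem_rcons inE.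
have [->|mn] := eqVneq m n; first by rewrite mode_mx_self (negbTE nr) mulmx1.
by rewrite mode_mx_neq// cid1 mul1mx.
Qed.

End kron.

Section casts.
Context {R : realType}.

Lemma cid_mul p q r : p = q -> @cid R p q *m cid q r = cid p r.
Proof. by move=> ->; rewrite cid1 mul1mx. Qed.

Lemma tr_cid p q : (@cid R p q)^T = cid q p.
Proof. by apply/matrixP => a b; rewrite !mxE eq_sym. Qed.

Lemma castmx_gram l l' q q' (e1 : l = l') (e2 : q = q') (A : 'M[R]_(l, q)) :
  (castmx (e1, e2) A)^T *m castmx (e1, e2) A = castmx (e2, e2) (A^T *m A).
Proof. by case: _ / e1; case: _ / e2; rewrite !castmx_id. Qed.

Lemma castmx_cogram l l' q q' (e1 : l = l') (e2 : q = q') (A : 'M[R]_(l, q)) :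
  castmx (e1, e2) A *m (castmx (e1, e2) A)^T = castmx (e1, e1) (A *m A^T).
Proof. by case: _ / e1; case: _ / e2; rewrite !castmx_id. Qed.

Lemma castmx1 l l' (e : l = l') : castmx (e, e) (1%:M : 'M[R]_l) = 1%:M.
Proof. by case: _ / e; rewrite castmx_id. Qed.

Lemma cid_conj p q (e : p = q) (A : 'M[R]_p) :
  (cid q p)^T *m castmx (e, e) A *m cid q p = A.
Proof. by case: _ / e; rewrite castmx_id cid1 trmx1 mul1mx mulmx1. Qed.

Lemma cid_intertwine p q (e : p = q) (A : 'M[R]_p) :
  castmx (e, e) A *m cid q p = cid q p *m A.
Proof. by case: _ / e; rewrite castmx_id cid1 mul1mx mulmx1. Qed.

Lemma fsq_castmx_proj p q J (e : q = p) (A : 'M[R]_(q, J)) (C : 'M[R]_p) :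
  fsq (castmx (e, erefl) A - C *m castmx (e, erefl) A) =
  fsq (A - castmx (esym e, esym e) C *m A).
Proof. by case: _ / e C => C; rewrite !castmx_id. Qed.

Lemma castmx_mull p q J l (e : q = p) (A : 'M[R]_(q, J)) (B : 'M[R]_(J, l)) :
  castmx (e, erefl) (A *m B) = castmx (e, erefl) A *m B.
Proof. by case: _ / e; rewrite !castmx_id. Qed.

End casts.

(** * The compression algorithm *)

Section algorithm.
Context {R : realType} {N : nat} (I : 'I_N -> nat) (l : nat).
Variable qr : forall n : 'I_N, 'M[R]_(I n, l) -> 'M[R]_(I n, l).
Hypothesis qrP : forall (n : 'I_N) (Y : 'M[R]_(I n, l)),
  exists U : 'M[R]_l, economic_qr Y (@qr n Y) U.

Definition cunfolding (n : 'I_N) (B : tensor R (cshape I l n)) : 'M[R]_(I n, ncols I l n) :=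
  castmx (cshape_self I l n, erefl) (unfolding n B).

Lemma qr_orth n Y : (@qr n Y)^T *m @qr n Y = 1%:M.
Proof. by have [U []] := qrP Y. Qed.

Lemma step_factorE (Om : forall n : 'I_N, 'M[R]_(ncols I l n, l)) (n : 'I_N)
    (B : tensor R (cshape I l n)) :
  step_factor qr Om B = @qr n (cunfolding B *m Om n).
Proof. by rewrite /step_factor castmx_mull. Qed.

Definition compress_mx (n : 'I_N) (Q : 'M[R]_(I n, l)) m :
    'M[R]_(cshape I l n.+1 m, cshape I l n m) :=
  mode_mx (castmx (esym (cshape_next I l n), esym (cshape_self I l n)) Q^T) m.

Lemma step_tensor_kron (n : 'I_N) (Q : 'M[R]_(I n, l)) (B : tensor R (cshape I l n)) :
  step_tensor Q B = kron (compress_mx Q) B.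
Proof. exact: mode_prod_kron. Qed.

Lemma compress_mx_orth (n : 'I_N) (Q : 'M[R]_(I n, l)) m : Q^T *m Q = 1%:M ->
  compress_mx Q m *m (compress_mx Q m)^T = 1%:M.
Proof.
move=> oQ; have [->|mn] := eqVneq m n.
  by rewrite /compress_mx mode_mx_self castmx_cogram trmxK oQ castmx1.
by rewrite /compress_mx mode_mx_neq// tr_cid cid_mul ?cid1// cshape_off.
Qed.

Lemma compress_mx_gram (n : 'I_N) (Q : 'M[R]_(I n, l)) m :
  (compress_mx Q m)^T *m compress_mx Q m =
  mode_mx (castmx (esym (cshape_self I l n), esym (cshape_self I l n)) (Q *m Q^T)) m.
Proof.
have [->|mn] := eqVneq m n.
  by rewrite /compress_mx !mode_mx_self castmx_gram trmxK.
by rewrite /compress_mx !mode_mx_neq// tr_cid cid_mul// cshape_off.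
Qed.

(** The compression has orthonormal rows, and its Gram matrix is Q Q^T in mode [n] and the identity
    elsewhere; the lost energy is therefore a projection residual, read off in the mode-[n]
    unfolding. *)
Lemma step_residual (n : 'I_N) (Q : 'M[R]_(I n, l)) (B : tensor R (cshape I l n)) :
  Q^T *m Q = 1%:M ->
  tdot B B - tdot (step_tensor Q B) (step_tensor Q B) =
  fsq (cunfolding B - Q *m Q^T *m cunfolding B).
Proof.
move=> oQ; rewrite step_tensor_kron -tdot_kron_proj; last by move=> m; exact: compress_mx_orth.
rewrite (eq_kron _ (compress_mx_gram Q)) -(mode_prod_kron (fun _ _ => erefl)).
by rewrite (tdot_unfolding n) unfoldingB unfolding_mode_prod -fsq_castmx_proj.
Qed.

Lemma rtc_tensor_irr Om X n (h h' : (n <= N)%N) :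
  rtc_tensor qr Om X h = rtc_tensor qr Om X h'.
Proof. by rewrite (bool_irrelevance h h'). Qed.

(** The algorithm does not look ahead: redrawing the test matrices of mode [n] and later leaves the
    tensor entering step [n] unchanged. *)
Lemma rtc_tensor_ext Om Om' X n (h : (n <= N)%N) :
  (forall m : 'I_N, (m < n)%N -> Om m = Om' m) ->
  rtc_tensor qr Om X h = rtc_tensor qr Om' X h.
Proof.
elim: n h => [//|n IH] h OmE /=.
rewrite (IH (ltnW h)); last by move=> m mn; apply: OmE; exact: ltnW.
by rewrite !step_factorE OmE.
Qed.

Lemma rtc_factorE Om X n (h : (n < N)%N) :
  rtc_factor qr Om X (Ordinal h) =
  @qr (Ordinal h) (cunfolding (n := Ordinal h) (rtc_tensor qr Om X (ltnW h)) *m Om (Ordinal h)).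
Proof. by rewrite /rtc_factor step_factorE (rtc_tensor_irr _ _ _ (ltnW h)). Qed.

Lemma rtc_tensorS Om X (n : 'I_N) :
  rtc_tensor qr Om X (ltn_ord n) =
  step_tensor (rtc_factor qr Om X n) (rtc_tensor qr Om X (ltnW (ltn_ord n))).
Proof.
case: n => n h /=; rewrite /rtc_factor /=.
by rewrite (bool_irrelevance (ltn_ord (Ordinal h)) h).
Qed.

(** [F m] is Q_m^T for the modes already compressed and the identity for the others, up to casts.
    Recording only the orthonormality of its rows and its Gram matrix keeps the casts out of later
    arguments. *)
Lemma rtc_tensor_kron Om (X : tensor R I) n (h : (n <= N)%N) :
  exists F : forall m, 'M[R]_(cshape I l n m, I m),
  [/\ rtc_tensor qr Om X h = kron F X, forall m, F m *m (F m)^T = 1%:M,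
      forall m : 'I_N, (n <= m)%N -> F m = cid _ _ &
      forall m : 'I_N, (m < n)%N ->
        (F m)^T *m F m = rtc_factor qr Om X m *m (rtc_factor qr Om X m)^T].
Proof.
elim: n h => [|n IH] h.
  exists (fun m => 1%:M); split => //= [|m|m _]; first by rewrite kron1.
    by rewrite trmx1 mulmx1.
  by rewrite cid1.
have [F [BF oF Fcid FQ]] := IH (ltnW h).
pose i := Ordinal h; pose Q := rtc_factor qr Om X i.
have oQ : Q^T *m Q = 1%:M by rewrite /Q rtc_factorE qr_orth.
pose C m : 'M[R]_(cshape I l n.+1 m, cshape I l n m) := compress_mx (n := i) Q m.
exists (fun m => C m *m F m); split.
- have -> : rtc_tensor qr Om X h = kron C (rtc_tensor qr Om X (ltnW h)).
    rewrite (rtc_tensor_irr _ _ h (ltn_ord i)) [LHS](rtc_tensorS Om X i).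
    by rewrite (rtc_tensor_irr _ _ (ltnW (ltn_ord i)) (ltnW h)) [LHS]step_tensor_kron.
  by rewrite BF kron_comp.
- move=> m; rewrite trmx_mul mulmxA -(mulmxA (C m)) oF mulmx1.
  exact: (@compress_mx_orth i Q m oQ).
- move=> m nm; rewrite /C /compress_mx mode_mx_neq; last by rewrite -val_eqE /= gtn_eqF.
  rewrite Fcid ?(ltnW nm)//; apply: cid_mul.
  by apply: (@cshape_off N I l i m); rewrite -val_eqE /= gtn_eqF.
- move=> m; rewrite ltnS leq_eqVlt => mn.
  rewrite trmx_mul mulmxA -(mulmxA (F m)^T) [(C m)^T *m _](@compress_mx_gram i Q m).
  have [mi|mi] := eqVneq m i.
    rewrite mi mode_mx_self Fcid//; exact: cid_conj.
  rewrite mode_mx_neq// cid1 mulmx1 FQ//; case/predU1P: mn => // mn.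
  by case/eqP: mi; apply: val_inj.
Qed.

Lemma rtc_error Om (X : tensor R I) :
  let Q := rtc_factor qr Om X in
  let E := X - multi_mode_prod (fun n => Q n *m (Q n)^T) X in
  tdot E E = \sum_(n < N) (let A := cunfolding (rtc_tensor qr Om X (ltnW (ltn_ord n))) in
                fsq (A - Q n *m (Q n)^T *m A)).
Proof.
move=> Q E; have [F [BF oF _ FQ]] := rtc_tensor_kron Om X (leqnn N).
have -> : tdot E E = tdot X X - tdot (kron F X) (kron F X).
  rewrite -tdot_kron_proj// /E multi_mode_prod_kron.
  by rewrite (eq_kron _ (fun m => FQ m (ltn_ord m))).
(* The squared norm of the [n]-th tensor depends on a proof of [n <= N]; extending it by 0 beyond
   [N] gives a sequence on all naturals, to which telescoping applies. *)
pose b n := if insub n is Some u then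
  tdot (rtc_tensor qr Om X (ltnSE (valP (u : 'I_N.+1))))
    (rtc_tensor qr Om X (ltnSE (valP u))) else 0.
have bE n (h : (n <= N)%N) : b n = tdot (rtc_tensor qr Om X h) (rtc_tensor qr Om X h).
  by rewrite /b insubT /= (rtc_tensor_irr _ _ _ h).
transitivity (\sum_(n < N) (b n - b n.+1)).
  rewrite -(big_mkord xpredT (fun n => b n - b n.+1)) /=.
  rewrite (eq_bigr (fun n => - (b n.+1 - b n))) => [|n _]; last by rewrite opprB.
  by rewrite sumrN telescope_sumr// opprB (bE 0%N (leq0n N)) (bE N (leqnn N)) BF.
apply: eq_bigr => n _; rewrite (bE n (ltnW (ltn_ord n))) (bE n.+1 (ltn_ord n)).
rewrite rtc_tensorS step_residual// /Q.
by case: n => n h; rewrite rtc_factorE qr_orth.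
Qed.

(** The earlier compressions act as the identity on mode [n], so they commute with V^T V there; on
    the other modes they are contractions, which cannot increase the residual. *)
Lemma rtc_low_rank Om (X : tensor R I) (n : 'I_N) k (V : 'M[R]_(k, I n)) :
  let A := cunfolding (rtc_tensor qr Om X (ltnW (ltn_ord n))) in
  fsq (A - V^T *m V *m A) <= fsq (unfolding n X - V^T *m V *m unfolding n X) :> R.
Proof.
have [F [BF oF Fcid _]] := rtc_tensor_kron Om X (ltnW (ltn_ord n)).
set C := V^T *m V; rewrite /= fsq_castmx_proj -unfolding_mode_prod -unfoldingB -tdot_unfolding.
rewrite -unfolding_mode_prod -unfoldingB -tdot_unfolding BF !mode_prod_kron kron_comp.
rewrite (_ : kron F X - _ = kron F (X - kron (mode_mx C) X)); first exact: tdot_kron_le.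
rewrite kronB kron_comp; congr (_ - _); apply: eq_kron => m.
have [->|mn] := eqVneq m n; last by rewrite !mode_mx_neq// !cid1 mul1mx mulmx1.
by rewrite !mode_mx_self Fcid// cid_intertwine.
Qed.

End algorithm.

(** * Expected compression error *)

Section measurable_compression.
Context {R : realType}.

(** Translates measurability for the sigma-algebra generated by entries into the entrywise notion
    used in the proof. *)
Lemma measurable_mx_funP d (S : measurableType d) m n m' n'
    (f : 'M[R]_(m, n) -> 'M[R]_(m', n')) (G : S -> 'M[R]_(m, n)) :
  measurable_mx_fun f -> measurable_mx G -> measurable_mx (fun s => f (G s)).
Proof.
move=> mf mG i j.
have mG' : measurable_fun setT (G : S -> g_sigma_algebraType (@mx_cylinders R m n)).
  apply: (@measurability _ _ S (g_sigma_algebraType (@mx_cylinders R m n)) setT _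
      (@mx_cylinders R m n)) => //.
  move=> _ [C [a [b [A [mA ->]]]] <-]; rewrite setTI.
  by rewrite -[X in measurable X]setTI; apply: (mG a b).
have mc : measurable_fun setT (fun M : g_sigma_algebraType (@mx_cylinders R m' n') => M i j : R).
  move=> _ A mA; rewrite setTI; apply: sub_sigma_algebra.
  by exists i, j, A.
exact: (measurableT_comp mc (measurableT_comp mf mG')).
Qed.

Lemma measurable_castmx d (S : measurableType d) m n m' n' (e : (m = m') * (n = n'))
    (F : S -> 'M[R]_(m, n)) :
  measurable_mx F -> measurable_mx (fun s => castmx e (F s)).
Proof.
case: e => e1 e2; case: _ / e1; case: _ / e2 => mF i j.
by under eq_fun do rewrite castmx_id; exact: mF.
Qed.

Section rtc.
Context {N : nat} (I : 'I_N -> nat) (l : nat) (X : tensor R I).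
Variable qr : forall n : 'I_N, 'M[R]_(I n, l) -> 'M[R]_(I n, l).
Hypothesis mqr : forall n : 'I_N, measurable_mx_fun (@qr n).
Local Notation K := {n : 'I_N & ('I_(ncols I l n) * 'I_l)%type}.

Definition fam_test (x : famR R K) (n : 'I_N) : 'M[R]_(ncols I l n, l) :=
  fam_mx (fun p : 'I_(ncols I l n) * 'I_l => x (Tagged _ p)).

Lemma measurable_fam_test n : measurable_mx (fam_test^~ n).
Proof.
move=> i j; have := @measurable_coord R K (Tagged _ (i, j)); congr (measurable_fun _ _).
by apply/funext => x; rewrite mxE.
Qed.

Definition measurable_tensor d (S : measurableType d) (e : 'I_N -> nat)
    (B : S -> tensor R e) : Prop :=
  forall i, measurable_fun setT (fun s => B s i).

Lemma measurable_rtc n (h : (n <= N)%N) :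
  measurable_tensor (fun x => rtc_tensor qr (fam_test x) X h).
Proof.
elim: n h => [|n IH] h; first by move=> i; exact: measurable_cst.
have mB := IH (ltnW h).
have mU : measurable_mx (fun x => unfolding (Ordinal h)
    (rtc_tensor qr (fam_test x) X (ltnW h) : tensor R (cshape I l (Ordinal h)))).
  move=> i j; have := mB (insert_idx i (enum_val j)); congr (measurable_fun _ _).
  by apply/funext => x; rewrite mxE.
move=> i.
rewrite (_ : (fun _ => _) = fun x : famR R K => \sum_(j < cshape I l n (Ordinal h))
    castmx (esym (cshape_next I l (Ordinal h)), esym (cshape_self I l (Ordinal h)))
      (step_factor qr (fam_test x) (n := Ordinal h) (rtc_tensor qr (fam_test x) X (ltnW h)))^T
      (i (Ordinal h)) j *
    rtc_tensor qr (fam_test x) X (ltnW h)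
      (insert_idx j (fiber_of (@cshape_off N I l (Ordinal h)) i))); last first.
  by apply/funext => x; rewrite /= ffunE.
apply: measurable_sum => j; apply: measurable_funM; last exact: mB.
apply: measurable_castmx; apply: measurable_mx_tr.
have mY : measurable_mx (fun x => castmx (cshape_self I l (Ordinal h), erefl)
    (unfolding (Ordinal h) (rtc_tensor qr (fam_test x) X (ltnW h)
       : tensor R (cshape I l (Ordinal h))) *m fam_test x (Ordinal h))).
  by apply: measurable_castmx; apply: measurable_mxM => //; exact: measurable_fam_test.
exact: (measurable_mx_funP (@mqr (Ordinal h)) mY).
Qed.

Lemma measurable_cunfolding (n : 'I_N) :
  measurable_mx (fun x => cunfolding (rtc_tensor qr (fam_test x) X (ltnW (ltn_ord n)))).
Proof.
apply: measurable_castmx => i j.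
have := measurable_rtc (ltnW (ltn_ord n)) (insert_idx i (enum_val j)).
by congr (measurable_fun _ _); apply/funext => x; rewrite mxE.
Qed.

Lemma measurable_rtc_factor (n : 'I_N) :
  measurable_mx (fun x => rtc_factor qr (fam_test x) X n).
Proof.
rewrite (_ : (fun _ => _) = fun x =>
    @qr n (cunfolding (rtc_tensor qr (fam_test x) X (ltnW (ltn_ord n))) *m fam_test x n)).
  have mY : measurable_mx (fun x =>
      cunfolding (rtc_tensor qr (fam_test x) X (ltnW (ltn_ord n))) *m fam_test x n).
    by apply: measurable_mxM; [exact: measurable_cunfolding|exact: measurable_fam_test].
  exact: (measurable_mx_funP (@mqr n) mY).
by apply/funext => x; rewrite /rtc_factor step_factorE.
Qed.

End rtc.

Lemma expectation_sqrt_le d (T : measurableType d) (P : probability T R)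
    (S : T -> R) (c : R) : measurable_fun setT S -> (forall w, 0 <= S w) ->
  (\int[P]_w (S w)%:E <= c%:E -> \int[P]_w (Num.sqrt (S w))%:E <= (Num.sqrt c)%:E)%E.
Proof.
move=> mS S0 Sc.
have c0 : 0 <= c.
  by rewrite -lee_fin; apply: le_trans Sc; apply: integral_ge0 => w _; rewrite lee_fin.
(* AM-GM: 2 b sqrt(S) <= S + b^2, for b slightly larger than sqrt(c), so that b > 0. *)
apply/lee_addgt0Pr => e e0; rewrite -EFinD; set b := Num.sqrt c + e.
have b0 : 0 < b by rewrite ltr_wpDl// sqrtr_ge0.
have cb : c <= b ^+ 2.
  rewrite -{1}(sqr_sqrtr c0) ler_pXn2r ?nnegrE ?sqrtr_ge0 ?(ltW b0)//.
  by rewrite /b lerDl ltW.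
have mR : measurable_fun setT (fun w => ((2 * b)^-1%:E * (S w)%:E)%E).
  by apply: emeasurable_funM => //; exact/measurable_EFinP.
apply: (@le_trans _ _ (\int[P]_w ((b / 2)%:E + (2 * b)^-1%:E * (S w)%:E))%E).
  apply: ge0_le_integral => //.
  - apply/measurable_EFinP; apply: measurableT_comp => //.
    exact: (continuous_measurable_fun (@sqrt_continuous R)).
  - exact: emeasurable_funD.
  move=> w _; rewrite -EFinM -EFinD lee_fin.
  have := sqr_ge0 (Num.sqrt (S w) - b).
  rewrite sqrrB sqr_sqrtr// => H.
  rewrite -(ler_pM2r (_ : 0 < 2 * b)); last by rewrite mulr_gt0.
  rewrite (mulrDl (b / 2)) (_ : (2 * b)^-1 * S w * (2 * b) = S w); last by field; rewrite gt_eqF.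
  by rewrite (_ : b / 2 * (2 * b) = b ^+ 2); [lra|field].
rewrite ge0_integralD//; last 2 first.
- by move=> w _; rewrite lee_fin divr_ge0// ltW.
- by move=> w _; rewrite mule_ge0// lee_fin// invr_ge0 mulr_ge0// ltW.
rewrite integral_probability_cst ge0_integralZl//; last 3 first.
- exact/measurable_EFinP.
- by move=> w _; rewrite lee_fin.
- by rewrite lee_fin invr_ge0 mulr_ge0// ltW.
apply: (@le_trans _ _ ((b / 2)%:E + (2 * b)^-1%:E * c%:E)%E).
  by rewrite leeD2l// lee_wpmul2l// lee_fin invr_ge0 mulr_ge0// ltW.
rewrite -EFinM -EFinD lee_fin.
rewrite -(ler_pM2r (_ : 0 < 2 * b)); last by rewrite mulr_gt0.
rewrite (mulrDl (b / 2)) (_ : (2 * b)^-1 * c * (2 * b) = c); last by field; rewrite gt_eqF.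
rewrite (_ : b / 2 * (2 * b) = b ^+ 2); last by field.
by rewrite (_ : b * (2 * b) = b ^+ 2 + b ^+ 2); [rewrite lerD2l|ring].
Qed.

End measurable_compression.

Lemma gaussian_test_matrices_iid d (T : measurableType d) (R : realType)
    (P : probability T R) N (r : 'I_N -> nat) (l : nat)
    (Om : forall n : 'I_N, 'I_(r n) -> 'I_l -> {RV P >-> R}) :
  gaussian_test_matrices Om ->
  iid_gaussian P (fun (q : {n : 'I_N & ('I_(r n) * 'I_l)%type}) (w : T) =>
    Om (tag q) (tagged q).1 (tagged q).2 w).
Proof.
move=> [gOm iOm]; split=> [q|A mA]; first exact: measurable_funP.
transitivity (\big[*%E/1%E]_q P (Om (tag q) (tagged q).1 (tagged q).2 @^-1` A q)).
  have := iOm [set: _]%SET A mA.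
  rewrite [in RHS](eq_bigl xpredT) => [<-|q]; last by rewrite inE.
  by congr (P _); apply/seteqP; split => [w h q _|w h q]; [exact: h|apply: h => /=; rewrite inE].
by apply: eq_bigr => q _; exact: (gOm _ _ _ (A q) (mA q)).
Qed.

Section mode_error.
Context {R : realType} {N : nat} (I : 'I_N -> nat) (k p : nat) (X : tensor R I).
Local Notation l := (k + p)%N.
Variable qr : forall n : 'I_N, 'M[R]_(I n, l) -> 'M[R]_(I n, l).
Hypothesis mqr : forall n : 'I_N, measurable_mx_fun (@qr n).
Hypothesis qrP : forall (n : 'I_N) (Y : 'M[R]_(I n, l)),
  exists U : 'M[R]_l, economic_qr Y (@qr n Y) U.
Local Notation K := {n : 'I_N & ('I_(ncols I l n) * 'I_l)%type}.

Definition mode_error (n : 'I_N) (x : famR R K) : R :=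
  let A := cunfolding (rtc_tensor qr (fam_test x) X (ltnW (ltn_ord n))) in
  fsq (A - rtc_factor qr (fam_test x) X n *m (rtc_factor qr (fam_test x) X n)^T *m A).

Lemma measurable_mode_error n : measurable_fun setT (mode_error n).
Proof.
have mA := @measurable_cunfolding R N I l X qr mqr n.
have mQ := @measurable_rtc_factor R N I l X qr mqr n.
apply: measurable_fsq; apply: measurable_mxD => //; apply: measurable_mxN.
apply: measurable_mxM => //; apply: measurable_mxM => //.
exact: measurable_mx_tr.
Qed.

Lemma integral_mode_error_le d (T : measurableType d) (P : probability T R)
    (G : K -> T -> R) (n : 'I_N) :
  (2 <= p)%N -> (l <= I n)%N -> iid_gaussian P G ->
  (\int[P]_w (mode_error n (G^~ w))%:E <=
   ((1 + k%:R / (p%:R - 1)) *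
    \sum_(s <- drop k (singular_values (unfolding n X))) s ^+ 2)%:E)%E.
Proof.
move=> p2 lI iG; set c := (_ * _)%:E.
have [V oV AV] := best_rank_approx (unfolding n X) (leq_trans (leq_addr p k) lI).
pose tg (pq : 'I_(ncols I l n) * 'I_l) : K := Tagged (fun m => ('I_(ncols I l m) * 'I_l)%type) pq.
have iGn : iid_gaussian P (fun pq => G (tg pq)).
  by apply: (iid_gaussian_sub _ iG) => a b; exact: eq_from_Tagged.
have mf : measurable_fun setT (fun x => (mode_error n x)%:E).
  by apply/measurable_EFinP; exact: measurable_mode_error.
have f0 x : (0 <= (mode_error n x)%:E)%E by rewrite lee_fin fsq_ge0.
have mc : measurable_fun [set: T] (fun=> c) by exact: measurable_cst.
rewrite -[leRHS](integral_probability_cst P).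
(* The draws of the modes before [n] are kept, which freezes the matrix [A]. All later ones are
   redrawn too, but the error of mode [n] sees only the test matrix of mode [n] among them. *)
apply: (iid_gaussian_split_le (a := fun q : K => (tag q < n)%N) iG mf f0 mc) => w.
pose A := cunfolding (rtc_tensor qr (fam_test (G^~ w)) X (ltnW (ltn_ord n))).
pose Q (x : famR R ('I_(ncols I l n) * 'I_l)%type) := @qr n (A *m fam_mx x).
pose mix w' (q : K) := if (tag q < n)%N then G q w else G q w'.
have AE w' : cunfolding (rtc_tensor qr (fam_test (mix w')) X (ltnW (ltn_ord n))) = A.
  congr cunfolding; apply: rtc_tensor_ext => m mn.
  by apply/matrixP => i j; rewrite !mxE /mix /= mn.
have OE w' : fam_test (mix w') n = fam_mx (fun pq => G (tg pq) w').
  by apply/matrixP => i j; rewrite !mxE /mix /= ltnn.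
have errE w' : mode_error n (mix w') =
    fsq (A - Q (fun pq => G (tg pq) w') *m (Q (fun pq => G (tg pq) w'))^T *m A).
  by rewrite /mode_error AE /rtc_factor step_factorE AE OE.
under eq_integral do rewrite errE.
apply: le_trans (range_finder_expectation V p2 iGn _ _ _) _.
- have mQ : measurable_mx Q.
    apply: (measurable_mx_funP (@mqr n) (G := fun x => (A *m fam_mx x)%R)).
    by apply: measurable_mxM; [exact: measurable_mx_cst|exact: measurable_fam_mx].
  apply: measurable_fsq; apply: measurable_mxD; first exact: measurable_mx_cst.
  apply: measurable_mxN; apply: measurable_mxM; last exact: measurable_mx_cst.
  by apply: measurable_mxM => //; exact: measurable_mx_tr.
- by move=> x; exact: qr_orth.
- by move=> x; have [U [_ _ ->]] := qrP (A *m fam_mx x); exists U.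
rewrite lee_fin ler_wpM2l//; first by rewrite addr_ge0// divr_ge0// subr_ge0 ler1n ltnW.
exact: le_trans (rtc_low_rank qrP _ _ _) AV.
Qed.

End mode_error.

Close Scope classical_set_scope.
Unset Implicit Arguments.

Theorem theorem1 (R : realType) (N : nat) (I : 'I_N -> nat) (X : tensor R I)
    (k p : nat) (d : measure_display) (T : measurableType d)
    (P : probability T R)
    (Om : forall n : 'I_N, 'I_(ncols I (k + p) n) -> 'I_(k + p) -> {RV P >-> R})
    (qr : forall n : 'I_N, 'M[R]_(I n, k + p) -> 'M[R]_(I n, k + p)) :
  (2 <= k)%N -> (2 <= p)%N -> (forall n : 'I_N, (k + p <= I n)%N) ->
  gaussian_test_matrices Om ->
  (forall n : 'I_N, measurable_mx_fun (qr n)) ->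
  (forall (n : 'I_N) (Y : 'M[R]_(I n, k + p)),
     exists U : 'M[R]_(k + p), economic_qr Y (qr n Y) U) ->
  ('E_P[fun w : T =>
          let Q : forall n : 'I_N, 'M[R]_(I n, k + p) :=
            rtc_factor qr (fun n : 'I_N => sample_mx (Om n) w) X in
          frobenius_norm
            (X - multi_mode_prod (fun n : 'I_N => Q n *m (Q n)^T) X)%R]
   <= (Num.sqrt (1 + k%:R / (p%:R - 1)) *
       Num.sqrt (\sum_(n < N)
         \sum_(s <- drop k (singular_values (unfolding n X))) s ^+ 2))%:E)%E.
Proof.
move=> _ p2 lI gOm mqr qrP; have iG := gaussian_test_matrices_iid gOm.
set G := (X in iid_gaussian _ X) in iG.
have GE w : (fun n => sample_mx (Om n) w) = fam_test (G^~ w).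
  by apply/functional_extensionality_dep => n; apply/matrixP => i j; rewrite !mxE.
have m0 n w : 0 <= mode_error X qr n (G^~ w) by exact: fsq_ge0.
have mG n : measurable_fun setT (fun w => mode_error X qr n (G^~ w)).
  exact: (measurableT_comp (measurable_mode_error X mqr n) (measurable_famP (proj1 iG))).
rewrite unlock (eq_integral
    (fun w => (Num.sqrt (\sum_(n < N) mode_error X qr n (G^~ w)))%:E)); last first.
  by move=> w _; rewrite /= frobenius_normE (rtc_error qrP) GE.
rewrite -sqrtrM; last by rewrite addr_ge0// divr_ge0// subr_ge0 ler1n ltnW.
apply: expectation_sqrt_le.
- exact: measurable_sum.
- by move=> w; exact: sumr_ge0.
under eq_integral do rewrite -sumEFin.
rewrite ge0_integral_sum//; last 2 first.
- by move=> n; exact/measurable_EFinP.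
- by move=> n w _; rewrite lee_fin.
rewrite mulr_sumr -sumEFin; apply: lee_sum => n _.
exact: integral_mode_error_le.
Qed.
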